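(* Let $G$ be a connected simple graph of order $n$ and minimum degree at least $d\ge 3$. Then $$\mu(G)\ge\frac{(d-1)\mu(P_n)}{\bigl(1+\sqrt{d(d+1)\mu(P_n)}\bigr)^2}.$$ For every fixed $d\ge3$, this gives $$\min_{\substack{|V(G)|=n\\ G\text{ connected},\ \delta(G)\ge d}}\mu(G)=(1+o(1))\frac{(d-1)\pi^2}{n^2}\qquad(n\to\infty).$$ For each fixed odd $d\ge3$, the same asymptotic equality holds when the minimum is restricted to connected $d$-regular graphs and $n$ tends to infinity through even integers.
   Context: All graphs are finite, simple and undirected. $\mu(G)$ is the algebraic connectivity, the second smallest eigenvalue of the Laplacian of $G$; $\delta(G)$ is the minimum degree; $P_n$ is the path on $n$ vertices, for which $\mu(P_n)=2(1-\cos(\pi/n))$. *)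

(* Defs.v *)
From HB Require Import structures.
From mathcomp Require Import all_boot all_order all_algebra.
From mathcomp Require Import all_classical all_reals all_analysis.
From mathcomp Require Import complex.

Set Implicit Arguments.
Unset Strict Implicit.
Unset Printing Implicit Defensive.

Import Order.TTheory GRing.Theory Num.Theory.

Local Open Scope ring_scope.
Local Open Scope classical_set_scope.

Record sgraph : Type := SGraph {
  vertex :> finType;
  adj : rel vertex;
  adj_sym : symmetric adj;
  adj_irr : irreflexive adj }.

Definition connected_graph (G : sgraph) : Prop :=
  (0 < #|G|)%N /\ forall x y : G, connect (@adj G) x y.

Definition degree (G : sgraph) (x : G) : nat := #|[set y | adj x y]%SET|.

(* Every degree is less than #|G|, so the initial value #|G| is irrelevant
   as soon as G has a vertex. *)
Definition min_degree (G : sgraph) : nat :=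
  \big[minn/#|G|]_(x : G) degree x.

Definition regular (d : nat) (G : sgraph) : Prop :=
  forall x : G, degree x = d.

Definition path_adj (n : nat) : rel 'I_n :=
  fun i j => (i.+1 == j :> nat) || (j.+1 == i :> nat).

Lemma path_adj_sym n : symmetric (@path_adj n).
Proof. by move=> i j; rewrite /path_adj orbC. Qed.

Lemma path_adj_irr n : irreflexive (@path_adj n).
Proof. by move=> i; rewrite /path_adj orbb gtn_eqF. Qed.

Definition path_graph (n : nat) : sgraph :=
  SGraph (@path_adj_sym n) (@path_adj_irr n).

Definition laplacian (R : realType) (G : sgraph) : 'M[R]_#|G| :=
  \matrix_(i, j) ((degree (enum_val i))%:R *+ (i == j)
                  - (adj (enum_val i) (enum_val j))%:R).

Lemma laplacian_sym (R : realType) (G : sgraph) :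
  (laplacian R G)^T = laplacian R G.
Proof.
apply/matrixP => i j; by rewrite !mxE adj_sym; case: eqVneq => [->|_] //; rewrite !mulr0n.
Qed.

(* The eigenvalues in nondecreasing order, repeated according to multiplicity;
   they exist for every symmetric matrix by spectrumP (the value is [::] when
   the characteristic polynomial does not split over R). *)
Definition spectrum (R : realType) (n : nat) (A : 'M[R]_n) : seq R :=
  xget [::] [set s : seq R |
    sorted <=%R s /\ char_poly A = \prod_(x <- s) ('X - x%:P)].

Lemma char_poly_conj (F : fieldType) n (P D : 'M[F]_n) : P \in unitmx ->
  char_poly (invmx P *m D *m P) = char_poly D.
Proof.
move=> uP; rewrite /char_poly /char_poly_mx.
have -> : 'X%:M - map_mx (@polyC F) (invmx P *m D *m P) =
  map_mx polyC (invmx P) *m ('X%:M - map_mx polyC D) *m map_mx polyC P.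
  rewrite mulmxBr mulmxBl -!map_mxM; congr (_ - _).
  by rewrite scalar_mxC -mulmxA -map_mxM mulVmx // map_mx1 mulmx1.
by rewrite !det_mulmx mulrAC -det_mulmx -map_mxM mulVmx // map_mx1 det1 mul1r.
Qed.

Lemma spectrumP (R : realType) (n : nat) (A : 'M[R]_n) : A^T = A ->
  sorted <=%R (spectrum A) /\
  char_poly A = \prod_(x <- spectrum A) ('X - x%:P).
Proof.
move=> Asym.
suff [s sP] : exists s : seq R, char_poly A = \prod_(x <- s) ('X - x%:P).
  rewrite /spectrum; case: xgetP => [_ _ //|/(_ (sort <=%R s))].
  case; split; first exact: sort_le_sorted.
  by rewrite sP; apply: perm_big; rewrite perm_sym perm_sort.
pose f : {rmorphism R -> R[i]} := real_complex R.
pose B := map_mx f A.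
have Breal : B \is a mxOver Num.real.
  apply/mxOverP => i j; rewrite mxE; apply/complex_realP; by exists (A i j).
have Bh : B \is hermsymmx.
  apply: realsym_hermsym => //.
  apply/is_hermitianmxP; rewrite expr0 scale1r.
  apply/matrixP => i j; rewrite !mxE; congr (f _).
  by move/matrixP: Asym => /(_ i j); rewrite mxE.
have Bn := hermitian_normalmx Bh.
have Dr := hermitian_spectral_diag_real Bh.
have E : B = invmx (spectralmx B) *m diag_mx (spectral_diag B) *m spectralmx B
  by exact/orthomx_spectralP.
set D := spectral_diag B in Dr E *.
exists [seq complex.Re (D 0 i) | i <- enum 'I_n].
apply: (map_poly_inj f).
rewrite map_char_poly -/B {1}E char_poly_conj ?spectral_unit //.
rewrite char_poly_trig ?diag_mx_is_trig // rmorph_prod /= big_map big_enum /=.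
apply: eq_bigr => i _; rewrite rmorphB /= map_polyX map_polyC /= mxE eqxx mulr1n.
by have /mxOverP/(_ 0 i)/complex_realP [x ->] := Dr.
Qed.

(* The sequence is indexed from 0, so that index 1 is the second smallest
   eigenvalue. *)
Definition algebraic_connectivity (R : realType) (G : sgraph) : R :=
  (spectrum (laplacian R G))`_1.

Definition is_minimum (R : realType) (S : set R) (m : R) : Prop :=
  S m /\ lbound S m.

(* Main.v *)
(* Lower bound. List the vertices so that a Fiedler vector f is nondecreasing,
   and let r_k be the gap f_(k+1) - f_k divided by the current phi_k of f through
   the k-th cut. By Thomson's principle, rho_j = r_0 + ... + r_(j-1) satisfies
   rho_j - rho_i <= R(i, j), the effective resistance between the first i + 1
   vertices and those from j on. In a graph of minimum degree K + 1,
   K R(i, j) <= j - i + K + 1: consider the harmonic potential between the two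
   sets; the vertices between two consecutive gaps longer than 1/K form blocks,
   and each block has enough vertices to pay for its share of the resistance.
   Truncating the increments of rho at 1/K, and letting the truncated sequence
   catch up with rho, yields a vector h on the path with K E_path(h) <= E(f) and
   K |f - h|^2 <= (K + 1)^2 E(f), so the triangle inequality for the distance
   to the constants gives the bound.

   Upper bound. Take a long chain of k complete graphs on K + 2 vertices, each with
   an edge removed, closed by two bounded end graphs: the Fiedler vector of the
   path on k vertices, extended as an electric potential to the chain, is a test
   vector. The minimum exists because a graph of order n has finitely many
   possible adjacency matrices. *)

Require Import Defs.
From HB Require Import structures.
From mathcomp Require Import all_boot all_order all_algebra.
From mathcomp Require Import all_classical all_reals all_analysis.
From mathcomp Require Import complex.
From mathcomp Require Import zify ring lra.

Set Implicit Arguments.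
Unset Strict Implicit.
Unset Printing Implicit Defensive.

Import Order.TTheory GRing.Theory Num.Theory.
Import numFieldNormedType.Exports.

Local Open Scope ring_scope.

(** * Currents and effective resistance *)

(** The constant [K = d - 1] counts vertices per unit of resistance. A bead of the necklace with one
    link uses [K + 2] vertices and has resistance [1/K + 1/K + 1 = (K + 2)/K], so each vertex brings
    [1/K]; the resistance estimate says that, up to a bounded error, minimum degree [K + 1] allows
    no more. This is why the two bounds meet. The obstacle is that this holds only on average: a
    bridge alone has resistance [1], so [rho] may jump by more than [1/K], and [f] itself is no good
    test vector on the path. As [resistance_window] overshoots by [K + 1] vertices at most, the
    truncated sequence trails [rho] by at most [(K + 1)/K] in value and [K + 1] in index, and both
    factors enter [(K + 1)^2]. In the resistance estimate, a long gap crossed by [c] edges has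
    length at most [1/c], while these edges stand for up to [c + 1] neighbours missing from the
    blocks at its two sides. The balance [K/c + c + 1 <= K + 2] is strict for [2 <= c <= K - 1]; the
    surplus rescues the one critical type of block, with [K + 1] vertices, one edge down from [v]
    and one up from [w]. *)

Section Dirichlet.
Variables (R : realFieldType) (T : finType) (e : rel T).
Hypothesis esym : symmetric e.
Implicit Types (u r : T -> R) (S A B : {set T}).

Definition flux u x : R := \sum_y (e x y)%:R * (u y - u x).

(** The sum runs over ordered pairs, so every edge counts twice; hence the factors [*+ 2] below. *)
Definition dirichlet u r : R :=
  \sum_x \sum_y (e x y)%:R * ((u y - u x) * (r y - r x)).

(** Green's formula: exchanging [x] and [y] turns the terms with [r y] into the negatives of those
    with [r x]. *)
Lemma dirichletE u r : dirichlet u r = - (\sum_x flux u x * r x) *+ 2.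
Proof.
rewrite /dirichlet /flux.
have h1 : \sum_x \sum_y (e x y)%:R * ((u y - u x) * r x) =
          \sum_x (\sum_y (e x y)%:R * (u y - u x)) * r x.
  by apply: eq_bigr => x _; rewrite mulr_suml; apply: eq_bigr => y _; rewrite mulrA.
have h2 : \sum_x \sum_y (e x y)%:R * ((u y - u x) * r y) =
          - \sum_x (\sum_y (e x y)%:R * (u y - u x)) * r x.
  rewrite -h1 exchange_big -sumrN; apply: eq_bigr => x _; rewrite -sumrN.
  by apply: eq_bigr => y _; rewrite esym; ring.
set S := (X in - X *+ 2); transitivity (- S - S); last by rewrite mulr2n.
rewrite -{1}h2 {}/S -h1 -sumrB; apply: eq_bigr => x _.
rewrite -sumrB; apply: eq_bigr => y _; ring.
Qed.

(** Edges inside [S] cancel, since [u y - u x] is antisymmetric. *)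
Lemma flux_cut u S :
  \sum_(x in S) flux u x =
  \sum_(x in S) \sum_(y in ~: S) (e x y)%:R * (u y - u x).
Proof.
have h0 : \sum_(x in S) \sum_(y in S) (e x y)%:R * (u y - u x) = 0.
  apply/eqP; rewrite -eqNr; apply/eqP.
  rewrite {2}exchange_big -sumrN; apply: eq_bigr => x _; rewrite -sumrN.
  by apply: eq_bigr => y _; rewrite esym; ring.
rewrite -[RHS]add0r -[X in _ = X + _]h0 -big_split /=; apply: eq_bigr => x _.
by rewrite /flux (bigID (mem S)) /=; congr (_ + _); apply: eq_bigl => y; rewrite inE.
Qed.

Hypothesis econn : forall x y, connect e x y.

Lemma connected_closed S x : x \in S ->
  (forall y z, y \in S -> e y z -> z \in S) -> forall y, y \in S.
Proof.
move=> xS clS y; have /connectP [p + ->] := econn x y.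
elim: p x xS => [|z p IH] x xS //= /andP [xz pz].
by apply: IH pz; apply: clS xz.
Qed.

Lemma flux_max u x : flux u x = 0 -> (forall y, u y <= u x) ->
  forall y, e x y -> u y = u x.
Proof.
move=> f0 umax y exy; apply/eqP; rewrite eq_le umax /=.
have : \sum_z (e x z)%:R * (u x - u z) = 0.
  by rewrite -[RHS]oppr0 -[X in _ = - X]f0 -sumrN; apply: eq_bigr => z _; ring.
move/eqP; rewrite psumr_eq0 => [|z _].
  by move=> /allP /(_ y); rewrite mem_index_enum exy mul1r subr_eq0 => /(_ isT) /eqP ->.
by apply: mulr_ge0; rewrite ?ler0n // subr_ge0.
Qed.

(** If the maximum exceeded [M], the set where it is attained would avoid [C] and be closed under
    [e], so by connectedness it would contain [c]. *)
Lemma max_principle u (C : {set T}) c M : c \in C ->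
  (forall x, x \notin C -> flux u x = 0) -> (forall x, x \in C -> u x <= M) ->
  forall x, u x <= M.
Proof.
move=> cC harm uM x0.
have [x _ xmax] : exists2 x, true & forall y, u y <= u x.
  case: (@arg_maxP _ R T c xpredT u) => // x _ h; exists x => // y; exact: h.
apply: le_trans (xmax _) _; rewrite leNgt; apply/negP => Mx.
suff : c \in [set y | u y == u x].
  by rewrite inE => /eqP ucx; move: (uM _ cC); rewrite ucx leNgt Mx.
apply: (@connected_closed _ x); first by rewrite inE.
move=> y z; rewrite !inE => /eqP uyx eyz; rewrite -uyx; apply/eqP.
apply: flux_max eyz => [|t]; last by rewrite uyx.
by apply: harm; apply/negP => /uM; rewrite uyx leNgt Mx.
Qed.

Lemma flux_linear (a b : R) u r x :
  flux (fun y => a * u y + b * r y) x = a * flux u x + b * flux r x.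
Proof.
by rewrite /flux !mulr_sumr -big_split /=; apply: eq_bigr => y _; ring.
Qed.

(** Uniqueness gives existence: the square linear system that prescribes values on [C] and zero flux
    elsewhere has trivial kernel by the maximum principle. *)
Lemma dirichlet_problem (C : {set T}) (b : T -> R) c : c \in C ->
  exists u, (forall x, x \in C -> u x = b x) /\
            (forall x, x \notin C -> flux u x = 0).
Proof.
move=> cC.
pose L (f : 'rV[R]_#|T|) : 'rV[R]_#|T| :=
  \row_j (let x := enum_val j in if x \in C then f 0 (enum_rank x)
          else flux (fun y => f 0 (enum_rank y)) x).
have Llin : linear L.
  move=> a f g; apply/rowP => j; rewrite !mxE /=; case: ifP => _; first by rewrite ?mxE.
  rewrite -[X in _ = _ + X]mul1r -flux_linear /flux; apply: eq_bigr => y _.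
  by rewrite !mxE !mul1r.
pose Ll := GRing.isLinear.Build _ _ _ _ L Llin.
pose Lf : {linear 'rV[R]_#|T| -> 'rV[R]_#|T|} := HB.pack L Ll.
have Lu : lin1_mx Lf \in unitmx.
  rewrite -row_free_unit -kermx_eq0; apply/eqP/row_matrixP => i; rewrite row0.
  have : row i (kermx (lin1_mx Lf)) *m lin1_mx Lf = 0 by rewrite -row_mul mulmx_ker row0.
  move: (row i _) => v; rewrite mul_rV_lin1 /= => Lv0.
  have H x : (if x \in C then v 0 (enum_rank x)
          else flux (fun y => v 0 (enum_rank y)) x) = 0.
    by move/rowP: Lv0 => /(_ (enum_rank x)); rewrite !mxE enum_rankK.
  have vC x : x \in C -> v 0 (enum_rank x) = 0 by move=> xC; move: (H x); rewrite xC.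
  have vh x : x \notin C -> flux (fun y => v 0 (enum_rank y)) x = 0.
    by move=> xC; move: (H x); rewrite (negbTE xC).
  have le0 x : v 0 (enum_rank x) <= 0.
    by apply: (@max_principle (fun y => v 0 (enum_rank y)) C c 0 cC vh) => y /vC ->.
  have ge0 x : - v 0 (enum_rank x) <= 0.
    apply: (@max_principle (fun y => - v 0 (enum_rank y)) C c 0 cC) => y yC.
      rewrite -[RHS]oppr0 -[X in _ = - X](vh _ yC) /flux -sumrN.
      by apply: eq_bigr => z _; ring.
    by rewrite vC ?oppr0.
  apply/rowP => j; rewrite [RHS]mxE -(enum_valK j); apply/eqP.
  by rewrite eq_le le0 -oppr_le0 ge0.
pose g0 : 'rV[R]_#|T| := \row_j (if enum_val j \in C then b (enum_val j) else 0).
have [f Lf0] : exists f, L f = g0.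
  by exists (g0 *m invmx (lin1_mx Lf)); rewrite -[L _](mul_rV_lin1 Lf) mulmxKV.
exists (fun x => f 0 (enum_rank x)); split=> x xC.
  by move/rowP: Lf0 => /(_ (enum_rank x)); rewrite !mxE enum_rankK /= xC.
by move/rowP: Lf0 => /(_ (enum_rank x)); rewrite !mxE enum_rankK /= (negbTE xC).
Qed.

(* [u] is a potential with unit current from [A] to [B], so that [Rr] is the
   effective resistance between them. *)
Record unit_current u A B (Rr : R) : Prop := UnitCurrent {
  uc_A : forall x, x \in A -> u x = 0;
  uc_B : forall x, x \in B -> u x = Rr;
  uc_ge0 : forall x, 0 <= u x;
  uc_le : forall x, u x <= Rr;
  uc_harm : forall x, x \notin A -> x \notin B -> flux u x = 0;
  uc_A1 : \sum_(x in A) flux u x = 1 }.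

Lemma dirichlet_ge0 u : 0 <= dirichlet u u.
Proof.
by apply: sumr_ge0 => x _; apply: sumr_ge0 => y _; rewrite mulr_ge0 ?ler0n ?sqr_ge0.
Qed.

Lemma dirichlet_eq0 u : dirichlet u u = 0 -> forall x y, u x = u y.
Proof.
move=> d0.
have H x y : e x y -> u x = u y.
  move=> exy; have := d0; rewrite /dirichlet => /eqP; rewrite psumr_eq0 => [|z _]; last first.
    by apply: sumr_ge0 => t _; rewrite mulr_ge0 ?ler0n ?sqr_ge0.
  move=> /allP /(_ x (mem_index_enum _)) /=; rewrite psumr_eq0 => [|z _]; last first.
    by rewrite mulr_ge0 ?ler0n ?sqr_ge0.
  move=> /allP /(_ y (mem_index_enum _)) /=.
  by rewrite exy mul1r mulf_eq0 orbb subr_eq0 => /eqP ->.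
move=> x y; suff : y \in [set z | u z == u x] by rewrite inE => /eqP.
apply: (@connected_closed _ x); first by rewrite inE.
by move=> z t; rewrite !inE => /eqP <- /H ->.
Qed.

Lemma sum_disjoint_support A B (F : T -> R) : [disjoint A & B] ->
  (forall x, x \notin A -> x \notin B -> F x = 0) ->
  \sum_x F x = \sum_(x in A) F x + \sum_(x in B) F x.
Proof.
move=> dAB F0; rewrite (bigID (mem A)) /=; congr (_ + _).
rewrite (bigID (mem B)) /= [X in _ + X]big1 ?addr0 => [|x /andP [xA xB]]; last exact: F0.
apply: eq_bigl => x; rewrite andbC; case: (boolP (x \in B)) => //= xB.
by rewrite (disjointFl dAB xB).
Qed.

Lemma sum_flux0 u : \sum_x flux u x = 0.
Proof.
have -> : \sum_x flux u x = \sum_(x in [set: T]) flux u x.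
  by apply: eq_bigl => x; rewrite inE.
rewrite flux_cut big1 // => x _; rewrite big1 // => y; by rewrite !inE.
Qed.

(** The harmonic extension of the indicator of [B] carries a current [I], which is half its
    [dirichlet] value by Green's formula and hence positive; dividing by [I] makes the current [1]
    and the potential difference [I^-1]. *)
Lemma unit_current_exists A B a b : a \in A -> b \in B -> [disjoint A & B] ->
  exists u, exists2 Rr, 0 < Rr & unit_current u A B Rr.
Proof.
move=> aA bB dAB.
have aC : a \in A :|: B by rewrite inE aA.
have [u [uC uh]] := dirichlet_problem (fun x => (x \in B)%:R) aC.
have uA x : x \in A -> u x = 0.
  by move=> xA; rewrite uC ?inE ?xA // (disjointFr dAB xA).
have uB x : x \in B -> u x = 1 by move=> xB; rewrite uC ?inE ?xB ?orbT.
have u1 x : u x <= 1.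
  by apply: max_principle aC uh _ _ => y; rewrite inE => /orP [/uA ->|/uB ->].
have u0 x : 0 <= u x.
  rewrite -oppr_le0; apply: (@max_principle (fun y => - u y) _ _ 0 aC) => y yC.
    rewrite -[RHS]oppr0 -[X in _ = - X](uh _ yC) /flux -sumrN; apply: eq_bigr => z _; ring.
  by rewrite oppr_le0; move: yC; rewrite inE => /orP [/uA ->|/uB ->].
pose I := \sum_(x in A) flux u x.
have harm x : x \notin A -> x \notin B -> flux u x = 0.
  by move=> xA xB; apply: uh; rewrite inE negb_or xA xB.
have IB : \sum_(x in B) flux u x = - I.
  have := sum_flux0 u; rewrite (sum_disjoint_support dAB harm) -/I => /eqP.
  by rewrite addrC addr_eq0 => /eqP.
have EI : dirichlet u u = I *+ 2.
  rewrite dirichletE (sum_disjoint_support dAB) => [|x xA xB]; last by rewrite harm ?mul0r.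
  rewrite [X in X + _]big1 ?add0r => [|x xA]; last by rewrite uA ?mulr0.
  rewrite (eq_bigr (flux u)) ?IB ?opprK // => x xB; by rewrite uB ?mulr1.
have I0 : 0 < I.
  rewrite lt_neqAle; apply/andP; split; last first.
    by rewrite -(@pmulrn_lge0 _ _ 2) // -EI dirichlet_ge0.
  apply/eqP => I0; move: EI; rewrite -I0 mul0rn => /dirichlet_eq0 /(_ a b).
  by rewrite uA ?uB // => /eqP; rewrite eq_sym oner_eq0.
exists (fun x => I^-1 * u x), I^-1; first by rewrite invr_gt0.
have fl x : flux (fun x => I^-1 * u x) x = I^-1 * flux u x.
  by rewrite /flux mulr_sumr; apply: eq_bigr => y _; ring.
split=> [x /uA ->|x /uB ->|x|x|x xA xB|]; rewrite ?mulr0 ?mulr1 //.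
- by rewrite mulr_ge0 // invr_ge0 ltW.
- by rewrite ler_piMr // invr_ge0 ltW.
- by rewrite fl harm ?mulr0.
- by rewrite (eq_bigr _ (fun x _ => fl x)) -mulr_sumr mulVf // gt_eqF.
Qed.

End Dirichlet.

(* Discards the hypotheses that are not about [nat], which slow [lia] down. *)
Ltac nlia := repeat match goal with
  | [H : ?P |- _] => lazymatch type of P with Prop =>
      lazymatch P with is_true (leq _ _) => fail | @eq nat _ _ => fail | _ => clear H end end
  end; lia.

(** * Counting lemmas for sequences of levels *)

Lemma shift_telescope (R : zmodType) (t : nat -> R) M K :
  \sum_(i < M) (t (i + K)%N - t i) = \sum_(i < K) (t (i + M)%N - t i).
Proof.
have E a b : \sum_(i < a) t i + \sum_(i < b) t (i + a)%N = \sum_(i < b + a) t i.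
  rewrite addnC big_split_ord /=; congr (_ + _); apply: eq_bigr => i _.
  by rewrite addnC.
rewrite !sumrB; apply/eqP; rewrite subr_eq addrAC eq_sym subr_eq.
by rewrite addrC E addrC E addnC.
Qed.

(** With [m = M + K + 2], the increments over [K] indices are summed over the starting points
    [1 .. M]. By [shift_telescope] only the [K] terms after the first and the [K] terms before the
    last remain, and they differ from [K * a] and [K * b] by at most [l] and [p] in total. *)
Lemma long_sequence (R : realFieldType) (t : nat -> R) m K (a b l p : R) :
  (K < m)%N -> (forall i, (i + K < m)%N -> t (i + K)%N <= t i + 1) ->
  t 0%N = a -> t m.-1 = b -> 1 <= b - a ->
  \sum_(i < K.+1) (t i - a) <= l -> \sum_(i < K.+1) (b - t (m.-1 - i)%N) <= p ->
  (K.+2)%:R + K%:R * (b - a) <= m%:R + l + p.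
Proof.
move=> Km tK t0 tm ab low high.
have [mK|mK] : (m = K.+1 \/ exists M, m = (M + K.+2)%N).
- by case: (ltngtP m K.+1) Km; [lia | right; exists (m - K.+2)%N; lia | left].
(* For [m = K.+1] both end sums run over the whole sequence, so [l + p] is at least
   [(K + 1) * (b - a)], and [1 <= b - a] closes the case. *)
- move: high; rewrite mK /= (reindex_inj rev_ord_inj) /= => high.
  have : \sum_(i < K.+1) (t i - a) + \sum_(i < K.+1) (b - t i) = K.+1%:R * (b - a).
    rewrite -big_split /= (eq_bigr (fun=> b - a)) => [|i _]; last by ring.
    by rewrite sumr_const card_ord mulr_natl.
  have : \sum_(i < K.+1) (b - t i) <= p.
    apply: le_trans high; apply: ler_sum => i _; rewrite lerD2l lerN2.
    suff -> : (K - (K.+1 - i.+1))%N = i by [].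
    by have := ltn_ord i; lia.
  rewrite -!natr1; move: ab low; set S1 := \sum_(_ < _) _; set S2 := \sum_(_ < _) _; nra.
case: mK => M mE; subst m.
have T := shift_telescope (fun i => t i.+1) M K.
have : \sum_(i < M) (t (i + K).+1 - t i.+1) <= M%:R.
  rewrite -[M in M%:R]card_ord -sumr_const; apply: ler_sum => i _.
  rewrite lerBlDr addrC -addSn; apply: tK; have := ltn_ord i; lia.
rewrite T {T tK}.
have L1 : \sum_(i < K) (t i.+1 - a) <= l.
  by apply: le_trans low; rewrite big_ord_recl /= t0 subrr add0r.
have L2 : \sum_(i < K) (b - t (i + M).+1) <= p.
  apply: le_trans high; rewrite big_ord_recl /= subn0 tm subrr add0r.
  rewrite [leRHS](reindex_inj rev_ord_inj) /=; apply: ler_sum => i _.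
  rewrite lerD2l lerN2.
  suff -> : ((M + K.+2).-1 - bump 0 (K - i.+1))%N = (i + M).+1 by [].
  by rewrite /bump; have := ltn_ord i; lia.
have E : \sum_(i < K) (t i.+1 - a) + \sum_(i < K) (b - t (i + M).+1) +
   \sum_(i < K) (t (i + M).+1 - t i.+1) = K%:R * (b - a).
  rewrite -!big_split /= (eq_bigr (fun=> b - a)) => [|i _]; last by ring.
  by rewrite sumr_const card_ord mulr_natl.
rewrite natrD; lra.
Qed.

(** As [th] separates [s] from the rest of [W], the sum of [th - f] over [W] is at most that over
    [s]; then [th <= 1] pays for the at most [l - 1] elements by which [W] falls short of [K.+1]. *)
Lemma smallest_sum (R : realFieldType) (T : finType) (f : T -> R) (s : seq T)
    (W : {set T}) (th : R) (K l : nat) :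
  uniq s -> size s = K.+1 -> (forall z, z \in s -> f z <= th) ->
  (forall z, z \in W -> z \notin s -> th <= f z) -> 0 <= th <= 1 ->
  \sum_(z in W) f z <= 1 -> (K.+2 <= #|W| + l)%N -> (1 <= l)%N ->
  \sum_(z <- s) f z <= l%:R.
Proof.
move=> us ss sth Wth /andP [th0 th1] W1 cW l1.
have h : \sum_(z in W) (th - f z) <= \sum_(z <- s) (th - f z).
  rewrite big_uniq //= big_mkcond [leRHS]big_mkcond; apply: ler_sum => z _.
  case: ifP => [zW|_]; case: ifP => [zs|zs] //.
    by rewrite subr_le0 Wth ?zs.
  by rewrite subr_ge0 sth.
move: h; rewrite !sumrB sumr_const big_const_seq count_predT ss iter_addr_0.
rewrite -![th *+ _]mulr_natl => h.
have c : (K.+2)%:R <= #|W|%:R + l%:R :> R by rewrite -natrD ler_nat.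
have c1 : 1 <= l%:R :> R by rewrite ler1n.
have : (K.+2)%:R * th <= (#|W|%:R + l%:R) * th by rewrite ler_wpM2r.
have : (l%:R - 1) * th <= l%:R - 1 by rewrite ler_piMr // subr_ge0.
rewrite -(natr1 K.+1); lra.
Qed.

(** * Levels, gaps and blocks of a unit current *)

Section UnitCurrent.
Variables (R : realFieldType) (T : finType) (e : rel T).
Hypotheses (esym : symmetric e) (eirr : irreflexive e).
Variables (u : T -> R) (A B : {set T}) (Rr : R) (K : nat).
Hypothesis dAB : [disjoint A & B].
Hypothesis uc : unit_current e u A B Rr.
Hypothesis K2 : (2 <= K)%N.
Hypothesis degK : forall x, (K.+1 <= #|[set y | e x y]|)%N.

(** Kirchhoff's law: vertices of [S] outside [A] have zero flux, so the cut carries the whole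
    current that leaves [A]. *)
Lemma current_cut (S : {set T}) : A \subset S -> [disjoint S & B] ->
  \sum_(x in S) \sum_(y in ~: S) (e x y)%:R * (u y - u x) = 1.
Proof.
move=> AS dSB; rewrite -flux_cut // -(uc_A1 uc).
rewrite (big_setID A) /= (finset.setIidPr AS) [X in _ + X]big1 ?addr0 // => x.
rewrite inE => /andP [xA xS]; apply: (uc_harm uc) => //.
by rewrite (disjointFr dSB xS).
Qed.

Lemma current_threshold a : 0 < a -> a <= Rr ->
  \sum_(x | u x < a) \sum_(y | a <= u y) (e x y)%:R * (u y - u x) = 1.
Proof.
move=> a0 aR; rewrite -[RHS](@current_cut [set x | u x < a]).
- apply: eq_big => [x|x _]; first by rewrite inE.
  by apply: eq_bigl => y; rewrite !inE -leNgt.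
- by apply/fintype.subsetP => x /(uc_A uc) ux; rewrite inE ux.
- rewrite disjoint_subset; apply/fintype.subsetP => x; rewrite !inE => ux.
  by apply/negP => /(uc_B uc) uR; move: ux; rewrite uR ltNge aR.
Qed.

Definition crossing a := [set p : T * T | [&& e p.1 p.2, u p.1 < a & a <= u p.2]].

Lemma crossing_sum (a : R) (F : T -> T -> R) :
  \sum_(x | u x < a) \sum_(y | a <= u y) (e x y)%:R * F x y =
  \sum_(p in crossing a) F p.1 p.2.
Proof.
rewrite pair_big_dep /= big_mkcond [RHS]big_mkcond; apply: eq_bigr => p _.
rewrite inE; case: (e _ _); rewrite /= ?mul1r ?mul0r //.
by case: ifP.
Qed.

(** The cut at level [a] carries current [1], and each crossing edge carries at least [a - al]. *)
Lemma crossing_gap al a : 0 < a -> a <= Rr -> (forall x, u x < a -> u x <= al) ->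
  #|crossing a|%:R * (a - al) <= 1.
Proof.
move=> a0 aR gap; rewrite -[leRHS](current_threshold a0 aR).
rewrite (crossing_sum a (fun x y => u y - u x)) mulr_natl -sumr_const.
apply: ler_sum => -[x y]; rewrite inE /= => /and3P [_ /gap h1 h2]; lra.
Qed.

(** The edges upwards from [v] belong to the cut just above the level of [v], which carries unit
    current. *)
Lemma current_up v (U : {set T}) : u v < Rr ->
  (forall y, y \in U -> e v y && (u v <= u y)) -> \sum_(y in U) (u y - u v) <= 1.
Proof.
move=> vR HU; have := @current_cut [set x | u x <= u v].
rewrite (bigD1 v) ?inE //= => H; rewrite -[leRHS]H {H}.
- rewrite -[leLHS]addr0; apply: lerD; last first.
    apply: sumr_ge0 => x; rewrite inE => /andP [xv _]; apply: sumr_ge0 => y.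
    by rewrite !inE -ltNge => yv; rewrite mulr_ge0 ?ler0n // subr_ge0 (le_trans xv) ?ltW.
  rewrite big_mkcond [leRHS]big_mkcond; apply: ler_sum => y _; rewrite !inE -ltNge.
  case: ifP => [/HU /andP [-> h]|_].
    by rewrite mul1r; case: ltP => // h'; rewrite subr_le0.
  by case: ltP => // h; rewrite mulr_ge0 ?ler0n // subr_ge0 ltW.
- by apply/fintype.subsetP => x /(uc_A uc) ux; rewrite inE ux (uc_ge0 uc).
- rewrite disjoint_subset; apply/fintype.subsetP => x; rewrite !inE => ux.
  by apply/negP => /(uc_B uc) uR; move: ux; rewrite uR leNgt vR.
Qed.

Lemma current_down v (U : {set T}) : 0 < u v ->
  (forall y, y \in U -> e v y && (u y <= u v)) -> \sum_(y in U) (u v - u y) <= 1.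
Proof.
move=> v0 HU; have H := current_threshold v0 (uc_le uc v).
rewrite exchange_big /= (bigD1 v) //= in H.
rewrite -[leRHS]H -[leLHS]addr0; apply: lerD; last first.
  apply: sumr_ge0 => x /andP [xv _]; apply: sumr_ge0 => y yv.
  by rewrite mulr_ge0 ?ler0n // subr_ge0 (le_trans _ xv) ?ltW.
rewrite big_mkcond [leRHS]big_mkcond; apply: ler_sum => y _.
case: ifP => [/HU /andP [h1 h2]|_].
  by rewrite esym h1 mul1r; case: ltP => // h'; rewrite subr_le0.
by case: ltP => // h; rewrite mulr_ge0 ?ler0n // subr_ge0 ltW.
Qed.

Definition dn a v := #|[set y | e v y & u y < a]|.
Definition up a v := #|[set y | e v y & a <= u y]|.

(** All these edges cross the level [a], and only the edge between [w] and [v] can be counted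
    twice. *)
Lemma dn_up_crossing a v w : a <= u v -> u w < a ->
  (dn a v + up a w <= #|crossing a|.+1)%N.
Proof.
move=> va wa.
pose X := [set (y, v) | y in [set y | e v y & u y < a]].
pose Y := [set (w, y) | y in [set y | e w y & a <= u y]].
have -> : dn a v = #|X| by rewrite card_imset // => y z [].
have -> : up a w = #|Y| by rewrite card_imset // => y z [].
rewrite -cardsUI -addn1; apply: leq_add.
  apply: subset_leq_card; apply/fintype.subsetP => p; rewrite inE.
  case/orP => /imsetP [y]; rewrite inE => /andP [h1 h2] ->; rewrite inE /=.
    by rewrite esym h1 h2 va.
  by rewrite h1 h2 wa.
rewrite -(cards1 (w, v)); apply: subset_leq_card; apply/fintype.subsetP => p.
by rewrite !inE => /andP [/imsetP [y _ ->] /imsetP [z _ [-> _]]].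
Qed.

(* Slack of a thin gap crossed by [c] edges, to be shared by the adjacent blocks. *)
Definition slack c : R := if (2 <= c)%N then (K%:R - 2) / (K%:R - 1) else 0.

Lemma crossing_gt0 a : 0 < a -> a <= Rr -> (0 < #|crossing a|)%N.
Proof.
move=> a0 aR; rewrite lt0n; apply/eqP => /cards0_eq c0.
have := current_threshold a0 aR; rewrite (crossing_sum a (fun x y => u y - u x)) c0 big_set0.
by move/eqP; rewrite eq_sym oner_eq0.
Qed.

Lemma thin_crossing al a : 0 < a -> a <= Rr -> (forall x, u x < a -> u x <= al) ->
  K%:R^-1 < a - al -> (#|crossing a| < K)%N.
Proof.
move=> a0 aR gap thin; rewrite ltnNge; apply/negP => cK.
have K0 : 0 < K%:R :> R by rewrite ltr0n (ltn_trans _ K2).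
have := crossing_gap a0 aR gap; rewrite leNgt => /negP; apply.
have : 1 < K%:R * (a - al) by rewrite mulrC -ltr_pdivrMr // mul1r.
move=> h; apply: (lt_le_trans h); rewrite ler_wpM2r ?ler_nat //.
by apply: le_trans (ltW thin); rewrite invr_ge0 ler0n.
Qed.

(** With [c] crossing edges the gap is at most [1/c]. Since [K/c + c] is convex in [c], its worst
    value for [2 <= c <= K - 1] is at [c = K - 1], where the inequality without slack has exactly
    [(K - 2)/(K - 1)] to spare: this is the origin of [slack]. *)
Lemma thin_slack al a : 0 < a -> a <= Rr -> (forall x, u x < a -> u x <= al) ->
  K%:R^-1 < a - al ->
  K%:R * (a - al) + #|crossing a|%:R + 1 + slack #|crossing a| <= K%:R + 2.
Proof.
move=> a0 aR gap thin; have cK := thin_crossing a0 aR gap thin.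
have c0 := crossing_gt0 a0 aR; have := crossing_gap a0 aR gap.
move: (#|crossing a|) c0 cK (a - al) thin => c c0 cK g thin cg.
have g0 : 0 < g by apply: le_lt_trans thin; rewrite invr_ge0 ler0n.
rewrite /slack; case: ltnP => c2; last first.
  have c1 : c = 1%N by clear -c0 c2; lia.
  rewrite c1 mul1r in cg *; have : K%:R * g <= K%:R by rewrite ler_piMr.
  lra.
have c2' : 2 <= c%:R :> R by rewrite ler_nat.
have cK' : c%:R + 1 <= K%:R :> R by rewrite natr1 ler_nat.
have K1 : 0 < K%:R - 1 :> R by lra.
have cp : 0 < c%:R :> R by lra.
have gle : K%:R * g <= K%:R / c%:R.
  by rewrite ler_wpM2l // -[leRHS]mul1r ler_pdivlMr // mulrC.
suff : K%:R / c%:R + c%:R + 1 + (K%:R - 2) / (K%:R - 1) <= K%:R + 2 :> R by lra.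
rewrite -subr_ge0.
have -> : K%:R + 2 - (K%:R / c%:R + c%:R + 1 + (K%:R - 2) / (K%:R - 1)) =
   (K%:R - 1 - c%:R) * ((K%:R - 1) * c%:R - K%:R) / (c%:R * (K%:R - 1)) :> R.
  by field; rewrite !gt_eqF.
apply: divr_ge0; last by rewrite mulr_ge0 ?ltW.
apply: mulr_ge0; [lra | nra].
Qed.

Section Block.
Variables (al a b be : R) (v w : T).
Hypotheses (al0 : 0 <= al) (ala : al < a) (ab : a <= b) (bbe : b < be) (beR : be <= Rr).
Hypothesis gapl : forall x, u x < a -> u x <= al.
Hypothesis gapu : forall x, u x < be -> u x <= b.
Hypotheses (uv : u v = a) (uw : u w = b).

Let a0 : 0 < a. Proof. exact: le_lt_trans ala. Qed.
Let b0 : 0 < b. Proof. exact: lt_le_trans ab. Qed.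
Let bR : b < Rr. Proof. exact: lt_le_trans beR. Qed.
Let aR : a < Rr. Proof. exact: le_lt_trans bR. Qed.

Let Bk := [set x | a <= u x & u x < be].

Lemma Bk_le x : x \in Bk -> a <= u x <= b.
Proof. by rewrite inE => /andP [-> /gapu ->]. Qed.

Lemma vBk : v \in Bk. Proof. by rewrite inE uv lexx (le_lt_trans ab). Qed.
Lemma wBk : w \in Bk. Proof. by rewrite inE uw ab. Qed.

(** A vertex of the block has at most [#|Bk| - 1] neighbours inside, hence at least [K.+2 - #|Bk|]
    outside, and an edge leaving the block crosses one of its two bounding levels. *)
Lemma block_out : (#|Bk| * (K.+2 - #|Bk|) <= #|crossing a| + #|crossing be|)%N.
Proof.
pose P := [set p : T * T | [&& p.1 \in Bk, p.2 \notin Bk & e p.1 p.2]].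
apply: (@leq_trans #|P|).
  rewrite -sum_nat_const -[leqRHS]sum1_card.
  rewrite (eq_bigl (fun p : T * T => (p.1 \in Bk) && ((p.2 \notin Bk) && e p.1 p.2))); last first.
    by move=> p; rewrite inE.
  rewrite -(pair_big_dep (fun x => x \in Bk) (fun x y => (y \notin Bk) && e x y) (fun _ _ => 1%N)) /=.
  apply: leq_sum => z zB; rewrite sum1_card leq_subLR.
  have := degK z; rewrite -(cardsID Bk) => h.
  have h1 : (#|[set y | e z y] :&: Bk| < #|Bk|)%N.
    apply: proper_card; apply/properP; split; first by apply/fintype.subsetP => y; rewrite inE => /andP [].
    by exists z => //; rewrite !inE eirr.
  have <- : #|[set y | e z y] :\: Bk| = #|[pred y | (y \notin Bk) && e z y]|.
    by apply: eq_card => y; rewrite !inE.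
  by move: h h1; clear; lia.
have -> : P = (P :&: [set p | u p.2 < a]) :|: (P :&: [set p | be <= u p.2]).
  apply/setP => -[x y]; rewrite !inE /=; case: (e x y); rewrite ?andbF //= !andbT.
  by rewrite negb_and -ltNge -leNgt; case: (ltP (u y) a); case: (leP be (u y)); rewrite ?andbF ?andbT ?orbb ?orbF.
apply: leq_trans (leq_card_setU _ _) _; apply: leq_add.
  rewrite -(@card_imset _ _ (fun p : T * T => (p.2, p.1))); last by move=> [x1 y1] [x2 y2] [-> ->].
  apply: subset_leq_card; apply/fintype.subsetP => p /imsetP [[x y]].
  by rewrite !inE /= => /andP [/and3P [/andP [h1 h2] h3 h4] h5] ->; rewrite /= esym h4 h5 h1.
apply: subset_leq_card; apply/fintype.subsetP => -[x y].
by rewrite !inE /= => /andP [/and3P [/andP [h1 h2] h3 h4] h5]; rewrite h4 h5 h2.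
Qed.

Let H := b - a.
Let clamp x := Num.max a (Num.min b (u x)).
Let F x y := (e x y)%:R * ((u y - u x) * (clamp y - clamp x)).

Lemma clamp_mono x y : u x <= u y -> clamp x <= clamp y.
Proof.
move=> h; rewrite /clamp ge_max !le_max lexx /=; apply/orP; right.
by rewrite le_min !ge_min lexx h orbT.
Qed.

Lemma F_ge0 x y : 0 <= F x y.
Proof.
rewrite /F mulr_ge0 ?ler0n //; case: (leP (u x) (u y)) => h.
  by rewrite mulr_ge0 // subr_ge0 // clamp_mono.
by rewrite mulr_le0 // subr_le0 ?clamp_mono // ltW.
Qed.

Lemma F_sym x y : F x y = F y x.
Proof. rewrite /F esym; ring. Qed.

(** Green's formula with a test function that is [a] on [A] and [b] on [B]: clamping keeps the
    energy dissipated between these two levels. *)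
Lemma clamp_green : dirichlet e u clamp = H *+ 2.
Proof.
have fB : \sum_(x in B) flux e u x = - 1.
  have := sum_flux0 esym u; rewrite (sum_disjoint_support dAB (uc_harm uc)) (uc_A1 uc).
  lra.
rewrite dirichletE // (sum_disjoint_support dAB) => [|x xA xB]; last by rewrite (uc_harm uc) ?mul0r.
rewrite (eq_bigr (fun x => flux e u x * a)) => [|x xA]; last first.
  by congr (_ * _); rewrite /clamp (uc_A uc xA) min_r ?max_l // ltW.
rewrite [X in _ + X](eq_bigr (fun x => flux e u x * b)) => [|x xB]; last first.
  by congr (_ * _); rewrite /clamp (uc_B uc xB) min_l ?max_r // ltW.
by rewrite -!mulr_suml fB (uc_A1 uc) /H; congr (_ *+ _); ring.
Qed.

Let Nv := [set y in Bk | e v y || (y == v)].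
Let Nw := [set y in Bk | e w y || (y == w)].

(** Of the energy in [clamp_green] only the edges at [v] and [w] are kept. A common neighbour at
    level [y] in the block contributes at least [(y - a)^2 + (b - y)^2 >= H^2 / 2], an edge from [v]
    to above the block or from [w] to below it at least [H^2], and the total is at most [H]. *)
Lemma block_overlap : 0 < H ->
  H * (#|Nv :&: Nw|%:R + (up be v)%:R *+ 2 + (dn a w)%:R *+ 2) <= 2.
Proof.
move=> H0; have vw : v != w.
  by apply/eqP => vw; move: H0; rewrite /H -uv vw uw subrr ltxx.
have wv : w != v by rewrite eq_sym.
have HF : F v w + \sum_(y | (y != v) && (y != w)) (F v y + F w y) <= H.
  have Fxx x : F x x = 0 by rewrite /F subrr mul0r mulr0.
  have Ev : \sum_y F v y = F v w + \sum_(y | (y != v) && (y != w)) F v y.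
    by rewrite (bigD1 v) //= (bigD1 w) ?wv //= Fxx add0r.
  have Ew : \sum_y F w y = F v w + \sum_(y | (y != v) && (y != w)) F w y.
    by rewrite (bigD1 v) //= (bigD1 w) ?wv //= Fxx add0r F_sym.
  have h : \sum_(y | (y != v) && (y != w)) (F v y + F w y) <=
           \sum_(i | (i != v) && (i != w)) \sum_y F i y.
    apply: ler_sum => x /andP [xv xw].
    rewrite (bigD1 v) //= (bigD1 w) ?wv //= addrA.
    rewrite (F_sym v) (F_sym w) lerDl; apply: sumr_ge0 => y _; exact: F_ge0.
  have : dirichlet e u clamp = \sum_y F v y + (\sum_y F w y +
           \sum_(i | (i != v) && (i != w)) \sum_y F i y).
    transitivity (\sum_x \sum_y F x y); first by [].
    by rewrite (bigD1 v) //=; congr (_ + _); rewrite (bigD1 w) ?wv.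
  move: h; rewrite clamp_green Ev Ew big_split /= mulr2n.
  by move=> h1 h2; lra.
have ca : clamp v = a by rewrite /clamp uv min_r ?max_l.
have cb : clamp w = b by rewrite /clamp uw min_l ?max_r.
have cin y : a <= u y -> u y < be -> clamp y = u y.
  by move=> h /gapu h'; rewrite /clamp min_r ?max_r.
have chi y : be <= u y -> clamp y = b.
  by move=> h; rewrite /clamp min_l ?max_r // (le_trans (ltW bbe)).
have clo y : u y < a -> clamp y = a.
  by move=> h; rewrite /clamp min_r ?max_l ?ltW // (lt_le_trans h).
have Fvw : F v w = (e v w)%:R * H ^+ 2 by rewrite /F uv uw ca cb -/H expr2.
have Fy y : y != v -> y != w -> H ^+ 2 * ((y \in Nv :&: Nw)%:R / 2 +
   (e v y && (be <= u y))%:R + (e w y && (u y < a))%:R) <= F v y + F w y.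
  move=> yv yw; rewrite !inE (negbTE yv) (negbTE yw) !orbF /F uv uw ca cb.
  case: (ltP (u y) a) => h1.
    rewrite (clo _ h1) andbF /= (leNgt be) (lt_trans h1) ?andbF ?(le_lt_trans ab) //.
    rewrite mul0r !add0r subrr !mulr0 add0r andbT.
    case: (e w y) => /=; last by rewrite mulr0 mul0r.
    rewrite mul1r mulr1 expr2 -/H; have : H <= b - u y by rewrite /H; lra.
    by move=> h3; rewrite -[leRHS]mulrNN !opprB ler_pM2r.
  rewrite andbF addr0; case: (ltP (u y) be) => h2; rewrite ?andbT ?andbF /=.
    rewrite addr0 (cin _ h1 h2).
    have h3 := gapu h2; case: (e v y); case: (e w y); rewrite /= ?mul1r ?mul0r ?mulr0 ?add0r ?addr0 -?expr2 ?sqr_ge0 //.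
    have := sqr_ge0 ((u y - a) - (b - u y)); rewrite /H !expr2; lra.
  rewrite (chi _ h2) mul0r add0r subrr !mulr0 addr0.
  case: (e v y) => /=; last by rewrite mulr0 mul0r.
  rewrite mul1r mulr1 expr2 -/H; have : H <= u y - a by rewrite /H; move: bbe; lra.
  by move=> h3; rewrite ler_pM2r.
(* An edge between [v] and [w] puts both of them into [Nv :&: Nw]; the two halves match its
   contribution [H ^+ 2]. *)
have vw_in : ((v \in Nv :&: Nw)%:R + (w \in Nv :&: Nw)%:R) / 2 = (e v w)%:R :> R.
  have vNv : v \in Nv by rewrite inE vBk eqxx orbT.
  have wNw : w \in Nw by rewrite inE wBk eqxx orbT.
  have vNw : v \in Nw = e v w by rewrite inE vBk (negbTE vw) orbF esym.
  have wNv : w \in Nv = e v w by rewrite inE wBk (negbTE wv) orbF.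
  rewrite !finset.in_setI vNv wNw vNw wNv andbT /=.
  by lra.
have sumH : H ^+ 2 * (#|Nv :&: Nw|%:R / 2 + (up be v)%:R + (dn a w)%:R) <= H.
  apply: le_trans HF.
  have cardE (P : pred T) : #|[set y | P y]|%:R = \sum_y (P y)%:R :> R.
    by rewrite -sum1_card natr_sum big_mkcond /=; apply: eq_bigr => y _; rewrite inE; case: (P y).
  have -> : #|Nv :&: Nw|%:R = \sum_y (y \in Nv :&: Nw)%:R :> R.
    by rewrite -cardE; congr (_%:R); apply: eq_card => y; rewrite inE.
  rewrite /up /dn !cardE mulr_suml -!big_split /=.
  rewrite (bigD1 v) //= (bigD1 w) ?wv //= addrA mulrDr; apply: lerD.
    rewrite Fvw mulrC; apply: ler_pM => //; rewrite ?sqr_ge0 ?addr_ge0 ?ler0n ?divr_ge0 ?ler0n //.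
    rewrite uv uw -vw_in (leNgt be) (le_lt_trans ab bbe) (leNgt be) bbe /= !andbF.
    by rewrite ltxx ltNge ab !andbF mulrDl (_ : false%:R = 0 :> R) // !addr0.
  by rewrite mulr_sumr; apply: ler_sum => y /andP [yv yw]; exact: Fy.
move: sumH; rewrite expr2 -mulrA -[leRHS]mulr1 ler_pM2l // => sumH.
have -> : #|Nv :&: Nw|%:R + (up be v)%:R *+ 2 + (dn a w)%:R *+ 2 =
   (#|Nv :&: Nw|%:R / 2 + (up be v)%:R + (dn a w)%:R) * 2 :> R by field.
by rewrite mulrA -[leRHS]mul1r ler_pM2r.
Qed.

Lemma block_deg x : x \in Bk -> (K.+2 <= #|[set y in Bk | e x y || (y == x)]| + dn a x + up be x)%N.
Proof.
move=> xB; apply: (leq_trans (n := #|x |: [set y | e x y]|)).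
  by rewrite cardsU1 inE eirr add1n ltnS degK.
apply: leq_trans (leq_trans (leq_card_setU _ _) (leq_add (leq_card_setU _ _) (leqnn _))).
apply: subset_leq_card; apply/fintype.subsetP => y; rewrite !inE.
case: (eqVneq y x) => [->|_] /=; first by move: xB; rewrite inE => ->; rewrite orbT.
by move=> ->; rewrite orbF andbT; case: (ltP (u y) a); case: (leP be (u y)); rewrite ?orbT ?orbF.
Qed.

(** Inclusion-exclusion for the closed neighbourhoods [Nv] and [Nw] inside the block, with
    [block_deg] at [v] and [w]. *)
Lemma block_card : (2 * K.+2 <= #|Bk| + #|Nv :&: Nw| + dn a v + up be v + dn a w + up be w)%N.
Proof.
have := block_deg vBk; have := block_deg wBk; have := cardsUI Nv Nw.
have : (#|Nv :|: Nw| <= #|Bk|)%N.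
  by apply: subset_leq_card; apply/fintype.subsetP => y; rewrite !inE => /orP [] /andP [].
rewrite -/Nv -/Nw; clear; lia.
Qed.

Let t i := u (nth v (sort (fun x y => u x <= u y) (enum Bk)) i).

(** In the sorted list [t] of levels, consecutive ones are at most [1/K] apart by [inner], so [K]
    steps climb at most [1]. The [K.+1] lowest levels are compared with those of [v] and its
    neighbours, whose total excess over [a] is at most the unit current; the top is symmetric, with
    [w]. *)
Lemma block_long : (1 <= dn a v)%N -> (1 <= up be w)%N ->
  (forall z, a <= u z -> u z < b -> exists z', [/\ u z < u z', u z' <= b & u z' <= u z + K%:R^-1]) ->
  1 <= H -> (K.+2)%:R + K%:R * H <= #|Bk|%:R + (dn a v)%:R + (up be w)%:R.
Proof.
move=> l1 p1 inner H1.
have K0 : 0 < K%:R :> R by rewrite ltr0n (ltn_trans _ K2).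
set s := sort (fun x y => u x <= u y) (enum Bk).
have stot : total (fun x y => u x <= u y) by move=> x y; exact: le_total.
have strans : transitive (fun x y : T => u x <= u y) by move=> x y z; exact: le_trans.
have ss : sorted (fun x y => u x <= u y) s by exact: sort_sorted.
have us : uniq s by rewrite sort_uniq enum_uniq.
have ms x : (x \in s) = (x \in Bk) by rewrite mem_sort mem_enum.
have szs : size s = #|Bk| by rewrite size_sort cardE.
have tmono i j : (i <= j)%N -> (j < #|Bk|)%N -> t i <= t j.
  move=> ij jm; apply: (sorted_leq_nth strans _ v ss) => //; rewrite ?inE ?szs //.
  exact: leq_ltn_trans jm.
have tin i : (i < #|Bk|)%N -> a <= t i <= b.
  by move=> im; apply: Bk_le; rewrite -ms mem_nth ?szs.
have idx x : x \in Bk -> exists2 i, (i < #|Bk|)%N & t i = u x.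
  by move=> xB; exists (index x s); rewrite -?szs ?index_mem ?ms // /t nth_index ?ms.
have m0 : (0 < #|Bk|)%N by apply/card_gt0P; exists v; exact: vBk.
have t0 : t 0 = a.
  have [i im ti] := idx _ vBk; apply/eqP; rewrite eq_le.
  by have /andP [-> _] := tin 0%N m0; rewrite andbT -[leRHS]uv -ti tmono.
have tm : t #|Bk|.-1 = b.
  have [i im ti] := idx _ wBk; apply/eqP; rewrite eq_le.
  have -> : t #|Bk|.-1 <= b by case/andP: (tin #|Bk|.-1 (ltac:(nlia))).
  by rewrite -[leLHS]uw -ti tmono //; nlia.
have step i : (i.+1 < #|Bk|)%N -> t i.+1 <= t i + K%:R^-1.
  move=> im; have /andP [h1 h2] := tin i (ltac:(nlia)).
  case: (ltP (t i) b) => h3; last first.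
    have /andP [_ h] := tin i.+1 im; apply: (le_trans h); apply: (le_trans h3).
    by rewrite lerDl invr_ge0 ler0n.
  have [z' [z1 z2 z3]] := inner _ h1 h3; apply: le_trans z3.
  have [|j jm tj] := idx z'.
    by rewrite inE (ltW (le_lt_trans h1 z1)) (le_lt_trans z2).
  rewrite -tj tmono //; rewrite ltnNge; apply/negP => ji.
  by move: z1; rewrite -/(t i) -tj ltNge tmono //; nlia.
have stepn n i : (i + n < #|Bk|)%N -> t (i + n)%N <= t i + n%:R / K%:R.
  elim: n => [|n IH] h; first by rewrite addn0 mul0r addr0.
  rewrite addnS; apply: le_trans (step _ _) _; first by rewrite -addnS.
  by have := IH (ltac:(nlia)); rewrite -natr1 mulrDl mul1r; lra.
have stepK i : (i + K < #|Bk|)%N -> t (i + K)%N <= t i + 1.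
  by move=> /stepn; rewrite divff // gt_eqF.
have mK : (K < #|Bk|)%N.
  rewrite ltnNge; apply/negP => mK.
  have : t (0 + #|Bk|.-1)%N <= t 0%N + #|Bk|.-1%:R / K%:R by apply: stepn; nlia.
  rewrite add0n tm t0 => h; have : 1 <= #|Bk|.-1%:R / K%:R :> R.
    by move: H1; rewrite /H => H1; apply: (le_trans H1); rewrite lerBlDr addrC.
  by rewrite ler_pdivlMr // mul1r ler_nat; nlia.
apply: (long_sequence (t := t) mK stepK t0 tm) => //.
- have -> : \sum_(i < K.+1) (t i - a) = \sum_(z <- take K.+1 s) (u z - a).
    rewrite (big_nth v) size_takel ?szs // big_mkord.
    by apply: eq_bigr => i _; rewrite nth_take.
  (* The comparison set is [v] with its neighbours at level [a] or above; the [dn a v] remaining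
     neighbours are what it lacks. *)
  apply: (@smallest_sum _ _ _ _ (v |: [set y | e v y & a <= u y]) (t K - a)) => //.
  + by rewrite take_uniq.
  + by rewrite size_takel ?szs //.
  + move=> z zs; rewrite lerD2r; have zB : z \in Bk by rewrite -ms (mem_take zs).
    have -> : u z = t (index z s) by rewrite /t nth_index ?ms.
    by apply: tmono => //; rewrite -ltnS index_ltn.
  + move=> z; rewrite !inE => zW zs; rewrite lerD2r.
    have az : a <= u z by case/orP: zW => [/eqP ->|/andP [] //]; rewrite uv.
    case: (ltP (u z) be) => zbe; last first.
      by case/andP: (tin K mK) => _ h; apply: (le_trans h); rewrite (le_trans (ltW bbe)).
    have zs' : z \in s by rewrite ms inE az.
    have -> : u z = t (index z s) by rewrite /t nth_index.
    apply: tmono; last by rewrite -szs index_mem.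
    rewrite leqNgt; apply: contra zs => h.
    by rewrite -(nth_index v zs') -(@nth_take K.+1) ?mem_nth // ?size_takel ?szs; nlia.
  + by case/andP: (tin K mK) => h _; rewrite subr_ge0 h /=; have := stepK 0%N mK; rewrite add0n t0; lra.
  + rewrite big_setU1 /= ?inE ?eirr //= uv subrr add0r -uv.
    by apply: current_up => [|y]; rewrite ?uv // inE.
  + rewrite cardsU1 inE eirr /= /dn.
    have := degK v; rewrite -(cardsID [set y | a <= u y]).
    have -> : [set y | e v y] :&: [set y | a <= u y] = [set y | e v y & a <= u y] by apply/setP => y; rewrite !inE.
    have -> : [set y | e v y] :\: [set y | a <= u y] = [set y | e v y & u y < a] by apply/setP => y; rewrite !inE andbC ltNge.
    nlia.
have -> : \sum_(i < K.+1) (b - t (#|Bk|.-1 - i)%N) = \sum_(z <- take K.+1 (rev s)) (b - u z).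
  rewrite (big_nth v) size_takel ?size_rev ?szs // big_mkord.
  apply: eq_bigr => i _; rewrite nth_take // nth_rev ?szs; last by have := ltn_ord i; nlia.
  by rewrite /t -subn1 -subnDA add1n.
have nthr i : (i < #|Bk|)%N -> u (nth v (rev s) i) = t (#|Bk| - i.+1)%N.
  by move=> im; rewrite nth_rev szs.
apply: (@smallest_sum _ _ _ _ (w |: [set y | e w y & u y <= b]) (b - t (#|Bk| - K.+1)%N)) => //.
+ by rewrite take_uniq ?rev_uniq.
+ by rewrite size_takel ?size_rev ?szs //.
+ move=> z zs; rewrite lerD2l lerN2; have zr := mem_take zs.
  have h : (index z (rev s) < #|Bk|)%N by rewrite -szs -size_rev index_mem.
  have -> : u z = t (#|Bk| - (index z (rev s)).+1)%N by rewrite -nthr // nth_index.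
  by apply: tmono; [move: (index_ltn zs); nlia | nlia].
+ move=> z; rewrite !inE => zW zs; rewrite lerD2l lerN2.
  have az : u z <= b by case/orP: zW => [/eqP ->|/andP [] //]; rewrite uw.
  have [tK1 tK2] := andP (tin (#|Bk| - K.+1)%N (ltac:(nlia))).
  case: (ltP (u z) a) => zbe; first by rewrite (le_trans (ltW zbe)).
  have zr : z \in rev s by rewrite mem_rev ms inE zbe (le_lt_trans az).
  have h : (index z (rev s) < #|Bk|)%N by rewrite -szs -size_rev index_mem.
  have -> : u z = t (#|Bk| - (index z (rev s)).+1)%N by rewrite -nthr // nth_index.
  apply: tmono; last nlia.
  suff : (K < index z (rev s))%N by nlia.
  rewrite ltnNge; apply: contra zs => h'.
  by rewrite -(nth_index v zr) -(@nth_take K.+1) ?mem_nth // ?size_takel ?size_rev ?szs; nlia.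
+ have := tin (#|Bk| - K.+1)%N (ltac:(nlia)).
  have := stepK (#|Bk| - K.+1)%N; have -> : (#|Bk| - K.+1 + K)%N = #|Bk|.-1 by nlia.
  by rewrite tm => h; have := h (ltac:(nlia)); lra.
+ rewrite big_setU1 /= ?inE ?eirr //= uw subrr add0r -uw.
  by apply: current_down => [|y]; rewrite ?uw // inE.
rewrite cardsU1 inE eirr /= /up.
have := degK w; rewrite -(cardsID [set y | u y <= b]).
have -> : [set y | e w y] :&: [set y | u y <= b] = [set y | e w y & u y <= b] by apply/setP => y; rewrite !inE.
have -> : [set y | e w y] :\: [set y | u y <= b] = [set y | e w y & be <= u y].
  apply/setP => y; rewrite !inE andbC; congr (_ && _).
  apply/idP/idP => h; last by rewrite -ltNge (lt_le_trans bbe).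
  by rewrite leNgt; apply: contra h => /gapu.
nlia.
Qed.

(* A block of length at least [1] is handled by telescoping its sorted levels in
   steps of [K], a shorter one by counting the common neighbours of [v] and [w]
   with Green's formula for the potential clamped to [[a, b]]. *)
Lemma block_main : K%:R^-1 < a - al -> K%:R^-1 < be - b ->
  (1 <= dn a v)%N -> (1 <= up be w)%N ->
  (forall z, a <= u z -> u z < b -> exists z', [/\ u z < u z', u z' <= b & u z' <= u z + K%:R^-1]) ->
  (K.+2)%:R + K%:R * H <= #|Bk|%:R + (dn a v)%:R + (up be w)%:R
    + (slack #|crossing a| + slack #|crossing be|) / 2.
Proof.
move=> thina thinb l1 p1 inner.
have cK := thin_crossing a0 (ltW aR) gapl thina.
have cK' := thin_crossing (lt_trans b0 bbe) beR gapu thinb.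
have K0 : 2 <= K%:R :> R by rewrite ler_nat.
have slack0 c : 0 <= slack c.
  by rewrite /slack; case: ifP => // _; rewrite divr_ge0; lra.
have le_noslack : (K.+2)%:R + K%:R * H <= #|Bk|%:R + (dn a v)%:R + (up be w)%:R ->
  (K.+2)%:R + K%:R * H <= #|Bk|%:R + (dn a v)%:R + (up be w)%:R
    + (slack #|crossing a| + slack #|crossing be|) / 2.
  by have := slack0 #|crossing a|; have := slack0 #|crossing be|; lra.
(* With [2] to [K] vertices, [block_out] would require at least [2 * K] outgoing edges, whereas two
   thin levels are crossed by at most [2 * (K - 1)]. *)
have m_cases : (#|Bk| = 1 \/ K.+1 <= #|Bk|)%N.
  have m0 : (0 < #|Bk|)%N by apply/card_gt0P; exists v; exact: vBk.
  case: (leqP #|Bk| 1) => h; [by left; apply/eqP; rewrite eqn_leq h | right].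
  rewrite ltnNge; apply/negP => mK; move: block_out.
  move: (#|Bk|) h mK (#|crossing a|) (#|crossing be|) cK cK' => m h mK c c' cK cK'; clear -h mK cK cK'.
  have [k Ek] : exists k, K = (m + k)%N by exists (K - m)%N; lia.
  rewrite Ek -addnS -addnS addKn in cK cK' *; nia.
have [H0|H0] := leP H 0.
  apply: le_noslack; have -> : H = 0 by apply/eqP; rewrite eq_le H0 subr_ge0.
  rewrite mulr0 addr0 -!natrD ler_nat.
  case: m_cases => [m1|mK]; last by nlia.
  have vw : v = w.
    by move/eqP: m1 => /cards1P [z Bz]; move: vBk wBk; rewrite Bz !inE => /eqP -> /eqP ->.
  rewrite -vw; apply: leq_trans (block_deg vBk) _.
  by rewrite !leq_add2r subset_leq_card //; apply/fintype.subsetP => y; rewrite inE => /andP [].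
have mK : (K.+1 <= #|Bk|)%N.
  case: m_cases => // m1; move/eqP: m1 => /cards1P [z Bz]; move: vBk wBk; rewrite Bz !inE.
  by move=> /eqP vz /eqP wz; move: H0; rewrite /H -uv -uw vz wz subrr ltxx.
have [H1|H1] := leP 1 H; first by apply: le_noslack; exact: block_long.
have o1 := block_overlap H0; have o2 := block_card.
move: (#|Nv :&: Nw|) (up be v) (dn a w) o1 o2 => o bv bw o1 o2.
set X := (o%:R + bv%:R + bw%:R : R).
have HX : H * X <= 2.
  apply: le_trans o1; rewrite ler_pM2l // /X !mulr2n.
  have := ler0n R bv; have := ler0n R bw; lra.
have mX : 2 * (K%:R + 2) <= #|Bk|%:R + (dn a v)%:R + (up be w)%:R + X.
  move: o2; rewrite -(ler_nat R) !natrD natrM -!natr1 /X; lra.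
(* After multiplication by [H] the claim follows from [H * X <= 2] and the identity [H * (K + 2) - 2
   - K * H ^+ 2 = (K * H - 2) * (1 - H)]. *)
have [KH|KH] := leP 2 (K%:R * H).
  apply: le_noslack; suff : 0 <= K%:R + 2 - X - K%:R * H by rewrite -!natr1; lra.
  rewrite -(pmulr_rge0 _ H0).
  have : 0 <= (K%:R * H - 2) * (1 - H) by rewrite mulr_ge0 ?subr_ge0 // ltW.
  by move: HX; lra.
have l1' : 1 <= (dn a v)%:R :> R by rewrite ler1n.
have p1' : 1 <= (up be w)%:R :> R by rewrite ler1n.
case: (ltngtP #|Bk| K.+1) => mK1; first by move: mK mK1; clear; lia.
  have : (K.+2)%:R <= #|Bk|%:R :> R by rewrite ler_nat.
  by move=> h; apply: le_noslack; lra.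
have [lp|lp] := leqP 3 (dn a v + up be w).
  have : 3 <= (dn a v)%:R + (up be w)%:R :> R by rewrite -natrD ler_nat.
  by move=> h; apply: le_noslack; rewrite mK1 -!natr1; lra.
(* This is the critical block, the only case that uses [slack]. It has at least [K.+1] outgoing
   edges, fewer than [K] on either side, so both bounding levels are crossed at least twice and
   [3 <= K]. *)
have [l2 p2] : dn a v = 1%N /\ up be w = 1%N by move: l1 p1 lp; clear; lia.
have cc : (K.+1 <= #|crossing a| + #|crossing be|)%N.
  by apply: leq_trans block_out; rewrite mK1 subSn // subnn muln1.
have [c2 c2' K3] : [/\ (2 <= #|crossing a|)%N, (2 <= #|crossing be|)%N & (3 <= K)%N].
  by move: cc cK cK'; clear; split; lia.
rewrite /slack c2 c2' mK1 l2 p2 /= -(natr1 K.+1) -(natr1 K).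
rewrite mK1 l2 p2 -(natr1 K) in mX.
have K3' : 3 <= K%:R :> R by rewrite ler_nat.
have HK : H * (K%:R + 1) <= 2.
  by apply: le_trans HX; rewrite ler_pM2l //; lra.
have : K%:R * H <= 1 + (K%:R - 2) / (K%:R - 1).
  have -> : 1 + (K%:R - 2) / (K%:R - 1) = (2 * K%:R - 3) / (K%:R - 1) :> R by field; lra.
  rewrite ler_pdivlMr; last lra.
  rewrite -(@ler_pM2r _ (K%:R + 1)); last lra.
  have -> : K%:R * H * (K%:R - 1) * (K%:R + 1) = H * (K%:R + 1) * (K%:R * (K%:R - 1)) by ring.
  apply: (@le_trans _ _ (2 * (K%:R * (K%:R - 1)))); last by nra.
  by apply: ler_wpM2r => //; nra.
by set s := (K%:R - 2) / _; lra.
Qed.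

End Block.
End UnitCurrent.

(** * Resistance between two vertex sets, by a sweep through the levels *)

Section Sweep.
Variables (R : realFieldType) (T : finType) (e : rel T).
Hypotheses (esym : symmetric e) (eirr : irreflexive e).
Hypothesis econn : forall x y, connect e x y.
Variables (u : T -> R) (A B : {set T}) (Rr : R) (K : nat).
Hypothesis dAB : [disjoint A & B].
Hypothesis uc : unit_current e u A B Rr.
Hypothesis K2 : (2 <= K)%N.
Hypothesis degK : forall x, (K.+1 <= #|[set y | e x y]|)%N.
Variable a0 : T.
Hypothesis a0A : a0 \in A.

(** Climbing from [p] to [q] in steps of at most [1/K] takes at most one step more than there are
    vertices strictly between; the induction is on their number. *)
Lemma step_chain n p q : (#|[set x | (p < u x < q)%R]| < n)%N -> p < q ->
  (forall z, p <= u z -> u z < q ->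
     exists z', [/\ u z < u z', u z' <= q & u z' <= u z + K%:R^-1]) ->
  (exists z, u z = p) ->
  K%:R * (q - p) <= #|[set x | (p < u x < q)%R]|%:R + 1.
Proof.
have K0 : 0 < K%:R :> R by rewrite ltr0n (ltn_trans _ K2).
elim: n p => // n IH p cn pq step [z zp].
have [z' [z1 z2 z3]] : exists z', [/\ u z < u z', u z' <= q & u z' <= u z + K%:R^-1].
  by apply: step; rewrite zp.
have h1 : K%:R * (u z' - p) <= 1.
  by rewrite mulrC -ler_pdivlMr // mul1r lerBlDr addrC -zp.
case: (ltgtP (u z') q) z2 => // [zq|zq] _; last first.
  by rewrite -zq; apply: (le_trans h1); rewrite lerDr.
have sub : ([set x | (u z' < u x < q)%R] \proper [set x | (p < u x < q)%R])%SET.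
  apply/properP; split.
    apply/fintype.subsetP => x; rewrite !inE => /andP [h ->].
    by rewrite andbT (lt_trans _ h) // -zp.
  by exists z'; rewrite !inE ?ltxx // -zp z1.
have cs := proper_card sub.
have := IH (u z') (leq_trans cs cn) zq.
have c2 : #|[set x | (u z' < u x < q)%R]|%:R + 1 <= #|[set x | (p < u x < q)%R]|%:R :> R.
  by rewrite natr1 ler_nat.
move=> h; have {}h := h _ (ex_intro _ z' erefl).
suff : K%:R * (q - u z') <= #|[set x | (u z' < u x < q)%R]|%:R + 1 by lra.
by apply: h => t t1 t2; apply: step => //; apply: le_trans t1; rewrite -zp ltW.
Qed.

Lemma exists_argmax (P : pred T) x0 : P x0 ->
  exists2 x, P x & forall y, P y -> u y <= u x.
Proof. by move=> Px0; case: (@arg_maxP _ R T x0 P u Px0) => x; exists x. Qed.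

Lemma exists_argmin (P : pred T) x0 : P x0 ->
  exists2 x, P x & forall y, P y -> u x <= u y.
Proof. by move=> Px0; case: (@arg_minP _ R T x0 P u Px0) => x; exists x. Qed.

(** Otherwise the level set of [x] would be closed under [e], hence contain [a0], where the
    potential is [0]. *)
Lemma level_escape x : 0 < u x -> u x < Rr ->
  exists y z, [/\ u y = u x, e y z & u z != u x].
Proof.
move=> x0 xR.
suff /existsP [y /existsP [z /and3P [/eqP h1 h2 h3]]] :
    [exists y, exists z, [&& u y == u x, e y z & u z != u x]] by exists y, z.
apply: contraT; rewrite negb_exists => /forallP H.
suff : a0 \in [set y | u y == u x].
  by rewrite inE (uc_A uc) // => /eqP h; rewrite -h ltxx in x0.
apply: (@connected_closed _ e econn _ x); first by rewrite inE.
move=> y z; rewrite !inE => yx yz; apply: contraT => zx.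
by case/negP: (H y); apply/existsP; exists z; rewrite yx yz.
Qed.

(** The terms of the flux at [y] sum to [0] and are not all zero, so both signs occur. *)
Lemma harmonic_neighbors y z : u y < Rr -> 0 < u y -> e y z -> u z != u y ->
  (1 <= dn e u (u y) y)%N /\ (exists2 t, e y t & u y < u t).
Proof.
move=> yR y0 yz zy.
have f0 : flux e u y = 0.
  apply: (uc_harm uc); apply/negP.
    by move/(uc_A uc) => h; rewrite h ltxx in y0.
  by move/(uc_B uc) => h; rewrite h ltxx in yR.
split.
  rewrite /dn; apply: contraT; rewrite -leqNgt leqn0 cards_eq0 => /eqP D.
  have H t : e y t -> u y <= u t.
    by move=> yt; rewrite leNgt; apply/negP => ty; move/setP/(_ t): D; rewrite !inE yt ty.
  move: f0 => /eqP; rewrite /flux psumr_eq0 => [|t _]; last first.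
    case yt: (e y t); last by rewrite mul0r.
    by rewrite mul1r subr_ge0 H.
  move=> /allP /(_ z (mem_index_enum _)) /=.
  by rewrite yz mul1r subr_eq0 (negbTE zy).
have [t /andP [yt h]|H] := pickP [pred t | e y t && (u y < u t)]; first by exists t.
move/eqP: f0; rewrite -oppr_eq0 -sumrN psumr_eq0 => [|t _]; last first.
  rewrite -mulrN opprB; case yt: (e y t); last by rewrite mul0r.
  by rewrite mul1r subr_ge0 leNgt; have := H t; rewrite /= yt /= => ->.
move=> /allP /(_ z (mem_index_enum _)) /=.
by rewrite yz mul1r oppr_eq0 subr_eq0 (negbTE zy).
Qed.

(** Thin refers to the cut: a gap longer than [1/K] is crossed by fewer than [K] edges
    ([thin_crossing]). *)
Definition thin x := (0 < u x) && [forall y, (u y < u x) ==> (u y + K%:R^-1 < u x)].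

Lemma thinP x : reflect (0 < u x /\ forall y, u y < u x -> u y + K%:R^-1 < u x) (thin x).
Proof.
apply: (iffP andP) => -[x0 H]; split=> //.
  by move=> y yx; move/forallP/(_ y)/implyP: H; apply.
by apply/forallP => y; apply/implyP; exact: H.
Qed.

Let cnt x := #|[set y | u y < u x]|.

(** If the level following that of [z] were more than [1/K] away, it would be thin. *)
Lemma next_level z q : (exists2 y, u y = q & u z < q) -> 0 <= u z ->
  (forall y, thin y -> u z < u y -> q < u y) ->
  exists z', [/\ u z < u z', u z' <= q & u z' <= u z + K%:R^-1].
Proof.
move=> [y yq zq] z0 noth.
have [|z' zz' zmin] := @exists_argmin [pred t | u z < u t] y; first by rewrite /= yq.
have z'q : u z' <= q by rewrite -yq zmin //= yq.
exists z'; split=> //; rewrite leNgt; apply/negP => h.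
have : thin z'.
  apply/thinP; split; first exact: le_lt_trans zz'.
  move=> t tz'; apply: le_lt_trans h; rewrite lerD2r leNgt; apply/negP => zt.
  by move: tz'; rewrite ltNge zmin.
by move/noth => /(_ zz'); rewrite ltNge z'q.
Qed.

(* Induction on the level, splitting at the last thin level below [u x]: the
   vertices in between are one block. *)
Lemma thin_count x : thin x ->
  K%:R * u x + (dn e u (u x) x)%:R + slack R K #|crossing e u (u x)| / 2 + #|A|%:R
  <= (cnt x)%:R + K%:R + 2.
Proof.
have [n] := ubnP (cnt x); elim: n x => // n IH x /ltnSE cn thx.
have [x0 xgap] := thinP _ thx.
have [|w0 w0x w0max] := @exists_argmax [pred y | u y < u x] a0.
  by rewrite /= (uc_A uc).
have Ac : #|A|%:R <= (cnt x)%:R :> R.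
  by rewrite ler_nat subset_leq_card //; apply/fintype.subsetP => y /(uc_A uc) yA; rewrite inE yA.
have gapl y : u y < u x -> u y <= u w0 by move=> h; exact: w0max.
have thinw : K%:R^-1 < u x - u w0 by rewrite ltrBrDl xgap.
have S := thin_slack esym uc K2 x0 (uc_le uc x) gapl thinw.
have slack0 c : 0 <= slack R K c.
  rewrite /slack; case: ifP => // _; have : 2 <= K%:R :> R by rewrite ler_nat.
  by move=> h; rewrite divr_ge0 //; lra.
(* [pw] bounds from below the edges crossing the gap in addition to those of [x]; [P2] trades both
   for the crossing edges, which [thin_slack] bounds. One half of the slack is spent in [P1] on the
   block below, the other is left in the claim for the block above. *)
suff [pw P1 P2] : exists2 pw : nat,
    K%:R * u w0 + #|A|%:R <= (cnt x)%:R + pw%:R + slack R K #|crossing e u (u x)| / 2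
  & (dn e u (u x) x + pw <= #|crossing e u (u x)|.+1)%N.
  have : (dn e u (u x) x)%:R + pw%:R <= #|crossing e u (u x)|%:R + 1 :> R.
    by rewrite -natrD natr1 ler_nat.
  move: P1 S; rewrite mulrBr; lra.
have [w00|w00] := leP (u w0) 0.
  (* Only level [0] lies below the gap, and [A] is already counted in [cnt x]. *)
  exists 0%N; last by rewrite addn0 (leq_trans (leq_addr _ _) (dn_up_crossing esym (lexx (u x)) w0x)).
  have -> : u w0 = 0 by apply/eqP; rewrite eq_le w00 (uc_ge0 uc).
  have := slack0 #|crossing e u (u x)|; lra.
have wR : u w0 < Rr by apply: lt_le_trans w0x (uc_le uc x).
(* [w] replaces [w0] on the same level so as to have a neighbour on another level, hence one above,
   which lies beyond the gap. *)
have [w [t [ww wt tw]]] := level_escape w00 wR; rewrite -ww in tw.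
have [_ [t' wt' tw']] : (1 <= dn e u (u w) w)%N /\ (exists2 t, e w t & u w < u t).
  by apply: (harmonic_neighbors _ _ wt tw); rewrite ww.
have upw : (1 <= up e u (u x) w)%N.
  rewrite /up card_gt0; apply/set0Pn; exists t'; rewrite inE wt' leNgt.
  by apply/negP => /gapl; rewrite -ww leNgt tw'.
exists (up e u (u x) w); last by apply: dn_up_crossing; rewrite ?ww.
have [y1 /andP [ty1 y1w]|noth] := pickP [pred y | thin y && (u y <= u w0)]; last first.
  have Kw : K%:R * (u w0 - 0) <= #|[set z | (0 < u z < u w0)%R]|%:R + 1.
    apply: (@step_chain _ 0 (u w0) (ltnSn _)) => //; last by exists a0; rewrite (uc_A uc).
    move=> z z0 zw; apply: next_level => //; first by exists w0.
    by move=> y ty _; rewrite ltNge; have := noth y; rewrite /= ty /= => ->.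
  have : #|[set z | (0 < u z < u w0)%R]|%:R + 1 + #|A|%:R <= (cnt x)%:R :> R.
    rewrite natr1 -natrD ler_nat /cnt.
    have -> : #|[set z | (0 < u z < u w0)%R]|.+1 = #|w0 |: [set z | (0 < u z < u w0)%R]|.
      by rewrite cardsU1 inE ltxx andbF.
    have I0 : (w0 |: [set z | (0 < u z < u w0)%R]) :&: A = finset.set0.
      apply/setP => z; rewrite !inE; apply/negP => /andP [h /(uc_A uc) z0].
      by case/orP: h => [/eqP h|]; [rewrite -h z0 ltxx in w00 | rewrite z0 ltxx].
    rewrite -cardsUI I0 cards0 addn0.
    apply: subset_leq_card; apply/fintype.subsetP => z; rewrite !inE => /orP [/orP [/eqP -> //|]|].
      by case/andP => _ h; exact: lt_trans w0x.
    by move/(uc_A uc) => ->.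
  rewrite subr0 in Kw; have := slack0 #|crossing e u (u x)|.
  have := ler0n R (up e u (u x) w); lra.
have [|y /andP [ty yw] ymax] := @exists_argmax [pred y | thin y && (u y <= u w0)] y1.
  by rewrite /= ty1.
have [y0 ygap] := thinP _ ty.
have yR : u y < Rr by exact: le_lt_trans wR.
have [v [tv [vy vtv tvv]]] := level_escape y0 yR; rewrite -vy in tvv.
have [dnv _] : (1 <= dn e u (u v) v)%N /\ (exists2 t, e v t & u v < u t).
  by apply: (harmonic_neighbors _ _ vtv tvv); rewrite vy.
have thv : thin v by apply/thinP; rewrite vy.
have vx : u v < u x by rewrite vy (le_lt_trans yw).
have cvx : (cnt v < cnt x)%N.
  apply: proper_card; apply/properP; split; last by exists v; rewrite !inE ?ltxx.
  by apply/fintype.subsetP => z; rewrite !inE => /lt_trans; apply.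
have IHv := IH v (leq_trans cvx cn) thv.
have [|al ala almax] := @exists_argmax [pred z | u z < u v] a0.
  by rewrite /= (uc_A uc) // vy.
have BM : (K.+2)%:R + K%:R * (u w0 - u v) <=
  #|[set z | u v <= u z & u z < u x]|%:R + (dn e u (u v) v)%:R + (up e u (u x) w)%:R
    + (slack R K #|crossing e u (u v)| + slack R K #|crossing e u (u x)|) / 2.
  apply: (@block_main R T e esym eirr u A B Rr K dAB uc K2 degK (u al)) => //.
  - exact: (uc_ge0 uc).
  - by rewrite vy.
  - exact: (uc_le uc).
  - by rewrite ltrBrDl vy ygap // -vy.
  - move=> z vz zw; apply: next_level => //; first by exists w0.
    + exact: (uc_ge0 uc).
    + move=> s ts zs; rewrite ltNge; apply/negP => sw.
      have := ymax s; rewrite /= ts sw => /(_ isT); rewrite leNgt -vy.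
      by rewrite (le_lt_trans vz).
have : (cnt v)%:R + #|[set z | u v <= u z & u z < u x]|%:R = (cnt x)%:R :> R.
  have I0 : [set z | u z < u v] :&: [set z | u v <= u z & u z < u x] = finset.set0.
    by apply/setP => z; rewrite !inE leNgt; case: ltP.
  rewrite -natrD /cnt -cardsUI I0 cards0 addn0.
  congr (#|pred_of_set _|%:R); apply/setP => z; rewrite !inE.
  by case: (ltP (u z) (u v)) => //= h; rewrite (lt_trans h).
move: BM IHv; rewrite mulrBr -(natr1 K.+1) -(natr1 K); lra.
Qed.

(** [thin_count] is used at the last thin level; above it all steps are at most [1/K], and the
    vertices strictly between it and [Rr] pay for them. *)
Lemma resistance_bound b0 : b0 \in B ->
  K%:R * Rr + #|A|%:R + #|B|%:R <= #|T|%:R + K%:R + 2.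
Proof.
move=> b0B; have Rb : u b0 = Rr by exact: (uc_B uc).
have AB_le (S : {set T}) : [disjoint S & B] -> #|S|%:R + #|B|%:R <= #|T|%:R :> R.
  move=> dSB; rewrite -natrD ler_nat -cardsUI.
  by move: dSB; rewrite -setI_eq0 => /eqP ->; rewrite cards0 addn0 max_card.
have [y1 ty1|noth] := pickP thin; last first.
  have [R0|R0] := leP Rr 0.
    have := AB_le A dAB; have : K%:R * Rr <= 0 by rewrite mulr_ge0_le0.
    have := ler0n R K; lra.
  have : K%:R * (Rr - 0) <= #|[set z | (0 < u z < Rr)%R]|%:R + 1.
    apply: (@step_chain _ 0 Rr (ltnSn _)) => //; last by exists a0; rewrite (uc_A uc).
    move=> z z0 zw; apply: next_level => //; first by exists b0.
    by move=> y; rewrite noth.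
  have : #|[set z | (0 < u z < Rr)%R] :|: A|%:R + #|B|%:R <= #|T|%:R :> R.
    apply: AB_le; rewrite disjoint_subset; apply/fintype.subsetP => z; rewrite !inE.
    case/orP => [/andP [_ zR]|zA]; last by rewrite (disjointFr dAB zA).
    by apply/negP => /(uc_B uc) zb; rewrite zb ltxx in zR.
  have -> : #|[set z | (0 < u z < Rr)%R] :|: A|%:R = #|[set z | (0 < u z < Rr)%R]|%:R + #|A|%:R :> R.
    rewrite -natrD -cardsUI; have -> : [set z | (0 < u z < Rr)%R] :&: A = finset.set0.
      apply/setP => z; rewrite !inE; apply/negP => /andP [h /(uc_A uc) z0].
      by rewrite z0 ltxx in h.
    by rewrite cards0 addn0.
  have := ler0n R K; rewrite subr0; lra.
have [y ty ymax] := exists_argmax ty1.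
have [y0 _] := thinP _ ty.
have s0 : 0 <= slack R K #|crossing e u (u y)|.
  rewrite /slack; case: ifP => // _; have : 2 <= K%:R :> R by rewrite ler_nat.
  by move=> h; rewrite divr_ge0 //; lra.
have C : K%:R * u y + #|A|%:R <= (cnt y)%:R + K%:R + 2.
  by have := thin_count ty; have := ler0n R (dn e u (u y) y); lra.
have [yR|yR] := leP Rr (u y).
  have uyR : u y = Rr by apply/eqP; rewrite eq_le yR (uc_le uc).
  have : (cnt y)%:R + #|B|%:R <= #|T|%:R :> R.
    apply: AB_le; rewrite disjoint_subset; apply/fintype.subsetP => z; rewrite !inE => zR.
    by apply/negP => /(uc_B uc) zb; rewrite zb uyR ltxx in zR.
  by move: C; rewrite uyR; lra.
have : K%:R * (Rr - u y) <= #|[set z | (u y < u z < Rr)%R]|%:R + 1.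
  apply: (@step_chain _ (u y) Rr (ltnSn _)) => //; last by exists y.
  move=> z yz zR; apply: next_level => //; first by exists b0.
    exact: (uc_ge0 uc).
  move=> t tt zt; have := ymax t tt; rewrite leNgt => /negP []; exact: le_lt_trans zt.
have : #|[set z | u z < u y] :|: (y |: [set z | (u y < u z < Rr)%R])|%:R + #|B|%:R <= #|T|%:R :> R.
  apply: AB_le; rewrite disjoint_subset; apply/fintype.subsetP => z; rewrite !inE => h.
  apply/negP => /(uc_B uc) zb; move: h; rewrite zb ltxx andbF orbF.
  by case/orP => [|/eqP h]; [rewrite ltNge ltW | rewrite -h zb ltxx in yR].
have -> : #|[set z | u z < u y] :|: (y |: [set z | (u y < u z < Rr)%R])|%:R =
   (cnt y)%:R + #|[set z | (u y < u z < Rr)%R]|%:R + 1 :> R.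
  have c1 : #|y |: [set z | (u y < u z < Rr)%R]| = #|[set z | (u y < u z < Rr)%R]|.+1.
    by rewrite cardsU1 inE ltxx add1n.
  rewrite -addrA natr1 -c1 -natrD /cnt -cardsUI.
  have -> : [set z | u z < u y] :&: (y |: [set z | (u y < u z < Rr)%R]) = finset.set0.
    apply/setP => z; rewrite !inE; case: (ltP (u z) (u y)) => //= zy.
    rewrite ltNge (ltW zy) orbF; apply/negP => /eqP h; by rewrite h ltxx in zy.
  by rewrite cards0 addn0.
move: C; rewrite mulrBr; lra.
Qed.

End Sweep.

(** Only vertices of [A] and [B] have flux, with totals [1] and [-1], and [s] is constant on both
    sets. *)
Lemma current_green (R : realFieldType) (T : finType) (e : rel T) (esym : symmetric e)
    (u s : T -> R) (A B : {set T}) (Rr sA sB : R) : [disjoint A & B] ->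
  unit_current e u A B Rr -> (forall x, x \in A -> s x = sA) ->
  (forall x, x \in B -> s x = sB) -> dirichlet e u s = (sB - sA) *+ 2.
Proof.
move=> dAB uc HA HB.
have fB : \sum_(x in B) flux e u x = - 1.
  have := sum_flux0 esym u; rewrite (sum_disjoint_support dAB (uc_harm uc)) (uc_A1 uc).
  lra.
rewrite dirichletE // (sum_disjoint_support dAB) => [|x xA xB]; last by rewrite (uc_harm uc) ?mul0r.
rewrite (eq_bigr (fun x => flux e u x * sA)) => [|x xA]; last by rewrite HA.
rewrite [X in _ + X](eq_bigr (fun x => flux e u x * sB)) => [|x xB]; last by rewrite HB.
by rewrite -!mulr_suml fB (uc_A1 uc); congr (_ *+ _); ring.
Qed.

Lemma weighted_cauchy (R : realFieldType) (I : finType) (P : pred I) (g c : I -> R) :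
  (forall i, P i -> 0 <= g i) ->
  (\sum_(i | P i) g i * c i) ^+ 2 <= (\sum_(i | P i) g i) * (\sum_(i | P i) g i * c i ^+ 2).
Proof.
move=> g0; set S0 := \sum_(i | P i) g i; set S1 := \sum_(i | P i) g i * c i.
set S2 := \sum_(i | P i) _.
have S00 : 0 <= S0 by apply: sumr_ge0.
have E t : 0 <= S2 - S1 * t *+ 2 + S0 * t ^+ 2.
  have -> : S2 - S1 * t *+ 2 + S0 * t ^+ 2 = \sum_(i | P i) g i * (c i - t) ^+ 2.
    rewrite /S0 /S1 /S2 !mulr_suml -sumrMnl -sumrB -big_split /=.
    by apply: eq_bigr => i _; ring.
  by apply: sumr_ge0 => i Pi; rewrite mulr_ge0 ?g0 ?sqr_ge0.
have [S0z|S0p] := eqVneq S0 0.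
  have g00 i : P i -> g i = 0.
    by move=> Pi; apply/eqP; move/eqP: S0z; rewrite psumr_eq0 // => /allP /(_ i (mem_index_enum _)) /implyP; apply.
  by rewrite S0z mul0r /S1 big1 ?expr0n // => i Pi; rewrite g00 ?mul0r.
have S0' : 0 < S0 by rewrite lt_neqAle eq_sym S0p.
have := E (S1 / S0); rewrite -(pmulr_rge0 _ S0').
have -> : S0 * (S2 - S1 * (S1 / S0) *+ 2 + S0 * (S1 / S0) ^+ 2) = S0 * S2 - S1 ^+ 2 by field.
by rewrite subr_ge0.
Qed.

(** * Smoothing along the order of the vertices *)

Section Smoothing.
Variables (R : realFieldType) (n K : nat) (e : rel 'I_n).
Hypotheses (esym : symmetric e) (eirr : irreflexive e).
Hypothesis econn : forall x y, connect e x y.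
Hypothesis K2 : (2 <= K)%N.
Hypothesis degK : forall x, (K.+1 <= #|[set y | e x y]|)%N.
Variable f : nat -> R.
Hypothesis fmono : forall i j, (i <= j)%N -> (j < n)%N -> f i <= f j.

Let g k := f k.+1 - f k.
Let cur k : R := \sum_(x : 'I_n | (x <= k)%N) \sum_(y : 'I_n | (k < y)%N) (e x y)%:R * (f y - f x).
Let r k := g k / cur k.
Let rho j := \sum_(k < j) r k.
Let energy := \sum_(x : 'I_n) \sum_(y : 'I_n | (x < y)%N) (e x y)%:R * (f y - f x) ^+ 2.

Let K0 : 0 < K%:R :> R.
Proof. by rewrite ltr0n (ltn_trans _ K2). Qed.

Lemma g_ge0 k : (k.+1 < n)%N -> 0 <= g k.
Proof. by move=> kn; rewrite subr_ge0 fmono. Qed.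

Lemma cur_ge0 k : 0 <= cur k.
Proof.
apply: sumr_ge0 => x xk; apply: sumr_ge0 => y ky.
by rewrite mulr_ge0 ?ler0n // subr_ge0 fmono // (leq_trans xk) // ltnW.
Qed.

(** By connectedness some edge crosses the cut, and it spans the gap. Hence [cur k = 0] forces
    [g k = 0], which makes [cur_r] true under the convention that division by zero gives [0]. *)
Lemma g_le_cur k : (k.+1 < n)%N -> g k <= cur k.
Proof.
move=> kn; have kn' := ltnW kn.
have [x [y [xk ky xy]]] : exists x y : 'I_n, [/\ (x <= k)%N, (k < y)%N & e x y].
  suff /existsP [x /existsP [y /and3P [h1 h2 h3]]] :
    [exists x : 'I_n, exists y : 'I_n, [&& (x <= k)%N, (k < y)%N & e x y]] by exists x, y.
  apply: contraT; rewrite negb_exists => /forallP H.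
  suff : Ordinal kn \in [set z : 'I_n | (z <= k)%N] by rewrite inE /= ltnn.
  apply: (@connected_closed _ e econn _ (Ordinal kn')); first by rewrite inE /=.
  move=> y z; rewrite !inE => yk yz; rewrite leqNgt; apply/negP => kz.
  by case/negP: (H y); apply/existsP; exists z; rewrite yk kz.
rewrite /cur (bigD1 x) //= (bigD1 y) //= xy mul1r -[leRHS]addrA -[leLHS]addr0; apply: lerD.
  by rewrite /g; apply: lerB; apply: fmono => //; apply: leq_ltn_trans kn'.
apply: addr_ge0; apply: sumr_ge0 => z /andP [zk _]; last apply: sumr_ge0 => t kt.
  by rewrite mulr_ge0 ?ler0n // subr_ge0 fmono // (leq_trans xk) // ltnW.
by rewrite mulr_ge0 ?ler0n // subr_ge0 fmono // (leq_trans zk) // ltnW.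
Qed.

Lemma cur_r k : (k.+1 < n)%N -> cur k * r k = g k.
Proof.
move=> kn; rewrite /r; have [c0|cn0] := eqVneq (cur k) 0; last by rewrite mulrC divfK.
rewrite c0 mul0r; apply/eqP; rewrite eq_le g_ge0 //= -c0; exact: g_le_cur.
Qed.

Lemma r_ge0 k : (k.+1 < n)%N -> 0 <= r k.
Proof. by move=> kn; rewrite divr_ge0 ?g_ge0 ?cur_ge0. Qed.

Lemma f_diff (c : nat -> R) i j : (i <= j)%N -> (j < n)%N ->
  \sum_(k < n.-1 | (i <= k < j)%N) (c k.+1 - c k) = c j - c i.
Proof.
move=> ij jn; rewrite -(big_mkord (fun k => (i <= k < j)%N) (fun k => c k.+1 - c k)).
rewrite -(telescope_sumr _ ij) [RHS]big_nat_cond.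
rewrite (big_cat_nat _ (n := j)) //=; last by lia.
rewrite [X in _ + X]big_nat_cond [X in _ + X]big_pred0 ?addr0; last by move=> k; lia.
rewrite (big_cat_nat _ (n := i)) //=.
rewrite [X in X + _]big_nat_cond [X in X + _]big_pred0 ?add0r; last by move=> k; lia.
by rewrite [LHS]big_nat_cond; apply: eq_bigl => k; lia.
Qed.

(** Exchange of summation: the edge between [x < y] crosses exactly the cuts [k] with
    [x <= k < y]. *)
Lemma sum_cur (c : nat -> R) :
  \sum_(x : 'I_n) \sum_(y : 'I_n | (x < y)%N) (e x y)%:R * (f y - f x) *
     (\sum_(k < n.-1 | (x <= k < y)%N) c k) = \sum_(k < n.-1) c k * cur k.
Proof.
transitivity (\sum_(x : 'I_n) \sum_(y : 'I_n) \sum_(k < n.-1)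
   if (x <= k < y)%N then c k * ((e x y)%:R * (f y - f x)) else 0).
  apply: eq_bigr => x _; rewrite big_mkcond; apply: eq_bigr => y _.
  rewrite -big_mkcond -mulr_suml [RHS]mulrC; case: ltnP => // yx.
  by rewrite big_pred0 ?mulr0 // => k; lia.
under eq_bigr do rewrite exchange_big.
rewrite exchange_big; apply: eq_bigr => k _.
rewrite /cur mulr_sumr [RHS]big_mkcond; apply: eq_bigr => x _.
case: leqP => xk /=; last by rewrite big1.
by rewrite mulr_sumr [RHS]big_mkcond.
Qed.

Lemma energyE : energy = \sum_(k < n.-1) g k * cur k.
Proof.
rewrite -sum_cur; apply: eq_bigr => x _; apply: eq_bigr => y xy.
by rewrite (f_diff f) ?(ltnW xy) // expr2 mulrA.
Qed.

Lemma rho_diff i j : (i <= j)%N -> rho j - rho i = \sum_(i <= k < j) r k.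
Proof.
move=> ij; rewrite /rho -!(big_mkord xpredT r) (big_cat_nat _ (n := i)) //=.
by rewrite [LHS]addrC addKr.
Qed.

Lemma rho_S k : rho k.+1 - rho k = r k.
Proof. by rewrite /rho big_ord_recr /= [LHS]addrC addKr. Qed.

Lemma rho_mono i j : (i <= j)%N -> (j < n)%N -> rho i <= rho j.
Proof.
move=> ij jn; rewrite -subr_ge0 rho_diff // big_nat_cond; apply: sumr_ge0 => k.
by rewrite andbT => /andP [_ kj]; apply: r_ge0; apply: leq_ltn_trans jn.
Qed.

Lemma dirichlet_half (T : 'I_n -> R) : dirichlet e T T =
  (\sum_(x : 'I_n) \sum_(y : 'I_n | (x < y)%N) (e x y)%:R * (T y - T x) ^+ 2) *+ 2.
Proof.
rewrite mulr2n /dirichlet.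
have -> : \sum_(x : 'I_n) \sum_(y : 'I_n) (e x y)%:R * ((T y - T x) * (T y - T x)) =
   \sum_(x : 'I_n) \sum_(y : 'I_n | (x < y)%N) (e x y)%:R * (T y - T x) ^+ 2 +
   \sum_(x : 'I_n) \sum_(y : 'I_n | (y < x)%N) (e x y)%:R * (T y - T x) ^+ 2.
  rewrite -big_split; apply: eq_bigr => x _ /=.
  rewrite [X in _ = X + _]big_mkcond [X in _ = _ + X]big_mkcond -big_split /=.
  apply: eq_bigr => y _; case: ltngtP => h; rewrite ?addr0 ?add0r -?expr2 //.
  by rewrite (ord_inj h) subrr expr0n mulr0.
congr (_ + _); rewrite (exchange_big_dep xpredT) //=; apply: eq_bigr => x _.
by apply: eq_bigr => y _; rewrite esym -(opprB (T y)) sqrrN.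
Qed.

(** Put [P = rho j - rho i] and let [s] be [rho] clamped to the window. The forms of [(u, u)],
    [(u, s)] and [(s, s)] are [2 Rr], [2 P] and at most [2 P], so nonnegativity of the form at
    [u - s] gives [P <= Rr]. *)
Lemma resistance_window i j : (i < j)%N -> (j < n)%N ->
  rho j - rho i <= (j%:R - i%:R + K%:R + 1) / K%:R.
Proof.
move=> ij jn; have i_n := ltn_trans ij jn.
pose A := [set x : 'I_n | (x <= i)%N]; pose B := [set x : 'I_n | (j <= x)%N].
have iA : Ordinal i_n \in A by rewrite inE /=.
have jB : Ordinal jn \in B by rewrite inE /=.
have dAB : [disjoint A & B].
  by rewrite disjoint_subset; apply/fintype.subsetP => x; rewrite !inE; lia.
have [u [Rr _ uc]] := @unit_current_exists R _ e esym econn A B _ _ iA jB dAB.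
have := resistance_bound esym eirr econn dAB uc K2 degK iA jB.
have -> : #|A|%:R = i%:R + 1 :> R.
  have -> : A = [set widen_ord i_n k | k in 'I_i.+1].
    apply/setP => x; rewrite inE; apply/idP/imsetP => [xi|[k _ ->]] /=; last by rewrite -ltnS.
    by exists (Ordinal (xi : (x < i.+1)%N)) => //; apply: val_inj.
  by rewrite card_imset ?card_ord ?natr1 // => k l /(congr1 val) /= /ord_inj.
have -> : #|B|%:R = n%:R - j%:R :> R.
  rewrite -(natrB _ (ltnW jn)); have -> : B = ~: [set widen_ord (ltnW jn) k | k in 'I_j].
    apply/setP => x; rewrite !inE; apply/idP/negP => [jx /imsetP [k _ xk]|h].
      by move: jx; rewrite xk /= leqNgt ltn_ord.
    rewrite leqNgt; apply/negP => xj; apply: h; apply/imsetP.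
    by exists (Ordinal xj) => //; apply: val_inj.
  rewrite cardsCs finset.setCK card_ord card_imset ?card_ord // => k l /(congr1 val) /= /ord_inj.
  done.
rewrite card_ord => HR.
suff PR : rho j - rho i <= Rr.
  rewrite ler_pdivlMr // mulrC.
  have : K%:R * (rho j - rho i) <= K%:R * Rr by rewrite ler_pM2l.
  by move: HR; lra.
pose s (x : 'I_n) := rho (minn j (maxn i x)).
have sA x : x \in A -> s x = rho i.
  by rewrite inE /s => xi; rewrite (maxn_idPl xi) (minn_idPr _) // ltnW.
have sB x : x \in B -> s x = rho j.
  rewrite inE /s => xi; rewrite (maxn_idPr _) ?(minn_idPl _) //.
  by apply: leq_trans xi; exact: ltnW.
have us := current_green esym dAB uc sA sB.
have uu := current_green esym dAB uc (uc_A uc) (uc_B uc).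
pose c k := if (i <= k < j)%N then (cur k)^-1 else 0.
(* Since [g k * c k] is the step of [rho] inside the window, Cauchy-Schwarz bounds the squared
   increment of [s] along an edge by [f y - f x] times the sum of [g k * c k ^+ 2] over the cuts it
   crosses; [sum_cur] adds up the edges. *)
have ss : dirichlet e s s <= (rho j - rho i) *+ 2.
  rewrite dirichlet_half ler_pMn2r //.
  have -> : rho j - rho i = \sum_(k < n.-1) (g k * c k ^+ 2) * cur k.
    rewrite -(f_diff rho (ltnW ij) jn) big_mkcond.
    apply: eq_bigr => k _; rewrite /c; case: ifP => _; last by rewrite expr0n mulr0 mul0r.
    rewrite rho_S /r.
    by have [->|c0] := eqVneq (cur k) 0; [rewrite invr0 !mulr0 | field].
  rewrite -(sum_cur (fun k => g k * c k ^+ 2)).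
  apply: ler_sum => x _; apply: ler_sum => y xy.
  rewrite -mulrA; apply: ler_wpM2l; first by rewrite ler0n.
  have xyn : (minn j (maxn i x) <= minn j (maxn i y))%N by lia.
  have yjn : (minn j (maxn i y) < n)%N by have := ltn_ord y; lia.
  have -> : s y - s x = \sum_(k < n.-1 | (x <= k < y)%N) g k * c k.
    rewrite /s -(f_diff rho xyn yjn) big_mkcond [RHS]big_mkcond; apply: eq_bigr => k _.
    rewrite rho_S /c /r.
    have -> : (minn j (maxn i x) <= k < minn j (maxn i y))%N = (i <= k < j)%N && (x <= k < y)%N by lia.
    by case: (i <= k < j)%N => //=; rewrite mulr0; case: ifP.
  rewrite -(f_diff f (ltnW xy) (ltn_ord y)).
  by apply: weighted_cauchy => k _; apply: g_ge0; have := ltn_ord k; lia.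
have : 0 <= dirichlet e (fun x => u x - s x) (fun x => u x - s x) by exact: dirichlet_ge0.
have -> : dirichlet e (fun x => u x - s x) (fun x => u x - s x) =
   dirichlet e u u - dirichlet e u s *+ 2 + dirichlet e s s.
  rewrite /dirichlet -sumrMnl -sumrB -big_split; apply: eq_bigr => x _ /=.
  rewrite -sumrMnl -sumrB -big_split; apply: eq_bigr => y _ /=; ring.
by rewrite uu us; move: ss; rewrite !mulr2n; lra.
Qed.

Let rmax := rho n.-1.

Hypothesis n0 : (0 < n)%N.

Let rho_ge0 j : (j < n)%N -> 0 <= rho j.
Proof. by move=> jn; rewrite -[0](_ : rho 0 = 0) ?rho_mono // /rho big_ord0. Qed.

(** The length of the part of the interval from [rho k] to [rho k.+1] that lies below [x]. *)
Let ov k x := Num.min x (rho k.+1) - Num.min x (rho k).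

(* [pot (rho j) = f j - f 0], with slope [cur k] from [rho k] to [rho k.+1];
   [act] integrates the square of this slope. *)
Let pot x := \sum_(k < n.-1) ov k x * cur k.
Let act x := \sum_(k < n.-1) ov k x * cur k ^+ 2.

Lemma ov_mono k x y : (k.+1 < n)%N -> x <= y -> ov k x <= ov k y.
Proof.
move=> kn xy; have := rho_mono (leqnSn k) kn; rewrite /ov.
case: (leP x (rho k)); case: (leP x (rho k.+1)); case: (leP y (rho k)); case: (leP y (rho k.+1)); lra.
Qed.

Lemma ov_sum x : 0 <= x -> x <= rmax -> \sum_(k < n.-1) ov k x = x.
Proof.
move=> x0 xm; rewrite /ov -(big_mkord xpredT (fun k => Num.min x (rho k.+1) - Num.min x (rho k))).
rewrite (telescope_sumr (fun k => Num.min x (rho k))) // (min_idPl xm).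
by rewrite /rho big_ord0 (min_idPr x0) subr0.
Qed.

Lemma act_mono x y : x <= y -> act x <= act y.
Proof.
move=> xy; apply: ler_sum => k _; apply: ler_wpM2r; first exact: sqr_ge0.
by apply: ov_mono => //; have := ltn_ord k; lia.
Qed.

(** Cauchy-Schwarz for the slope of [pot] between [x] and [y]. *)
Lemma pot_act x y : 0 <= x -> x <= y -> y <= rmax ->
  (pot y - pot x) ^+ 2 <= (y - x) * (act y - act x).
Proof.
move=> x0 xy ym.
have -> : y - x = \sum_(k < n.-1) (ov k y - ov k x).
  by rewrite sumrB !ov_sum ?(le_trans x0 xy) ?(le_trans xy ym).
rewrite /pot /act -!sumrB.
rewrite [X in X ^+ 2 <= _](eq_bigr (fun k : 'I_n.-1 => (ov k y - ov k x) * cur k)) => [|k _]; last by rewrite [RHS]mulrBl.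
rewrite [X in _ <= _ * X](eq_bigr (fun k : 'I_n.-1 => (ov k y - ov k x) * cur k ^+ 2)) => [|k _]; last by rewrite [RHS]mulrBl.
apply: weighted_cauchy => k _; rewrite subr_ge0 ov_mono //; have := ltn_ord k; lia.
Qed.

Lemma ov_rho j k : (j < n)%N -> (k.+1 < n)%N -> ov k (rho j) = if (k < j)%N then r k else 0.
Proof.
move=> jn kn; rewrite /ov; case: ltnP => h.
  by rewrite (min_idPr (rho_mono h jn)) (min_idPr (rho_mono (ltnW h) jn)) rho_S.
by rewrite !(min_idPl _) ?subrr // rho_mono // ltnW.
Qed.

Lemma pot_rho j : (j < n)%N -> pot (rho j) = f j - f 0%N.
Proof.
move=> jn; rewrite -(f_diff f (leq0n j) jn) [RHS]big_mkcond; apply: eq_bigr => k _.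
have kn : (k.+1 < n)%N by have := ltn_ord k; lia.
by rewrite ov_rho //=; case: ifP => _; rewrite ?mul0r // mulrC cur_r.
Qed.

Lemma act_rmax : act rmax = energy.
Proof.
rewrite energyE; apply: eq_bigr => k _.
have kn : (k.+1 < n)%N by have := ltn_ord k; lia.
by rewrite ov_rho ?ltn_predL // ltn_ord expr2 mulrA [r k * _]mulrC cur_r.
Qed.

Lemma act0 : act 0 = 0.
Proof.
rewrite /act big1 // => k _.
have -> : ov k 0 = if (k < 0)%N then r k else 0.
  have kn : (k.+1 < n)%N by have := ltn_ord k; lia.
  by rewrite -(ov_rho n0 kn) /rho big_ord0.
by rewrite mul0r.
Qed.

(* The steps of [rho] are truncated at [1 / K], with catching up. *)
Fixpoint lag j := if j is j'.+1 then Num.min (rho j'.+1) (lag j' + K%:R^-1) else 0.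

(** [i] is the last index at which [lag] was reset to [rho], or [0]; since then it has advanced by
    [1/K] at every step. *)
Lemma lagP j : exists2 i, (i <= j)%N & lag j = rho i + (j%:R - i%:R) / K%:R.
Proof.
elim: j => [|j [i ij IH]] /=.
  by exists 0%N => //; rewrite /rho big_ord0 subrr mul0r addr0.
rewrite minElt; case: ifP => _.
  by exists j.+1 => //; rewrite subrr mul0r addr0.
by exists i; [exact: leqW | rewrite IH -natr1; field; rewrite gt_eqF].
Qed.

Lemma lag_le_rho j : lag j <= rho j.
Proof. by case: j => [|j] /=; [rewrite /rho big_ord0 | rewrite ge_min lexx]. Qed.

Lemma lag_step j : lag j.+1 - lag j <= K%:R^-1.
Proof. by rewrite lerBlDl /= ge_min lexx orbT. Qed.

Lemma lag_mono j : (j.+1 < n)%N -> lag j <= lag j.+1.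
Proof.
move=> jn; rewrite /= le_min lerDl invr_ge0 ler0n andbT.
exact: le_trans (lag_le_rho j) (rho_mono (leqnSn j) jn).
Qed.

Lemma lag_ge0 j : (j < n)%N -> 0 <= lag j.
Proof. by elim: j => //= j IH jn; apply: le_trans (IH (ltnW jn)) (lag_mono jn). Qed.

Lemma rho_lag j : (j < n)%N -> rho j - lag j <= K.+1%:R / K%:R.
Proof.
move=> jn; have [i ij ->] := lagP j.
have [ij'|ij'] := ltnP i j.
  have := resistance_window ij' jn; rewrite -natr1.
  have -> : (j%:R - i%:R + K%:R + 1) / K%:R = (K%:R + 1) / K%:R + (j%:R - i%:R) / K%:R :> R.
    by field; rewrite gt_eqF.
  lra.
have -> : i = j by lia.
by rewrite subrr mul0r addr0 subrr divr_ge0.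
Qed.

(** From the reset index [i] on, [rho] has advanced by at most [(j - i + K + 1)/K], which [lag]
    reaches after [K + 1] further steps. *)
Lemma lag_catch_up j : (j + K.+1 < n)%N -> rho j <= lag (j + K.+1)%N.
Proof.
move=> jn; have [i ij ->] := lagP (j + K.+1)%N.
have jn' : (j < n)%N by apply: leq_ltn_trans jn; exact: leq_addr.
have [ij'|ij'] := ltnP i j.
  have := resistance_window ij' jn'; rewrite natrD -natr1.
  have -> : j%:R - i%:R + K%:R + 1 = j%:R + (K%:R + 1) - i%:R :> R by ring.
  lra.
have := rho_mono ij' (leq_ltn_trans ij jn) => h.
apply: le_trans h _; rewrite lerDl divr_ge0 // subr_ge0 ler_nat //.
Qed.

Lemma smoothing : exists h : nat -> R,
  K%:R * (\sum_(j < n.-1) (h j.+1 - h j) ^+ 2) <= energy /\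
  K%:R * (\sum_(j < n) (f j - h j) ^+ 2) <= K.+1%:R ^+ 2 * energy.
Proof.
have nn : (n.-1 < n)%N by rewrite ltn_predL.
have lag_max j : (j < n)%N -> lag j <= rmax.
  by move=> jn; apply: le_trans (lag_le_rho j) _; apply: rho_mono => //; lia.
have e0 : 0 <= energy.
  by rewrite -act_rmax -[leLHS]act0; apply: act_mono; exact: rho_ge0.
have act_e x : x <= rmax -> act x <= energy by rewrite -act_rmax; exact: act_mono.
have act_p x : 0 <= x -> 0 <= act x by move=> x0; rewrite -[leLHS]act0; exact: act_mono.
(* Since [pot (rho j) = f j - f 0], this is [f] with [rho j] replaced by [lag j]. *)
exists (fun j => pot (lag j) + f 0%N); split.
  apply: (@le_trans _ _ (\sum_(j < n.-1) (act (lag j.+1) - act (lag j)))).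
    rewrite mulr_sumr; apply: ler_sum => j _.
    have jn : (j.+1 < n)%N by have := ltn_ord j; lia.
    rewrite opprD addrACA subrr addr0 -ler_pdivlMl //.
    apply: le_trans (pot_act (lag_ge0 (ltnW jn)) (lag_mono jn) (lag_max _ jn)) _.
    apply: ler_wpM2r; last exact: lag_step.
    by rewrite subr_ge0; apply: act_mono; exact: lag_mono.
  rewrite -(big_mkord xpredT (fun j => act (lag j.+1) - act (lag j))).
  rewrite (telescope_sumr (fun j => act (lag j))) //= act0 subr0.
  by apply: act_e; exact: lag_max.
(* Extending by [energy] beyond [n] keeps [act (rho j) <= b (j + K.+1)] valid up to the end; the
   shifted differences then telescope to [K.+1] terms, each at most [energy]. *)
pose b j := if (j < n)%N then act (lag j) else energy.
have bK : \sum_(j < n) (b (j + K.+1)%N - b j) <= K.+1%:R * energy.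
  rewrite shift_telescope -[K.+1 in leRHS]card_ord mulr_natl -sumr_const; apply: ler_sum => j _.
  rewrite lerBlDr /b ltnNge leq_addl /= lerDl; case: ifP => // jn.
  by apply: act_p; exact: lag_ge0.
apply: (@le_trans _ _ (K.+1%:R * \sum_(j < n) (b (j + K.+1)%N - b j))); last first.
  by rewrite expr2 -mulrA ler_pM2l // ltr0n.
rewrite !mulr_sumr; apply: ler_sum => j _.
have jn := ltn_ord j.
have -> : f j - (pot (lag j) + f 0%N) = pot (rho j) - pot (lag j) by rewrite pot_rho //; ring.
rewrite -ler_pdivlMl //.
apply: le_trans (pot_act (lag_ge0 jn) (lag_le_rho j) (rho_mono (_ : (j <= n.-1)%N) nn)) _; first by lia.
rewrite mulrA [_^-1 * _]mulrC; apply: ler_pM => //.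
- by rewrite subr_ge0 lag_le_rho.
- by rewrite subr_ge0 act_mono // lag_le_rho.
- exact: rho_lag.
rewrite /b jn lerD2r.
case: ltnP => h; first by apply: act_mono; exact: lag_catch_up.
by apply: act_e; apply: rho_mono => //; lia.
Qed.

End Smoothing.

(** * The second smallest eigenvalue *)

Section SpectralGap.
Variables (R : realType) (n : nat) (A : 'M[R]_n).
Hypothesis Asym : A^T = A.

Let toC : {rmorphism R -> R[i]} := real_complex R.

(** The spectral theorem is applied over [R[i]]: the rows of [U] form a unitary eigenbasis and [z]
    gives the coordinates of [h], so moduli appear although the forms are real. *)
Lemma spectral_decomposition : exists (d : 'I_n -> R) (U : 'M[R[i]]_n),
  [/\ U \in unitmx, perm_eq [seq d i | i <- enum 'I_n] (spectrum A),
      forall i, row i U *m map_mx toC A = toC (d i) *: row i U &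
      forall h : 'cV[R]_n, let z i := (U *m map_mx toC h) i 0 in
        toC ((h^T *m A *m h) 0 0) = \sum_i toC (d i) * `|z i| ^+ 2 /\
        toC ((h^T *m h) 0 0) = \sum_i `|z i| ^+ 2].
Proof.
pose B := map_mx toC A.
have Breal : B \is a mxOver Num.real.
  apply/mxOverP => i j; rewrite mxE; apply/complex_realP; by exists (A i j).
have Bh : B \is hermsymmx.
  apply: realsym_hermsym => //.
  apply/is_hermitianmxP; rewrite expr0 scale1r.
  apply/matrixP => i j; rewrite !mxE; congr (toC _).
  by move/matrixP: Asym => /(_ i j); rewrite mxE.
have Dr := hermitian_spectral_diag_real Bh.
have [U [D [Uu Uunit {}Dr E]]] : exists U D, [/\ U \is unitarymx, U \in unitmx,
    D \is a mxOver Num.real & B = invmx U *m diag_mx D *m U].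
  exists (spectralmx B), (spectral_diag B); split=> //.
  - exact: spectral_unitarymx.
  - exact: spectral_unit.
  - exact/orthomx_spectralP/hermitian_normalmx.
have UB : U *m B = diag_mx D *m U by rewrite E 2!mulmxA mulmxV // mul1mx.
pose d i := complex.Re (D 0 i).
have dD i : toC (d i) = D 0 i.
  by have /mxOverP/(_ 0 i)/complex_realP [x Dx] := Dr; rewrite /d Dx.
have Uinv : invmx U = (U ^t*)%sesqui by exact: invmx_unitary.
exists d, U; split=> //.
- have [_ cA] := spectrumP Asym.
  apply: prod_XsubC_eq; rewrite -cA; apply: (map_poly_inj toC).
  rewrite map_char_poly -/B {1}E char_poly_conj //.
  rewrite char_poly_trig ?diag_mx_is_trig // rmorph_prod /= big_map big_enum /=.
  apply: eq_bigr => i _; rewrite rmorphB /= map_polyX map_polyC /= mxE eqxx mulr1n.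
  by rewrite -dD.
- move=> i; rewrite -row_mul -/B UB row_mul dD.
  apply/rowP => j; rewrite !mxE (bigD1 i) //= !mxE eqxx mulr1n big1 ?addr0 // => k ki.
  by rewrite !mxE eq_sym (negbTE ki) mulr0n mul0r.
move=> h z; set hc := map_mx toC h in z *.
have hcT : hc^T = (hc ^t*)%sesqui.
  by apply/matrixP => i j; rewrite !mxE; symmetry; exact: conjc_real.
have hTC : hc^T = map_mx toC h^T by apply/matrixP => i j; rewrite !mxE.
have zT : (hc ^t* *m U ^t*)%sesqui = ((U *m hc) ^t*)%sesqui.
  by rewrite trmx_mul map_mxM.
have normE (x : R[i]) : x^* * x = `|x| ^+ 2 by rewrite normCK mulrC.
split.
  have -> : toC ((h^T *m A *m h) 0 0) = (hc^T *m B *m hc) 0 0.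
    by rewrite hTC /hc /B -!map_mxM [RHS]mxE.
  rewrite E Uinv !mulmxA hcT zT -mulmxA mxE; apply: eq_bigr => i _.
  rewrite mul_mx_diag !mxE -dD -/(z i).
  have -> : \sum_j U i j * hc j 0 = z i by rewrite /z mxE.
  by rewrite -normE mulrAC mulrC -/toC mulrA.
have -> : toC ((h^T *m h) 0 0) = (hc^T *m hc) 0 0.
  by rewrite hTC /hc -!map_mxM [RHS]mxE.
have -> : hc^T *m hc = (hc^T *m invmx U) *m (U *m hc).
  by rewrite -mulmxA mulKmx.
rewrite Uinv hcT zT mxE; apply: eq_bigr => i _.
by rewrite -normE !mxE /z !mxE.
Qed.

Hypothesis A1 : A *m const_mx 1 = 0 :> 'cV_n.
Hypothesis Apsd : forall h : 'cV[R]_n, 0 <= (h^T *m A *m h) 0 0.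
Hypothesis Aker : forall h : 'cV[R]_n, (h^T *m A *m h) 0 0 = 0 -> forall i j, h i 0 = h j 0.
Hypothesis n2 : (2 <= n)%N.

Let s := spectrum A.

Lemma size_spectrum : size s = n.
Proof.
have [d [U [_ /perm_size <- _ _]]] := spectral_decomposition.
by rewrite size_map size_enum_ord.
Qed.

Lemma spectrum_eigenvector a : a \in s -> exists2 v : 'cV[R]_n, v != 0 & A *m v = a *: v.
Proof.
move=> sa; have : root (char_poly A) a.
  by have [_ ->] := spectrumP Asym; rewrite root_prod_XsubC.
rewrite -eigenvalue_root_char => /eigenvalueP [v vA v0]; exists v^T.
  by rewrite trmx_eq0.
by rewrite -{1}Asym -trmx_mul vA linearZ.
Qed.

Lemma spectrum_ge0 a : a \in s -> 0 <= a.
Proof.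
move=> /spectrum_eigenvector [v v0 Av].
have : 0 < (v^T *m v) 0 0.
  have [i vi] : exists i, v i 0 != 0.
    apply/existsP; apply: contraT; rewrite negb_exists => /forallP H.
    case/negP: v0; apply/eqP/colP => i; rewrite mxE; apply/eqP; have := H i.
    by rewrite negbK.
  rewrite mxE (bigD1 i) //= !mxE -expr2 ltr_pwDl //.
    by rewrite lt_neqAle eq_sym expf_eq0 /= vi sqr_ge0.
  by apply: sumr_ge0 => j _; rewrite !mxE -expr2 sqr_ge0.
have := Apsd v; rewrite -mulmxA Av -scalemxAr mxE => h h'.
by move: h; rewrite pmulr_lge0.
Qed.

Lemma spectrum0 : s`_0 = 0.
Proof.
have s0 : 0 \in s.
  rewrite -root_prod_XsubC; have [_ <-] := spectrumP Asym.
  rewrite -eigenvalue_root_char; apply/eigenvalueP; exists (const_mx 1).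
    by rewrite scale0r -[LHS]trmxK trmx_mul Asym trmx_const A1 trmx0.
  apply/eqP => /rowP /(_ (Ordinal (ltnW n2))); rewrite !mxE => /eqP.
  by rewrite oner_eq0.
have sz := size_spectrum; have [ss _] := spectrumP Asym.
apply/eqP; rewrite eq_le spectrum_ge0 ?mem_nth ?sz ?(ltnW n2) // andbT.
rewrite -[leRHS](nth_index 0 s0); apply: (sorted_leq_nth le_trans lexx 0 ss) => //.
  by rewrite inE -/s sz ltnW.
by rewrite inE index_mem.
Qed.

(** The real and the imaginary part of such a row are real kernel vectors, hence constant by [Aker];
    [g] stands for either part. *)
Lemma kernel_row (U : 'M[R[i]]_n) i : row i U *m map_mx toC A = 0 ->
  forall j k, U i j = U i k.
Proof.
move=> UA; have H (g : R[i] -> R) : (forall x y, g (x * toC y) = g x * y) ->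
   (forall x y, g (x + y) = g x + g y) -> g 0 = 0 -> forall j k, g (U i j) = g (U i k).
  move=> gM gD g0.
  have gs (F : 'I_n -> R[i]) : g (\sum_k F k) = \sum_k g (F k).
    by apply: (big_morph g gD g0).
  pose v : 'cV[R]_n := \col_j g (U i j).
  have vA : v^T *m A = 0.
    apply/rowP => j; move/rowP/(_ j): UA; rewrite !mxE => /(congr1 g).
    by rewrite gs g0 => h; rewrite -[RHS]h; apply: eq_bigr => k _; rewrite !mxE gM.
  have := Aker (h := v); rewrite vA mul0mx mxE => /(_ erefl) vc j k.
  by have := vc j k; rewrite !mxE.
move=> j k; apply/eqP; rewrite eq_complex; apply/andP; split; apply/eqP.
  by apply: H => [[a b] y|[a b] [c d]|] //=; rewrite mulr0 subr0.
by apply: H => [[a b] y|[a b] [c d]|] //=; rewrite mulr0 add0r.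
Qed.

(** If [0] occurred twice, two rows of [U] would be constant, hence linearly dependent, although [U]
    is invertible. *)
Lemma spectrum1_gt0 : 0 < s`_1.
Proof.
have sz := size_spectrum.
rewrite lt_neqAle spectrum_ge0 ?mem_nth ?sz // andbT eq_sym; apply/eqP => s1.
have [d [U [Uu perm_d rowU _]]] := spectral_decomposition.
have c2 : (2 <= count (pred1 0%R) [seq d i | i <- enum 'I_n])%N.
  rewrite (permP perm_d) -/s; case: s sz spectrum0 s1 => [|a [|b t]] /=.
  - by move=> n0; have := n2; rewrite -n0.
  - by move=> n0; have := n2; rewrite -n0.
  - by move=> _ -> ->; rewrite eqxx.
rewrite count_map -size_filter in c2.
pose t := [seq i <- enum 'I_n | d i == 0].
have ut : uniq t by rewrite filter_uniq ?enum_uniq.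
have [i [j [ij di dj]]] : exists i j, [/\ i != j, d i = 0 & d j = 0].
  have i0 : 'I_n by exact: (Ordinal n2).
  exists (nth i0 t 0), (nth i0 t 1); split; first by rewrite nth_uniq //; apply: ltnW.
    have := mem_nth i0 (ltnW c2); rewrite mem_filter => /andP [/eqP -> //].
  by have := mem_nth i0 c2; rewrite mem_filter => /andP [/eqP -> //].
have Ui := kernel_row (i := i) (U := U); have Uj := kernel_row (i := j) (U := U).
move: Ui Uj; rewrite !rowU di dj rmorph0 !scale0r => /(_ erefl) Ui /(_ erefl) Uj.
pose k0 := Ordinal n2.
have : (U j k0 *: delta_mx 0 i - U i k0 *: delta_mx 0 j) *m U = 0 :> 'rV_n.
  rewrite mulmxBl -!scalemxAl -!rowE; apply/rowP => k.
  by rewrite !mxE (Ui k k0) (Uj k k0) mulrC subrr.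
move/(congr1 (mulmx^~ (invmx U))); rewrite mulmxK // mul0mx => /rowP H.
have Uik : U i k0 = 0.
  have := H j; rewrite !mxE eqxx eq_sym (negbTE ij) !eqxx /= mulr0 mulr1 sub0r.
  by move/eqP; rewrite oppr_eq0 => /eqP.
have : row i U *m invmx U = delta_mx 0 i :> 'rV_n by rewrite rowE mulmxK.
have -> : row i U = 0 by apply/rowP => k; rewrite !mxE (Ui k k0).
by rewrite mul0mx => /rowP /(_ i); rewrite !mxE !eqxx => /eqP; rewrite eq_sym oner_eq0.
Qed.

Lemma spectrum1_eigenvector :
  exists2 v : 'cV[R]_n, v != 0 & A *m v = s`_1 *: v /\ \sum_i v i 0 = 0.
Proof.
have [|v v0 Av] := @spectrum_eigenvector s`_1; first by rewrite mem_nth ?size_spectrum.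
exists v => //; split => //.
have : (const_mx 1 : 'rV[R]_n) *m (A *m v) = 0.
  rewrite mulmxA -[X in X *m v]trmxK trmx_mul Asym trmx_const A1.
  by rewrite trmx0 mul0mx.
rewrite Av -scalemxAr => /matrixP /(_ 0 0); rewrite !mxE => /eqP.
rewrite mulf_eq0 gt_eqF ?spectrum1_gt0 //= => /eqP {2}<-.
by apply: eq_bigr => i _; rewrite mxE mul1r.
Qed.

(** Coordinates for the eigenvalue [0] vanish, because those rows of [U] are constant and [h] has
    sum [0]; every other eigenvalue has index at least [1] in the sorted spectrum. *)
Lemma spectrum1_rayleigh (h : 'cV[R]_n) : \sum_i h i 0 = 0 ->
  s`_1 * (h^T *m h) 0 0 <= (h^T *m A *m h) 0 0.
Proof.
move=> h0; have [d [U [Uu perm_d rowU quad]]] := spectral_decomposition.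
have [q1 q2] := quad h; rewrite -subr_ge0 -lecR rmorphB rmorphM /=.
rewrite -[X in X - _]/(toC _) -[X in _ * X]/(toC _) q1 q2.
rewrite mulr_sumr -sumrB; apply: sumr_ge0 => i _; rewrite -mulrBl.
have ds : d i \in s by rewrite -(perm_mem perm_d) map_f ?mem_enum.
have [di|di] := eqVneq (d i) 0.
  have Ui := kernel_row (i := i) (U := U).
  move: Ui; rewrite rowU di rmorph0 scale0r => /(_ erefl) Ui.
  suff -> : (U *m map_mx toC h) i 0 = 0 by rewrite normr0 expr0n mulr0.
  rewrite mxE; pose k0 := Ordinal n2.
  rewrite (eq_bigr (fun k => U i k0 * toC (h k 0))) => [|k _]; last by rewrite (Ui k k0) mxE.
  by rewrite -mulr_sumr -rmorph_sum h0 rmorph0 mulr0.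
apply: mulr_ge0; last by rewrite exprn_ge0.
rewrite -rmorphB /= -[0]/(toC 0) lecR subr_ge0.
have [ss _] := spectrumP Asym.
rewrite -[leRHS](nth_index 0 ds); apply: (sorted_leq_nth le_trans lexx 0 ss) => //.
- by rewrite inE -/s size_spectrum.
- by rewrite inE index_mem.
rewrite lt0n; apply: contra di => /eqP i0.
by rewrite -(nth_index 0 ds) i0 spectrum0.
Qed.

End SpectralGap.

Section GraphConnectivity.
Variables (R : realType) (G : sgraph).
Hypothesis Gconn : connected_graph G.
Hypothesis G2 : (2 <= #|G|)%N.

Let L := laplacian R G.
Let col (F : G -> R) : 'cV[R]_#|G| := \col_i F (enum_val i).

Lemma sum_enum_val (F : G -> R) : \sum_(i < #|G|) F (enum_val i) = \sum_x F x.
Proof. by rewrite (reindex _ (onW_bij _ (@enum_val_bij G))). Qed.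

Lemma laplacian_flux (F : G -> R) i : (L *m col F) i 0 = - flux (@adj G) F (enum_val i).
Proof.
set x := enum_val i; rewrite mxE.
rewrite (eq_bigr (fun j => (degree x)%:R *+ (i == j) * F (enum_val j) -
   (adj x (enum_val j))%:R * F (enum_val j))) => [|j _]; last by rewrite !mxE mulrBl.
rewrite sumrB (bigD1 i) //= eqxx mulr1n big1 ?addr0 => [|j ji]; last first.
  by rewrite eq_sym (negbTE ji) mulr0n mul0r.
rewrite (sum_enum_val (fun y => (adj x y)%:R * F y)) -/x /flux /degree.
have -> : #|[set y | adj x y]%SET|%:R = \sum_y (adj x y)%:R :> R.
  by rewrite -sum1_card natr_sum big_mkcond; apply: eq_bigr => y _; rewrite inE; case: (adj x y).
rewrite mulr_suml -sumrB -sumrN; apply: eq_bigr => y _; ring.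
Qed.

Lemma laplacian_quad (F : G -> R) :
  ((col F)^T *m L *m col F) 0 0 *+ 2 = dirichlet (@adj G) F F.
Proof.
rewrite dirichletE; last exact: adj_sym.
congr (_ *+ 2); rewrite -mulmxA mxE -sumrN -(sum_enum_val (fun x => - (flux (@adj G) F x * F x))).
apply: eq_bigr => i _; rewrite laplacian_flux !mxE; ring.
Qed.

Lemma col_norm (F : G -> R) : ((col F)^T *m col F) 0 0 = \sum_x F x ^+ 2.
Proof.
by rewrite mxE -(sum_enum_val (fun x => F x ^+ 2)); apply: eq_bigr => i _; rewrite !mxE expr2.
Qed.

Lemma colE (h : 'cV[R]_#|G|) : h = col (fun x => h (enum_rank x) 0).
Proof. by apply/colP => i; rewrite mxE enum_valK. Qed.

Let Lsym : L^T = L. Proof. exact: laplacian_sym. Qed.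

Let L1 : L *m const_mx 1 = 0 :> 'cV_#|G|.
Proof.
have -> : const_mx 1 = col (fun=> 1) by apply/colP => i; rewrite !mxE.
apply/colP => i; rewrite laplacian_flux /flux big1 ?mxE ?oppr0 // => y _.
by rewrite subrr mulr0.
Qed.

Let Lpsd (h : 'cV[R]_#|G|) : 0 <= (h^T *m L *m h) 0 0.
Proof. by rewrite (colE h) -(@pmulrn_lge0 _ _ 2) // laplacian_quad dirichlet_ge0. Qed.

Let Lker (h : 'cV[R]_#|G|) : (h^T *m L *m h) 0 0 = 0 -> forall i j, h i 0 = h j 0.
Proof.
rewrite (colE h) => H i j; rewrite !mxE.
apply: (@dirichlet_eq0 R G (@adj G) Gconn.2 (fun x => h (enum_rank x) 0)).
by rewrite -laplacian_quad H mul0rn.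
Qed.

Lemma connectivity_eigenvector : exists2 F : G -> R, 0 < \sum_x F x ^+ 2 &
  \sum_x F x = 0 /\
  dirichlet (@adj G) F F = (algebraic_connectivity R G * \sum_x F x ^+ 2) *+ 2.
Proof.
have [v v0 [Lv sv]] := spectrum1_eigenvector Lsym L1 Lpsd Lker G2.
exists (fun x => v (enum_rank x) 0); last split.
- rewrite lt_neqAle sumr_ge0 => [|x _]; last exact: sqr_ge0.
  rewrite andbT eq_sym; apply: contra v0; rewrite psumr_eq0 => [|x _]; last exact: sqr_ge0.
  move=> /allP H; apply/eqP/colP => i; rewrite mxE; apply/eqP.
  by have := H (enum_val i) (mem_index_enum _); rewrite enum_valK sqrf_eq0.
- rewrite -(sum_enum_val (fun x => v (enum_rank x) 0)) -[RHS]sv.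
  by apply: eq_bigr => i _; rewrite enum_valK.
- rewrite -laplacian_quad -col_norm -colE -mulmxA Lv -scalemxAr; congr (_ *+ 2).
  by rewrite mxE.
Qed.

Lemma connectivity_rayleigh0 (F : G -> R) : \sum_x F x = 0 ->
  (algebraic_connectivity R G * \sum_x F x ^+ 2) *+ 2 <= dirichlet (@adj G) F F.
Proof.
move=> sF; rewrite -laplacian_quad -col_norm ler_pMn2r //.
apply: (spectrum1_rayleigh Lsym L1 Lpsd Lker G2).
by rewrite -[RHS]sF -sum_enum_val; apply: eq_bigr => i _; rewrite mxE.
Qed.

Lemma connectivity_gt0 : 0 < algebraic_connectivity R G.
Proof. exact: (spectrum1_gt0 Lsym L1 Lpsd Lker G2). Qed.

(** Subtracting the mean leaves the energy unchanged. An existential [m] suffices, since the test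
    vectors below are compared with centred ones for any shift. *)
Lemma connectivity_rayleigh (F : G -> R) : exists m,
  (algebraic_connectivity R G * \sum_x (F x - m) ^+ 2) *+ 2 <= dirichlet (@adj G) F F.
Proof.
pose m := (\sum_x F x) / #|G|%:R.
have N0 : #|G|%:R != 0 :> R by rewrite pnatr_eq0 -lt0n; exact: ltnW.
exists m; have -> : dirichlet (@adj G) F F = dirichlet (@adj G) (fun x => F x - m) (fun x => F x - m).
  by apply: eq_bigr => x _; apply: eq_bigr => y _; congr (_ * _); ring.
apply: connectivity_rayleigh0; rewrite sumrB sumr_const -mulr_natr divfK ?subrr //.
Qed.

End GraphConnectivity.

(** * Spectrum of the path *)

Section PathGraph.
Variables (R : realType) (n : nat).

Lemma sum_pick (g : nat -> R) (m : nat) : \sum_(y < n) (m == y :> nat)%:R * g y = if (m < n)%N then g m else 0.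
Proof.
case: ltnP => h.
  rewrite (bigD1 (Ordinal h)) //= (_ : (m == Ordinal h) = true); last exact: eqxx.
  rewrite mul1r big1 ?addr0 // => y ny.
  rewrite (_ : (m == y) = false) ?mul0r //; apply: contraNF ny => /eqP my.
  by apply/eqP/val_inj => /=; rewrite -my.
rewrite big1 // => y _; rewrite (_ : (m == y) = false) ?mul0r //.
by apply/eqP => my; have := ltn_ord y; rewrite -my ltnNge h.
Qed.

Lemma path_sum (g : nat -> R) (i : 'I_n) :
  \sum_(y < n) (path_adj i y)%:R * g y =
  (if (i.+1 < n)%N then g i.+1 else 0) + (if (0 < i)%N then g i.-1 else 0).
Proof.
rewrite (eq_bigr (fun y : 'I_n => (i.+1 == y :> nat)%:R * g y + (y.+1 == i :> nat)%:R * g y)) => [|y _]; last first.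
  rewrite -mulrDl /path_adj -natrD; congr (_%:R * _).
  by case: eqP => // h1; case: eqP => // h2; lia.
rewrite big_split /= (sum_pick g); congr (_ + _); case: posnP => [i0|i0].
  by rewrite big1 // => y _; rewrite i0 /= mul0r.
rewrite (eq_bigr (fun y : 'I_n => (i.-1 == y :> nat)%:R * g y)) => [|y _]; last first.
  by congr (_%:R * _); apply/eqP/eqP; lia.
by rewrite (sum_pick g) (leq_ltn_trans (leq_pred _) (ltn_ord i)).
Qed.

Lemma path_dirichlet (h : nat -> R) :
  dirichlet (@adj (path_graph n)) (fun i : 'I_n => h i) (fun i : 'I_n => h i) =
  (\sum_(j < n.-1) (h j.+1 - h j) ^+ 2) *+ 2.
Proof.
rewrite /dirichlet /=.
rewrite (eq_bigr (fun i : 'I_n => (if (i.+1 < n)%N then (h i.+1 - h i) ^+ 2 else 0) +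
   (if (0 < i)%N then (h i.-1 - h i) ^+ 2 else 0))) => [|i _]; last first.
  by rewrite -(path_sum (fun y => (h y - h i) ^+ 2)); apply: eq_bigr => y _; rewrite expr2.
rewrite big_split mulr2n; case: n => [|m] /=; first by rewrite !big_ord0.
congr (_ + _).
  rewrite big_ord_recr /= ltnn addr0; apply: eq_bigr => j _.
  by rewrite ltnS ltn_ord.
rewrite big_ord_recl /= add0r; apply: eq_bigr => j _.
by rewrite /bump /= add1n -(opprB (h j.+1)) sqrrN.
Qed.

Lemma path_connected : (0 < n)%N -> connected_graph (path_graph n).
Proof.
move=> n0; split; first by rewrite card_ord.
have symc : connect_sym (@adj (path_graph n)) by exact/sym_connect_sym/path_adj_sym.
have H (x y : 'I_n) : (x <= y)%N -> connect (@path_adj n) x y.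
  case: y => y; elim: y => [|y IH] yn /= xy.
    by rewrite (_ : x = Ordinal yn) //; apply: val_inj => /=; lia.
  case: (ltngtP x y.+1) xy => // [xy _|xy _].
    apply: connect_trans (IH (ltnW yn) xy) _; apply: connect1.
    by rewrite /path_adj /= eqxx.
  by rewrite (_ : x = Ordinal yn) //; apply: val_inj.
move=> x y; case: (leqP x y) => h; first exact: H.
by rewrite symc; apply: H; exact: ltnW.
Qed.

Let lam k : R := 2 * (1 - cos (pi * k%:R / n%:R)).

(** The sequence [cos (x * (2 * i + 1))] is invariant under the reflections [i -> -1 - i] and, up to
    the sign of [h], compatible with [i -> 2 * n - 1 - i], in the sense that [h (-1) = h 0] and
    [h n = h (n - 1)]. So virtual neighbours at the two ends change no flux, and the addition
    formula applies at every vertex. *)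
Lemma path_eigenvalue k : (k < n)%N -> lam k \in spectrum (laplacian R (path_graph n)).
Proof.
move=> kn; have n0 : 0 < n%:R :> R by rewrite ltr0n (leq_ltn_trans _ kn).
pose x : R := pi * k%:R / n%:R / 2; pose h i : R := cos (x * (2 * i%:R + 1)).
have hflux (i : 'I_n) : flux (@adj (path_graph n)) (fun i : 'I_n => h i) i = - lam k * h i.
  have step (j : R) : cos (x * (2 * (j + 1) + 1)) + cos (x * (2 * (j - 1) + 1)) - 2 * cos (x * (2 * j + 1)) =
      - lam k * cos (x * (2 * j + 1)).
    have -> : x * (2 * (j + 1) + 1) = x * (2 * j + 1) + x * 2 by ring.
    have -> : x * (2 * (j - 1) + 1) = x * (2 * j + 1) - x * 2 by ring.
    rewrite cosD cosB /lam; have -> : pi * k%:R / n%:R = x * 2 :> R by rewrite /x divfK.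
    ring.
  rewrite /flux /= (path_sum (fun y => h y - h i)).
  have -> : (if (i.+1 < n)%N then h i.+1 - h i else 0) = cos (x * (2 * (i%:R + 1) + 1)) - h i.
    case: ltnP => ni; first by rewrite /h -(natr1 i).
    have in1 : i.+1 = n by have := ltn_ord i; lia.
    have -> : (i%:R : R) = n%:R - 1 by rewrite -[in RHS]in1 -(natr1 i) addrK.
    have E : x * (2 * n%:R) = 0 + pi *+ k :> R.
      by rewrite /x -mulr_natr; field; rewrite gt_eqF.
    have -> : x * (2 * (n%:R - 1 + 1) + 1) = x * (2 * n%:R) + x by ring.
    rewrite /h; have -> : (i%:R : R) = n%:R - 1 by rewrite -[in RHS]in1 -(natr1 i) addrK.
    have -> : x * (2 * (n%:R - 1) + 1) = x * (2 * n%:R) - x by ring.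
    by rewrite E cosD cosB (alternatingn (@sinDpi R)) sin0 mulr0; ring.
  have -> : (if (0 < i)%N then h i.-1 - h i else 0) = cos (x * (2 * (i%:R - 1) + 1)) - h i.
    case: posnP => i0; last first.
      have -> : (i%:R : R) - 1 = i.-1%:R by rewrite -[in LHS](prednK i0) -(natr1 i.-1) addrK.
      by [].
    rewrite /h i0; have -> : x * (2 * (0 - 1) + 1) = - (x * (2 * 0 + 1)) by ring.
    by rewrite cosN subrr.
  have := step i%:R; rewrite /h; lra.
have [_ cL] := spectrumP (laplacian_sym R (path_graph n)).
rewrite -root_prod_XsubC -cL -eigenvalue_root_char; apply/eigenvalueP.
pose v : 'cV[R]_#|path_graph n| := \col_i h (enum_val i : 'I_n).
exists v^T.
  rewrite -[X in _ *m X]laplacian_sym -trmx_mul -linearZ; congr trmx.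
  apply/colP => i; rewrite (laplacian_flux (fun i : path_graph n => h (i : 'I_n))) !mxE.
  by rewrite hflux mulNr opprK.
have kn0 := leq_ltn_trans (leq0n k) kn.
have h0 : 0 < h 0%N.
  rewrite /h mulr0 add0r mulr1; apply: cos_gt0_pihalf; rewrite /x; apply/andP; split.
    apply: (@lt_le_trans _ _ 0); first by rewrite oppr_lt0 divr_gt0 ?pi_gt0.
    by rewrite !divr_ge0 ?mulr_ge0 ?pi_ge0.
  rewrite ltr_pM2r ?invr_gt0 // ltr_pdivrMr // ltr_pM2l ?pi_gt0 // ltr_nat //.
apply/eqP => /rowP /(_ (enum_rank (Ordinal kn0 : path_graph n))).
by rewrite !mxE enum_rankK /= => h00; rewrite h00 ltxx in h0.
Qed.

Lemma lam_mono k l : (k < l)%N -> (l < n)%N -> lam k < lam l.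
Proof.
move=> kl ln; have n0 : 0 < n%:R :> R by rewrite ltr0n (leq_ltn_trans _ ln).
have In m : (m < n)%N -> pi * m%:R / n%:R \in `[0 : R, pi].
  move=> mn; rewrite in_itv /= divr_ge0 ?mulr_ge0 ?pi_ge0 //=.
  by rewrite ler_pdivrMr // ler_pM2l ?pi_gt0 // ler_nat ltnW.
rewrite /lam ltr_pM2l // ltrD2l ltrN2 ltr_cos ?In //; last exact: ltn_trans kl ln.
by rewrite ltr_pM2r ?invr_gt0 // ltr_pM2l ?pi_gt0 // ltr_nat.
Qed.

(** The [n] values [lam k] increase strictly, so they are distinct, exhaust a spectrum of size [n]
    and come in its order. *)
Lemma path_connectivity : (2 <= n)%N ->
  algebraic_connectivity R (path_graph n) = 2 * (1 - cos (pi / n%:R)).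
Proof.
move=> n2; have [ss _] := spectrumP (laplacian_sym R (path_graph n)).
rewrite /algebraic_connectivity; set s := spectrum _ in ss *.
pose t := [seq lam k | k <- iota 0 n].
have st : sorted <%R t.
  rewrite sorted_map; apply: (@sub_in_sorted _ (fun k => k < n)%N ltn).
  - by move=> k l kn ln kl; apply: lam_mono kl ln.
  - by apply/allP => k; rewrite mem_iota.
  - exact: iota_ltn_sorted.
have ut : uniq t by apply: sorted_uniq st; [exact: lt_trans | exact: ltxx].
have ts : {subset t <= s}.
  by move=> a /mapP [k]; rewrite mem_iota => /andP [_ kn] ->; exact: path_eigenvalue.
have szs : size s = n.
  rewrite (@size_spectrum R _ (laplacian R (path_graph n))) ?card_ord //.
  exact: laplacian_sym.
have szt : (size s <= size t)%N by rewrite szs size_map size_iota.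
have [_ ts'] := uniq_min_size ut ts szt.
have -> : s = t.
  apply: (sorted_eq le_trans le_anti) => //.
    by move: st; apply: sub_sorted => a b; exact: ltW.
  apply: uniq_perm => //; exact: leq_size_uniq ut ts szt.
by rewrite (nth_map 0%N) ?size_iota // nth_iota // /lam mulr1.
Qed.

End PathGraph.

Lemma min_degree_le (G : sgraph) (x : G) : (min_degree G <= degree x)%N.
Proof.
rewrite /min_degree; have : x \in index_enum G by exact: mem_index_enum.
elim: (index_enum G) => // y s IH; rewrite inE big_cons geq_min => /orP [/eqP ->|/IH ->].
  by rewrite leqnn.
by rewrite orbT.
Qed.

Lemma ler_sqrD (R : realFieldType) (t a b : R) : 0 < t ->
  (a + b) ^+ 2 <= (1 + t) * a ^+ 2 + (1 + t^-1) * b ^+ 2.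
Proof.
move=> t0; rewrite -subr_ge0.
have -> : (1 + t) * a ^+ 2 + (1 + t^-1) * b ^+ 2 - (a + b) ^+ 2 = t^-1 * (t * a - b) ^+ 2.
  by field; rewrite gt_eqF.
by rewrite mulr_ge0 ?sqr_ge0 // invr_ge0 ltW.
Qed.

(** * The lower bound *)

Section LowerBound.
Variables (R : realType) (d : nat) (G : sgraph).
Hypotheses (d3 : (3 <= d)%N) (Gconn : connected_graph G) (Gd : (d <= min_degree G)%N).

Let n := #|G|.

Lemma order_gt_degree : (d < n)%N.
Proof.
have [x _] : exists x : G, true by have [/card_gt0P [x _] _] := Gconn; exists x.
apply: leq_ltn_trans (leq_trans Gd (min_degree_le x)) _.
rewrite /degree /n; have : ([set y | adj x y]%SET \proper G).
  by apply/properP; split; [exact/fintype.subsetP | exists x => //; rewrite inE adj_irr].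
exact: proper_card.
Qed.

Let n2 : (2 <= n)%N. Proof. by apply: leq_trans (ltnW order_gt_degree); apply: leq_trans d3. Qed.

(** [phi] numbers the vertices by nondecreasing [F], which gives a graph on ['I_n] to which
    [smoothing] applies with [K = d.-1]. *)
Lemma sorted_profile (F : G -> R) : exists h : nat -> R, exists f : nat -> R,
  [/\ \sum_(j < n) f j = \sum_x F x, \sum_(j < n) f j ^+ 2 = \sum_x F x ^+ 2,
   (d.-1%:R * \sum_(j < n.-1) (h j.+1 - h j) ^+ 2) *+ 2 <= dirichlet (@adj G) F F &
   (d.-1%:R * \sum_(j < n) (f j - h j) ^+ 2) *+ 2 <= d%:R ^+ 2 * dirichlet (@adj G) F F].
Proof.
have [x0 _] : exists x : G, true by have [/card_gt0P [x _] _] := Gconn; exists x.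
pose s := sort (fun x y => F x <= F y) (enum G).
have szs : size s = n by rewrite size_sort -cardE.
have us : uniq s by rewrite sort_uniq enum_uniq.
pose phi (i : 'I_n) := nth x0 s i.
have phi_inj : injective phi.
  by move=> i j /eqP; rewrite nth_uniq ?szs // => /eqP; exact: val_inj.
have phi_bij : bijective phi by apply: inj_card_bij => //; rewrite card_ord.
have phiS (H : G -> R) : \sum_(i < n) H (phi i) = \sum_x H x.
  by rewrite (reindex _ (onW_bij _ phi_bij)).
pose e (i j : 'I_n) := adj (phi i) (phi j).
have esym : symmetric e by move=> i j; exact: adj_sym.
have eirr : irreflexive e by move=> i; exact: adj_irr.
have econn i j : connect e i j.
  have [psi phiK psiK] := phi_bij.
  have /connectP [p] := Gconn.2 (phi i) (phi j).
  rewrite -[i in connect _ i]phiK; elim: p (phi i) => [|z p IH] x /=.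
    by move=> _ <-; rewrite phiK.
  move=> /andP [xz pz] lj; apply: connect_trans (IH _ pz lj).
  by apply: connect1; rewrite /e !psiK.
have degK i : (d.-1.+1 <= #|[set j | e i j]%SET|)%N.
  rewrite prednK; last by apply: leq_trans d3.
  apply: leq_trans (leq_trans Gd (min_degree_le (phi i))) _.
  rewrite /degree -(card_imset [set j | e i j]%SET phi_inj) subset_leq_card //.
  apply/fintype.subsetP => y; rewrite inE => xy; have [psi phiK psiK] := phi_bij.
  by apply/imsetP; exists (psi y); rewrite ?inE /e ?psiK.
pose f k := F (nth x0 s k).
have fmono i j : (i <= j)%N -> (j < n)%N -> f i <= f j.
  move=> ij jn; rewrite /f.
  have st : total (fun x y => F x <= F y) by move=> x y; exact: le_total.
  apply: (sorted_leq_nth (leT := fun x y => F x <= F y)); rewrite ?inE ?szs //.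
  - by move=> x y z; exact: le_trans.
  - exact: sort_sorted.
  - exact: leq_ltn_trans jn.
have K2 : (2 <= d.-1)%N by rewrite -ltnS prednK //; apply: leq_trans d3.
have n0 : (0 < n)%N by exact: ltnW.
have [h [h1 h2]] := smoothing esym eirr econn K2 degK fmono n0.
have DE := dirichlet_half esym (fun i => f i).
have DF : dirichlet e (fun i => f i) (fun i => f i) = dirichlet (@adj G) F F.
  rewrite /dirichlet -phiS; apply: eq_bigr => i _.
  by rewrite -(phiS (fun y => (adj (phi i) y)%:R * ((F y - F (phi i)) * (F y - F (phi i))))).
exists h, f; split.
- exact: phiS.
- by rewrite -(phiS (fun x => F x ^+ 2)).
- by rewrite -DF DE ler_pMn2r.
- by rewrite -DF DE mulrnAr ler_pMn2r //; move: h2; rewrite prednK //; apply: leq_trans d3.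
Qed.

(** With [V] the squared distance of [h] to a constant and [D] that of [f] to [h], smoothing bounds
    [K * mu_path * V] by [mu * S] and [K * mu_path * D] by [q ^+ 2 * (mu * S)]. The weight [t = q]
    in [ler_sqrD] makes the total factor [1 + 2 q + q ^+ 2], a square. *)
Lemma connectivity_lower_bound :
  let mu_path : R := algebraic_connectivity R (path_graph n) in
  (d%:R - 1) * mu_path / (1 + Num.sqrt (d%:R * (d%:R + 1) * mu_path)) ^+ 2
  <= algebraic_connectivity R G.
Proof.
cbv zeta; set mu_path := algebraic_connectivity R (path_graph n).
have n0 : (0 < n)%N by exact: ltnW.
have cn2 : (2 <= #|path_graph n|)%N by rewrite card_ord.
have mp0 : 0 < mu_path := connectivity_gt0 R (path_connected n0) cn2.
have [F S0 [F0 FE]] := connectivity_eigenvector R Gconn n2.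
set S := \sum_x F x ^+ 2 in S0 FE; set mu := algebraic_connectivity R G in FE *.
have [h [f [f0 fS]]] := sorted_profile F.
rewrite FE -mulrnAr mulrnAr ler_pMn2r // -/S F0 in f0 fS * => h1.
rewrite mulrnAr ler_pMn2r // => h2.
have [m] := connectivity_rayleigh (path_connected n0) cn2 (fun i : 'I_n => h i).
rewrite path_dirichlet ler_pMn2r // -/mu_path; set V := \sum_x _ => hV.
set D := \sum_(j < n) (f j - h j) ^+ 2 in h2.
set K : R := d.-1%:R in h1 h2.
have dK : d%:R = K + 1 :> R by rewrite /K natr1 prednK //; apply: leq_trans d3.
have K2 : 2 <= K by rewrite /K ler_nat -ltnS prednK //; apply: leq_trans d3.
set q := Num.sqrt _.
have dd0 : 0 < d%:R * (d%:R + 1) * mu_path :> R by rewrite !mulr_gt0 // dK; lra.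
have q0 : 0 < q by rewrite sqrtr_gt0.
have q2 : q ^+ 2 = d%:R * (d%:R + 1) * mu_path by rewrite sqr_sqrtr // ltW.
have SVD : S <= (1 + q) * V + (1 + q^-1) * D.
  apply: (@le_trans _ _ (\sum_(j < n) (f j - m) ^+ 2)).
    have -> : \sum_(j < n) (f j - m) ^+ 2 = S - (m *+ 2) * (\sum_(j < n) f j) + n%:R * m ^+ 2.
      rewrite -fS mulr_sumr -sumrB -[X in X%:R * _]card_ord mulr_natl -sumr_const -big_split.
      by apply: eq_bigr => j _ /=; ring.
    by rewrite f0 mulr0 subr0 lerDl mulr_ge0 ?sqr_ge0.
  rewrite /V /D !mulr_sumr -big_split; apply: ler_sum => j _ /=.
  have -> : f j - m = (h j - m) + (f j - h j) by ring.
  exact: ler_sqrD.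
have mu0 : 0 < mu := connectivity_gt0 R Gconn n2.
have V0 : 0 <= V by apply: sumr_ge0 => j _; exact: sqr_ge0.
have D0 : 0 <= D by apply: sumr_ge0 => j _; exact: sqr_ge0.
rewrite ler_pdivrMr; last by rewrite exprn_gt0 // addr_gt0.
rewrite -(ler_pM2r S0).
have hKV : K * mu_path * V <= mu * S.
  by apply: le_trans h1; rewrite -mulrA ler_pM2l //; lra.
(* Smoothing yields the factor [d ^ 2], which is relaxed to [d * (d + 1)] to match [q]. *)
have hKD : K * mu_path * D * q^-1 <= mu * S * q.
  rewrite ler_pdivrMr // -[leRHS]mulrA -expr2 q2.
  have -> : K * mu_path * D = K * D * mu_path by ring.
  have -> : mu * S * (d%:R * (d%:R + 1) * mu_path) = (d%:R * (d%:R + 1) * (mu * S)) * mu_path by ring.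
  rewrite ler_pM2r //; apply: (le_trans h2); rewrite ler_pM2r ?mulr_gt0 //.
  by rewrite expr2 ler_pM2l ?dK; lra.
have hKD' : K * mu_path * D <= mu * S * q ^+ 2.
  by rewrite expr2 mulrA -ler_pdivrMr.
have -> : d%:R - 1 = K by rewrite dK addrK.
apply: (@le_trans _ _ (K * mu_path * ((1 + q) * V + (1 + q^-1) * D))).
  by rewrite ler_pM2l // mulr_gt0 //; lra.
have -> : K * mu_path * ((1 + q) * V + (1 + q^-1) * D) =
  (1 + q) * (K * mu_path * V) + K * mu_path * D + K * mu_path * D * q^-1 by ring.
have -> : mu * (1 + q) ^+ 2 * S = (1 + q) * (mu * S) + mu * S * q ^+ 2 + mu * S * q by ring.
by rewrite !lerD // ler_pM2l // addr_gt0.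
Qed.

End LowerBound.

(** * Necklaces *)

Section Necklace.
Variables (H1 H2 : sgraph) (r1 : H1) (r2 : H2) (k K : nat).

Definition necklace_vertex : finType := (H1 + 'I_k * 'I_K.+2 + H2)%type.

(* Beads are copies of the complete graph on [K.+2] vertices without the edge
   between [0] and [K.+1]; each edge is given one orientation. *)
Definition necklace_arc (u v : necklace_vertex) : bool :=
  match u, v with
  | inl (inl x), inl (inl y) => adj x y
  | inl (inl x), inl (inr (j, q)) => [&& x == r1, j == 0%N :> nat & q == 0%N :> nat]
  | inl (inr (i, p)), inl (inr (j, q)) =>
      ((i == j) && (p < q)%N && ~~ ((p == 0%N :> nat) && (q == K.+1 :> nat)))
      || [&& i.+1 == j :> nat, p == K.+1 :> nat & q == 0%N :> nat]
  | inl (inr (i, p)), inr y => [&& y == r2, i.+1 == k & p == K.+1 :> nat]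
  | inr x, inr y => adj x y
  | _, _ => false
  end.

Definition necklace_adj : rel necklace_vertex :=
  fun u v => necklace_arc u v || necklace_arc v u.

Lemma necklace_adj_sym : symmetric necklace_adj.
Proof. by move=> u v; rewrite /necklace_adj orbC. Qed.

Lemma necklace_adj_irr : irreflexive necklace_adj.
Proof.
move=> u; rewrite /necklace_adj orbb; case: u => [[x|[i p]]|x] /=; rewrite ?adj_irr //.
by rewrite ltnn andbF /= gtn_eqF.
Qed.

Definition necklace : sgraph := SGraph necklace_adj_sym necklace_adj_irr.

Let top (x : H1) : necklace := inl (inl x).
Let bead (i : 'I_k) (p : 'I_K.+2) : necklace := inl (inr (i, p)).
Let bot (x : H2) : necklace := inr x.

Lemma card_necklace : #|necklace| = (#|H1| + k * K.+2 + #|H2|)%N.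
Proof. by rewrite !card_sum card_prod !card_ord. Qed.

Lemma big_necklace (V : Type) (idx : V) (op : Monoid.com_law idx) (F : necklace -> V) :
  \big[op/idx]_u F u = op (op (\big[op/idx]_x F (top x))
    (\big[op/idx]_(i < k) \big[op/idx]_(p < K.+2) F (bead i p))) (\big[op/idx]_x F (bot x)).
Proof.
rewrite big_sumType /= big_sumType /=; congr (op (op _ _) _).
by rewrite pair_big /=; apply: eq_bigr => -[i p].
Qed.

Lemma sum_nat_pick n (m : nat) : (\sum_(y < n) (m == y :> nat))%N = (m < n)%N.
Proof.
case: ltnP => h.
  rewrite (bigD1 (Ordinal h)) //= (_ : (m == Ordinal h) = true); last exact: eqxx.
  rewrite big1 // => y ny; apply/eqP; rewrite eqb0; apply: contra ny => /eqP my.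
  by apply/eqP/val_inj => /=; rewrite -my.
rewrite big1 // => y _; apply/eqP; rewrite eqb0.
by apply/eqP => my; have := ltn_ord y; rewrite -my ltnNge h.
Qed.

Lemma sum_nat_pick1 n (m : nat) : (m < n)%N -> (\sum_(y < n) (y == m :> nat))%N = 1%N.
Proof.
move=> mn; transitivity ((m < n)%N : nat); last by rewrite mn.
by rewrite -sum_nat_pick; apply: eq_bigr => y _; rewrite eq_sym.
Qed.

Lemma degreeE (G : sgraph) (x : G) : degree x = (\sum_y adj x y)%N.
Proof. by rewrite /degree -sum1_card big_mkcond; apply: eq_bigr => y _; rewrite inE; case: (adj x y). Qed.

Lemma sum_pred1 (T : finType) (x : T) : (\sum_y (y == x))%N = 1%N.
Proof. by rewrite (bigD1 x) //= eqxx big1 // => y /negbTE ->. Qed.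

Hypothesis k0 : (0 < k)%N.

Lemma degree_top x : degree (top x) = (degree x + (x == r1))%N.
Proof.
rewrite !degreeE (big_necklace addn) /= /necklace_adj /= [X in (_ + X)%N]big1 // addn0.
congr (_ + _)%N; first by apply: eq_bigr => y _; rewrite (adj_sym y) orbb.
case: (x == r1) => /=; last by rewrite big1 // => i _; rewrite big1.
under eq_bigr => i _ do under eq_bigr => p _ do rewrite orbF -mulnb.
under eq_bigr => i _ do rewrite -big_distrr /=.
rewrite (eq_bigr (fun i : 'I_k => (0 == i :> nat) * 1)%N) => [|i _]; last first.
  by rewrite eq_sym; congr (_ * _)%N; exact: sum_nat_pick1.
by rewrite -big_distrl /= sum_nat_pick k0.
Qed.

Lemma degree_bot x : degree (bot x) = (degree x + (x == r2))%N.
Proof.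
rewrite !degreeE (big_necklace addn) /= /necklace_adj /= [X in (X + _ + _)%N]big1 // add0n addnC.
congr (_ + _)%N; first by apply: eq_bigr => y _; rewrite (adj_sym y) orbb.
case: (x == r2) => /=; last by rewrite big1 // => i _; rewrite big1.
under eq_bigr => i _ do under eq_bigr => p _ do rewrite -mulnb.
under eq_bigr => i _ do rewrite -big_distrr /=.
rewrite (eq_bigr (fun i : 'I_k => (k.-1 == i :> nat) * 1)%N) => [|i _]; last first.
  congr (_ * _)%N; first by congr nat_of_bool; apply/eqP/eqP; lia.
  exact: sum_nat_pick1.
by rewrite -big_distrl /= sum_nat_pick prednK // leqnn.
Qed.

(** The end vertices [0] and [K.+1] lack the edge between them, but each has one link, to the next
    bead or to an end graph. *)
Lemma degree_bead i p : degree (bead i p) = K.+1.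
Proof.
rewrite degreeE (big_necklace addn) /= /necklace_adj /=.
pose P0 := (p == 0%N :> nat); pose P1 := (p == K.+1 :> nat).
have -> : (\sum_x [&& x == r1, i == 0%N :> nat & p == 0%N :> nat])%N = ((i == 0%N :> nat) && P0) :> nat.
  rewrite -/P0; case: (_ && P0); last by rewrite big1 // => x _; rewrite andbF.
  by rewrite -[RHS](sum_pred1 r1); apply: eq_bigr => x _; rewrite andbT.
have -> : (\sum_x ([&& x == r2, i.+1 == k & p == K.+1 :> nat] || false))%N = ((i.+1 == k) && P1) :> nat.
  rewrite -/P1; case: (_ && P1); last by rewrite big1 // => x _; rewrite andbF.
  by rewrite -[RHS](sum_pred1 r2); apply: eq_bigr => x _; rewrite orbF andbT.
(* [ok] marks the neighbours of [p] inside its own bead. *)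
pose ok (q : 'I_K.+2) := (p != q) && ~~ (P0 && (q == K.+1 :> nat)) && ~~ (P1 && (q == 0%N :> nat)).
have okE : (\sum_q ok q + (1 + P0 + P1))%N = K.+2.
  have e1 : (\sum_(q < K.+2) (p == q))%N = 1%N.
    by rewrite -[RHS](sum_pred1 p); apply: eq_bigr => q _; rewrite eq_sym.
  have e2 : (\sum_(q < K.+2) (P0 && (q == K.+1 :> nat)))%N = P0.
    case: (P0); last by rewrite big1.
    exact: sum_nat_pick1.
  have e3 : (\sum_(q < K.+2) (P1 && (q == 0%N :> nat)))%N = P1.
    case: (P1); last by rewrite big1.
    exact: sum_nat_pick1.
  rewrite -[X in (X + P0 + P1)%N]e1 -[X in (_ + X + _)%N]e2 -[X in (_ + (_ + X))%N]e3 -!big_split /=.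
  rewrite -[RHS]card_ord -sum1_card; apply: eq_bigr => q _; rewrite /ok.
  case: eqVneq => [<-|pq] /=; first by rewrite /P0 /P1; lia.
  by rewrite /P0 /P1; lia.
have -> : (\sum_(j < k) \sum_(q < K.+2)
   ((i == j) && (p < q)%N && ~~ ((p == 0%N :> nat) && (q == K.+1 :> nat))
     || [&& i.+1 == j :> nat, p == K.+1 :> nat & q == 0%N :> nat]
     || ((j == i) && (q < p)%N && ~~ ((q == 0%N :> nat) && (p == K.+1 :> nat))
     || [&& j.+1 == i :> nat, q == K.+1 :> nat & p == 0%N :> nat])))%N =
   (\sum_q ok q + (P1 && (i.+1 < k)%N) + (P0 && (0 < i)%N))%N.
  rewrite (eq_bigr (fun j : 'I_k => (i == j) * \sum_q ok q + (i.+1 == j :> nat) * P1 + ((0 < i)%N && (i.-1 == j :> nat)) * P0)%N) => [|j _].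
    rewrite !big_split /= -!big_distrl /= sum_nat_pick; congr (_ + _ + _)%N.
    - by rewrite ltn_ord mul1n.
    - by rewrite sum_nat_pick mulnb andbC.
    - case: posnP => i0; rewrite ?andbF /=; first by rewrite big1 ?mul0n.
      by rewrite sum_nat_pick (leq_ltn_trans (leq_pred _) (ltn_ord i)) mul1n andbT.
  have e2 : (\sum_(q < K.+2) (q == K.+1 :> nat))%N = 1%N.
    exact: sum_nat_pick1.
  have e3 : (\sum_(q < K.+2) (q == 0%N :> nat))%N = 1%N.
    exact: sum_nat_pick1.
  transitivity ((i == j) * (\sum_q ok q) + (i.+1 == j :> nat) * (P1 * \sum_(q < K.+2) (q == 0%N :> nat))
    + ((0 < i)%N && (i.-1 == j :> nat)) * (P0 * \sum_(q < K.+2) (q == K.+1 :> nat)))%N; last by rewrite e2 e3 !muln1.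
  rewrite !big_distrr /= -!big_split /=; apply: eq_bigr => q _.
  rewrite /ok /P0 /P1 -!(inj_eq val_inj) /=.
  have := ltn_ord q; have := ltn_ord p; move: (nat_of_ord i) (nat_of_ord j) (nat_of_ord p) (nat_of_ord q).
  clear => i j p q; move=> ? ?.
  case: (ltngtP i j); case: (ltngtP p q); case: (p =P 0%N); case: (q =P 0%N); case: (p =P K.+1); case: (q =P K.+1); case: (i.+1 =P j); case: (j.+1 =P i); case: (i.-1 =P j); case: (posnP i) => //=; lia.
move: okE; have := ltn_ord i; have := ltn_ord p; rewrite /P0 /P1; lia.
Qed.

End Necklace.

Lemma connect_morph (T T' : finType) (e : rel T) (e' : rel T') (phi : T -> T') x y :
  (forall a b, e a b -> e' (phi a) (phi b)) -> connect e x y -> connect e' (phi x) (phi y).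
Proof.
move=> H /connectP [p + ->]; elim: p x => [|z p IH] x //= /andP [xz pz].
by apply: (connect_trans _ (IH _ pz)); apply/connect1/H.
Qed.

Section NecklaceConnectivity.
Variables (H1 H2 : sgraph) (r1 : H1) (r2 : H2) (k K : nat).
Hypotheses (H1conn : connected_graph H1) (H2conn : connected_graph H2).
Hypotheses (k0 : (0 < k)%N) (K0 : (0 < K)%N).

Let G := necklace r1 r2 k K.
Let top (x : H1) : G := inl (inl x).
Let bead (i : 'I_k) (p : 'I_K.+2) : G := inl (inr (i, p)).
Let bot (x : H2) : G := inr x.

Lemma necklace_connected : connected_graph G.
Proof.
have symc : connect_sym (@adj G) by exact/sym_connect_sym/adj_sym.
have Htop x : connect (@adj G) (top r1) (top x).
  apply: (connect_morph (phi := top) _ (H1conn.2 r1 x)) => a b ab.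
  by rewrite /= /necklace_adj /= ab.
pose p0 : 'I_K.+2 := ord0; pose pm : 'I_K.+2 := ord_max.
have Hbead0 i p : connect (@adj G) (bead i p0) (bead i p).
  have mid (q : 'I_K.+2) : (0 < q)%N -> (q < K.+1)%N -> connect (@adj G) (bead i p0) (bead i q).
    move=> q0 qK; apply: connect1; rewrite /= /necklace_adj /= eqxx q0 /=.
    by rewrite (ltn_eqF qK).
  case: (posnP p) => [p0'|pp].
    by rewrite (_ : p = p0) //; apply: val_inj.
  case: (ltngtP p K.+1) => pK; first exact: mid.
    by have := ltn_ord p; rewrite ltnS leqNgt pK.
  (* The two ends of a bead are joined through its vertex [1], which is interior since [0 < K]. *)
  have K2 : (1 < K.+2)%N by [].
  apply: connect_trans (mid (Ordinal K2) isT K0) _; apply: connect1.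
  by rewrite /= /necklace_adj /= eqxx pK /= ltnS K0.
have Hbead i p : connect (@adj G) (top r1) (bead i p).
  case: i => i; elim: i p => [|i IH] p ik.
    apply: (connect_trans _ (Hbead0 _ _)); apply: connect1.
    by rewrite /= /necklace_adj /= eqxx.
  apply: (connect_trans _ (Hbead0 _ _)); apply: connect_trans (IH pm (ltnW ik)) _.
  apply: connect1; rewrite /= /necklace_adj /=.
  by rewrite !eqxx /= orbT.
have Hbot x : connect (@adj G) (top r1) (bot x).
  have kk : (k.-1 < k)%N by rewrite ltn_predL.
  apply: connect_trans (Hbead (Ordinal kk) pm) _.
  apply: (@connect_trans _ _ (bot r2)).
    by apply: connect1; rewrite /= /necklace_adj /= eqxx prednK ?eqxx.
  apply: (connect_morph (phi := bot) _ (H2conn.2 r2 x)) => a b ab.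
  by rewrite /= /necklace_adj /= ab.
have H x : connect (@adj G) (top r1) x.
  by case: x => [[x|[i p]]|x]; [exact: Htop | exact: Hbead | exact: Hbot].
split; first by apply/card_gt0P; exists (top r1).
by move=> a b; apply: (connect_trans _ (H b)); rewrite symc.
Qed.

Variable R : realType.
Variable y : nat -> R.

Let del i := if (i.+1 < k)%N then y i.+1 - y i else 0.
Let del' i := if (0 < i)%N then y i - y i.-1 else 0.

(* The current through the path, of resistance [1] per edge, is distributed
   along the beads: half a bead has resistance [1 / K], a link has resistance [1]. *)
Let pos (i p : nat) : R :=
  if p == 0%N then y i - del' i / K.+2%:R
  else if p == K.+1 then y i + del i / K.+2%:R else y i.

Let F (u : G) : R :=
  match u with
  | inl (inl _) => y 0%N
  | inl (inr (i, p)) => pos i p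
  | inr _ => y k.-1
  end.

Let Q (u v : G) := (F v - F u) ^+ 2.

Lemma Q_sym u v : Q u v = Q v u.
Proof. by rewrite /Q -(opprB (F u)) sqrrN. Qed.

(** An inequality is enough: edges of the end graphs are arcs in both directions, but [Q] vanishes
    on them. *)
Lemma necklace_arcs : dirichlet (@adj G) F F <=
  (\sum_u \sum_v (necklace_arc r1 r2 u v)%:R * Q u v) *+ 2.
Proof.
have sw : \sum_u \sum_v (necklace_arc r1 r2 u v)%:R * Q u v =
          \sum_u \sum_v (necklace_arc r1 r2 v u)%:R * Q u v.
  rewrite exchange_big; apply: eq_bigr => u _; apply: eq_bigr => v _.
  by rewrite Q_sym.
rewrite mulr2n {2}sw -big_split; apply: ler_sum => u _ /=.
rewrite -big_split; apply: ler_sum => v _ /=.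
rewrite -mulrDl -expr2 -/(Q u v); apply: ler_wpM2r; first exact: sqr_ge0.
by rewrite /necklace_adj -natrD ler_nat; case: (necklace_arc _ _ u v); case: (necklace_arc _ _ v u).
Qed.

Lemma pos_bottom : pos 0 0 = y 0%N.
Proof. by rewrite /pos /del' /= mul0r subr0. Qed.

Lemma pos_top : pos k.-1 K.+1 = y k.-1.
Proof. by rewrite /pos /del /= eqxx prednK // ltnn mul0r addr0. Qed.

Lemma sum_interior (n : nat) (a : R) :
  \sum_(q < n.+2) (if (0 < q < n.+1)%N then a else 0) = n%:R * a.
Proof.
rewrite big_ord_recl /= add0r big_ord_recr /= /bump /= add1n ltnn addr0.
rewrite (eq_bigr (fun=> a)) ?sumr_const ?card_ord ?mulr_natl // => q _.
by rewrite add1n ltnS ltn_ord.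
Qed.

Lemma sum_del_sqr : \sum_(i < k) del i ^+ 2 = \sum_(i < k.-1) (y i.+1 - y i) ^+ 2.
Proof.
rewrite /del; case: k k0 => // k' _ /=; rewrite big_ord_recr /= ltnn expr0n addr0.
by apply: eq_bigr => i _; rewrite ltnS ltn_ord.
Qed.

Lemma sum_del'_sqr : \sum_(i < k) del' i ^+ 2 = \sum_(i < k.-1) (y i.+1 - y i) ^+ 2.
Proof.
by rewrite /del'; case: k k0 => // k' _ /=; rewrite big_ord_recl /= expr0n add0r.
Qed.

(** An increment [del] of the path is spread over [2 K] bead edges with drop [del / (K + 2)] and a
    link with drop [K * del / (K + 2)], which gives [(2 K + K^2) / (K + 2)^2 = K / (K + 2)] times
    [del ^+ 2]. *)
Lemma necklace_arc_energy :
  \sum_u \sum_v (necklace_arc r1 r2 u v)%:R * Q u v <=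
  (K%:R / K.+2%:R) * \sum_(i < k.-1) (y i.+1 - y i) ^+ 2.
Proof.
have D0 : (K.+2)%:R != 0 :> R by rewrite pnatr_eq0.
have D0' : 2 + K%:R != 0 :> R by rewrite -natrD pnatr_eq0.
rewrite (big_necklace +%R) /= [X in X + _ + _]big1 ?add0r; last first.
  move=> x _; rewrite (big_necklace +%R) /= [X in X + _ + _]big1 => [|z _]; last by rewrite /Q /= subrr expr0n mulr0.
  rewrite [X in _ + X]big1 ?addr0 ?add0r => [|z _]; last by rewrite mul0r.
  rewrite big1 // => i _; rewrite big1 // => p _; rewrite /Q /=.
  case: (x == r1); rewrite ?mul0r //=; case: eqP => i0; rewrite ?mul0r //=.
  by case: eqP => p0; rewrite ?mul0r //= i0 p0 pos_bottom subrr expr0n mulr0.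
rewrite [X in _ + X]big1 ?addr0; last first.
  move=> x _; rewrite (big_necklace +%R) /= [X in X + _ + _]big1 => [|z _]; last by rewrite mul0r.
  rewrite [X in _ + X]big1 ?addr0 ?add0r => [|z _]; last by rewrite /Q /= subrr expr0n mulr0.
  by rewrite big1 // => i _; rewrite big1 // => p _; rewrite mul0r.
pose L i : R := K%:R * (del' i / K.+2%:R) ^+ 2 + K%:R * (del i / K.+2%:R) ^+ 2 + (K%:R * del i / K.+2%:R) ^+ 2.
apply: (@le_trans _ _ (\sum_(i < k) L i)).
  apply: ler_sum => i _.
  apply: (@le_trans _ _ (\sum_(p < K.+2) ((if p == 0%N :> nat then K%:R * (del' i / K.+2%:R) ^+ 2 else 0) +
     (if (0 < p < K.+1)%N then (del i / K.+2%:R) ^+ 2 else 0) +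
     (if p == K.+1 :> nat then (K%:R * del i / K.+2%:R) ^+ 2 else 0)))); last first.
    rewrite !big_split /= sum_interior /L lerD //; [apply: lerD => // |].
    - by rewrite big_ord_recl /= big1 ?addr0.
    - rewrite big_ord_recr /= eqxx big1 ?add0r // => p _; rewrite ltn_eqF //.
  apply: ler_sum => p _; rewrite (big_necklace +%R) /=.
  rewrite [X in X + _ + _]big1 => [|z _]; last by rewrite mul0r.
  rewrite [X in _ + X]big1 ?addr0 ?add0r => [|z _]; last first.
    rewrite /Q /=; case: (z == r2); rewrite ?mul0r //=; case: eqP => i0; rewrite ?mul0r //=.
    case: eqP => p0; rewrite ?mul0r //= p0.
    have -> : nat_of_ord i = k.-1 by move/(congr1 predn): i0.
    by rewrite pos_top subrr expr0n mulr0.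
  (* [g] and [b] are the contributions of the arcs from [p] within its bead and along the outgoing
     link. *)
  pose g (q : nat) : R := if p == 0%N :> nat then (if (0 < q < K.+1)%N then (del' i / K.+2%:R) ^+ 2 else 0)
    else if (p < K.+1)%N && (q == K.+1) then (del i / K.+2%:R) ^+ 2 else 0.
  pose b (q : nat) : R := if (p == K.+1 :> nat) && (q == 0%N) then (K%:R * del i / K.+2%:R) ^+ 2 else 0.
  have g0 q : 0 <= g q by rewrite /g; repeat case: ifP => _ //; exact: sqr_ge0.
  have b0 q : 0 <= b q by rewrite /b; case: ifP => _ //; exact: sqr_ge0.
  apply: (@le_trans _ _ (\sum_(j < k) \sum_(q < K.+2) ((i == j :> nat)%:R * g q + (i.+1 == j :> nat)%:R * b q))).
    apply: ler_sum => j _; apply: ler_sum => q _.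
    have pK := ltn_ord p; have qK := ltn_ord q.
    case: (eqVneq (i : nat) j) => [ij|ij].
      have -> : j = i by apply: val_inj; rewrite /= -ij.
      rewrite eqxx (gtn_eqF (ltnSn i)) /= orbF mul0r addr0 mul1r.
      case: andP => [[pq ext]|_]; last by rewrite mul0r g0.
      rewrite mul1r /Q /= /pos /g (gtn_eqF (leq_ltn_trans (leq0n p) pq)).
      case: (eqVneq (p : nat) 0%N) ext => [p0|p0] /= ext.
        rewrite (negbTE ext) (leq_ltn_trans (leq0n p) pq) /=.
        have -> : (q < K.+1)%N by move: ext qK; clear; lia.
        by rewrite opprB addrC addrNK.
      have pK1 : (p < K.+1)%N by move: pq qK; clear; lia.
      rewrite (ltn_eqF pK1) pK1 /=; case: eqP => _; last by rewrite subrr expr0n.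
      by rewrite addrC addKr.
    have -> : (i == j) = false by apply: contraNF ij => /eqP ->.
    rewrite /= mul0r add0r; case: (eqVneq i.+1 (j : nat)) => [ij1|]; last by rewrite !mul0r.
    rewrite /= mul1r /b; case: eqP => pm; last by rewrite mul0r.
    case: eqP => q0 /=; last by rewrite mul0r.
    rewrite mul1r /Q /= /pos q0 pm /= eqxx -ij1 /del /del' /= ij1 (ltn_ord j).
    rewrite -(natr1 K.+1) -(natr1 K) le_eqVlt; apply/orP; left; apply/eqP; congr (_ ^+ 2).
    by field; rewrite !natr1 D0.
  rewrite (eq_bigr (fun j : 'I_k => (i == j :> nat)%:R * (\sum_(q < K.+2) g q) +
    (i.+1 == j :> nat)%:R * (\sum_(q < K.+2) b q))) => [|j _]; last first.
    by rewrite big_split /= !mulr_sumr.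
  rewrite big_split /= (sum_pick _ (fun=> \sum_(q < K.+2) g q)) ltn_ord.
  rewrite (sum_pick _ (fun=> \sum_(q < K.+2) b q)).
  have pK := ltn_ord p; apply: lerD.
    rewrite /g; case: posnP => p0 /=.
      by rewrite sum_interior addr0.
    rewrite add0r; case: (ltnP p K.+1) => pK1; last by rewrite big1.
    by rewrite big_ord_recr /= eqxx big1 ?add0r // => q _; rewrite (ltn_eqF (ltn_ord q)).
  have bs : \sum_(q < K.+2) b q = if p == K.+1 :> nat then (K%:R * del i / K.+2%:R) ^+ 2 else 0.
    rewrite /b; case: eqP => pm /=; last by rewrite big1.
    by rewrite big_ord_recl /= big1 ?addr0.
  by rewrite bs; case: ifP => // _; case: ifP => // _; exact: sqr_ge0.
have -> : \sum_(i < k) L i = K%:R / K.+2%:R ^+ 2 * \sum_(i < k) del' i ^+ 2 +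
   (K%:R / K.+2%:R ^+ 2 + K%:R ^+ 2 / K.+2%:R ^+ 2) * \sum_(i < k) del i ^+ 2.
  rewrite !mulr_sumr -big_split; apply: eq_bigr => i _ /=; rewrite /L; field.
  exact: D0'.
rewrite sum_del_sqr sum_del'_sqr -mulrDl le_eqVlt; apply/orP; left; apply/eqP; congr (_ * _).
by rewrite -!(natr1 K.+1) -(natr1 K); field; rewrite !natr1 D0.
Qed.

(** In each bead [K] vertices have the value [y i] exactly, so the loss [eps] is incurred only at
    its two ends; the squares on the end graphs are dropped. *)
Lemma necklace_variance m eps : 0 < eps ->
  (K.+2%:R - eps *+ 2) * (\sum_(i < k) (y i - m) ^+ 2)
    - eps^-1 *+ 2 * (\sum_(i < k.-1) (y i.+1 - y i) ^+ 2) / K.+2%:R ^+ 2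
  <= \sum_u (F u - m) ^+ 2.
Proof.
move=> eps0; have le_sq (a b : R) : (1 - eps) * a ^+ 2 - eps^-1 * b ^+ 2 <= (a + b) ^+ 2.
  rewrite -subr_ge0.
  have -> : (a + b) ^+ 2 - ((1 - eps) * a ^+ 2 - eps^-1 * b ^+ 2) =
    eps * (a + b / eps) ^+ 2 + b ^+ 2 by field; rewrite gt_eqF.
  by rewrite addr_ge0 ?sqr_ge0 // mulr_ge0 ?sqr_ge0 // ltW.
rewrite (big_necklace +%R) /=.
apply: (@le_trans _ _ (\sum_(i < k) \sum_(p < K.+2) (pos i p - m) ^+ 2)); last first.
  rewrite -[leLHS]add0r -[leLHS]addr0; apply: lerD; last by apply: sumr_ge0 => x _; exact: sqr_ge0.
  by apply: lerD => //; apply: sumr_ge0 => x _; exact: sqr_ge0.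
apply: (@le_trans _ _ (\sum_(i < k) ((K.+2%:R - eps *+ 2) * (y i - m) ^+ 2
    - eps^-1 * (del' i ^+ 2 + del i ^+ 2) / K.+2%:R ^+ 2))).
  rewrite sumrB -mulr_sumr lerD2l lerN2 -mulr_suml -mulr_sumr big_split /=.
  by rewrite sum_del_sqr sum_del'_sqr -mulr2n mulrnAl mulrnAr.
apply: ler_sum => i _; rewrite big_ord_recl big_ord_recr /=.
rewrite (eq_bigr (fun=> (y i - m) ^+ 2)) => [|p _]; last first.
  by rewrite /pos /= /bump /= add1n eqSS (ltn_eqF (ltn_ord p)).
rewrite sumr_const card_ord /pos /= /bump /= add1n eqxx.
have := le_sq (y i - m) (- (del' i / K.+2%:R)); have := le_sq (y i - m) (del i / K.+2%:R).
have -> : y i - m - del' i / K.+2%:R = y i - del' i / K.+2%:R - m by ring.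
have -> : y i - m + del i / K.+2%:R = y i + del i / K.+2%:R - m by ring.
rewrite sqrrN !exprMn !exprVn -!(natr1 K.+1) -(natr1 K).
rewrite -[(y i - m) ^+ 2 *+ K]mulr_natl.
set X := (y i - m) ^+ 2; set D := (K%:R + 1 + 1) ^- 2.
rewrite mulr2n; lra.
Qed.

End NecklaceConnectivity.

(** For [eps = 1/k] the factor on the left tends to [K + 2], so the connectivity is asymptotically
    at most [K / (K + 2)^2] times that of the path on [k] vertices. *)
Lemma necklace_upper_bound (R : realType) (H1 H2 : sgraph) (r1 : H1) (r2 : H2) (k K : nat) (eps : R) :
  connected_graph H1 -> connected_graph H2 -> (2 <= k)%N -> (0 < K)%N ->
  0 < eps -> eps <= 1 ->
  let muk : R := algebraic_connectivity R (path_graph k) in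
  algebraic_connectivity R (necklace r1 r2 k K) *
    (K.+2%:R - eps *+ 2 - eps^-1 *+ 2 * muk / K.+2%:R ^+ 2) <= K%:R / K.+2%:R * muk.
Proof.
move=> H1c H2c k2 K0 e0 e1; cbv zeta; set muk := algebraic_connectivity R (path_graph k).
have k0 := ltnW k2.
have Gc := necklace_connected r1 r2 H1c H2c k0 K0.
have G2 : (2 <= #|necklace r1 r2 k K|)%N.
  by rewrite card_necklace -addnA addnCA (leq_trans k2) // (leq_trans (leq_pmulr _ _) (leq_addr _ _)).
have cn2 : (2 <= #|path_graph k|)%N by rewrite card_ord.
have [z S0 [z0 zE]] := connectivity_eigenvector R (path_connected k0) cn2.
pose y i := if insub i is Some j then z (j : 'I_k) else 0.
have yE (j : 'I_k) : y j = z j by rewrite /y valK.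
have [m] := connectivity_rayleigh Gc G2 (fun u : necklace r1 r2 k K => match u with
    | inl (inl _) => y 0%N
    | inl (inr (i, p)) => if p == 0%N :> nat then y i - (if (0 < i)%N then y i - y i.-1 else 0) / K.+2%:R
        else if p == K.+1 :> nat then y i + (if (i.+1 < k)%N then y i.+1 - y i else 0) / K.+2%:R else y i
    | inr _ => y k.-1 end).
set V := \sum_x _; set mu := algebraic_connectivity _ _ => HV.
have {HV} := le_trans HV (necklace_arcs r1 r2 k K y).
rewrite ler_pMn2r // => HV; have {HV} := le_trans HV (necklace_arc_energy r1 r2 K k0 y).
have HV' := necklace_variance r1 r2 K k0 y m e0; rewrite -/V in HV'.
have zE' : \sum_(i < k.-1) (y i.+1 - y i) ^+ 2 = muk * \sum_x z x ^+ 2.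
  apply: (@mulIf _ 2%:R); first by rewrite pnatr_eq0.
  rewrite !mulr_natr -zE -(path_dirichlet k y).
  by apply: eq_bigr => i _; apply: eq_bigr => j _; rewrite !yE.
have Sm : \sum_x z x ^+ 2 <= \sum_(i < k) (y i - m) ^+ 2.
  have -> : \sum_(i < k) (y i - m) ^+ 2 = \sum_x z x ^+ 2 - (m *+ 2) * (\sum_x z x) + k%:R * m ^+ 2.
    rewrite mulr_sumr -sumrB -[X in X%:R * _]card_ord mulr_natl -sumr_const -big_split.
    by apply: eq_bigr => j _ /=; rewrite yE; ring.
  by rewrite z0 mulr0 subr0 lerDl mulr_ge0 ?sqr_ge0.
rewrite zE' in HV' *; set S := \sum_x z x ^+ 2 in S0 Sm HV' *.
move=> HV; rewrite -(ler_pM2r S0).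
have mu0 : 0 < mu := connectivity_gt0 R Gc G2.
rewrite -[leRHS]mulrA; apply: le_trans HV; rewrite -[leLHS]mulrA ler_pM2l //.
apply: le_trans HV'; rewrite mulrBl; apply: lerB.
  apply: ler_wpM2l => //; rewrite subr_ge0.
  by apply: (@le_trans _ _ 2); [rewrite mulr2n; lra | rewrite ler_nat].
by rewrite le_eqVlt; apply/orP; left; apply/eqP; ring.
Qed.

(** * End graphs: complete graphs, and circulants with a near-perfect matching *)

Section EndGraphs.

Definition complete_adj n : rel 'I_n := fun i j => i != j.

Lemma complete_adj_sym n : symmetric (@complete_adj n).
Proof. by move=> i j; rewrite /complete_adj eq_sym. Qed.

Lemma complete_adj_irr n : irreflexive (@complete_adj n).
Proof. by move=> i; rewrite /complete_adj eqxx. Qed.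

Definition complete_graph n : sgraph := SGraph (@complete_adj_sym n) (@complete_adj_irr n).

Lemma complete_connected n : (0 < n)%N -> connected_graph (complete_graph n).
Proof.
move=> n0; split=> [|x y]; first by rewrite card_ord.
by have [->|xy] := eqVneq x y; [exact: connect0 | exact: connect1].
Qed.

Lemma degree_complete n (x : complete_graph n) : degree x = n.-1.
Proof.
rewrite /degree (_ : [set y | _]%SET = [set~ x]%SET) ?cardsC1 ?card_ord //.
by apply/setP => y; rewrite !inE /= /complete_adj eq_sym.
Qed.

Variables h t : nat.
Hypotheses (th : (t < h)%N) (t0 : (0 < t)%N).

(** The order must be odd, since all degrees but one are to be odd. *)
Let q := h.*2.+1.

(** The differences [1 .. t] and [-t .. -1] modulo [q]; as [t < h], they avoid the differences [h]
    and [-h] of the matching. *)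
Let near (m : nat) := (0 < m <= t)%N || (q - t <= m < q)%N.

(** The subtraction is the one of the group ['I_q], modulo [q]. *)
Let gap (i j : 'I_q) : nat := (j - i)%R.

(* The matching [i ~ i + h] raises every degree but that of [h.*2], where the
   graph is attached to the necklace. *)
Definition circulant_adj : rel 'I_q := fun i j =>
  near (gap i j) || [&& (i < h.*2)%N, (j < h.*2)%N & (i + h == j)%N || (j + h == i)%N].

Lemma gapE i j : gap i j = (if (i <= j)%N then j - i else q + j - i)%N.
Proof.
rewrite /gap /=; have iq := ltn_ord i; have jq := ltn_ord j; rewrite -/q modnDmr.
case: leqP => ij.
  have -> : (j + (q - i) = (j - i) + q)%N by lia.
  by rewrite modnDr modn_small // (leq_ltn_trans (leq_subr _ _)).
have -> : (j + (q - i) = q + j - i)%N by lia.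
by rewrite modn_small //; lia.
Qed.

Lemma circulant_adj_sym : symmetric circulant_adj.
Proof.
move=> i j; rewrite /circulant_adj andbCA orbC [(j + h == _)%N || _]orbC orbC; congr (_ || _).
rewrite !gapE /near; move: (nat_of_ord i) (nat_of_ord j) (ltn_ord i) (ltn_ord j).
by move=> a b aq bq; case: (ltngtP a b) => ab; rewrite /q in aq bq *; lia.
Qed.

Lemma circulant_adj_irr : irreflexive circulant_adj.
Proof. by move=> i; rewrite /circulant_adj gapE leqnn subnn /near orbb; move: th; rewrite /q; lia. Qed.

Definition circulant : sgraph := SGraph circulant_adj_sym circulant_adj_irr.

Lemma circulant_connected : connected_graph circulant.
Proof.
split; first by rewrite card_ord.
have symc : connect_sym (@adj circulant) by exact/sym_connect_sym/adj_sym.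
have H (x : 'I_q) : connect circulant_adj ord0 x.
  case: x => x; elim: x => [|x IH] xq; first by rewrite (_ : Ordinal xq = ord0) //; exact: val_inj.
  apply: connect_trans (IH (ltnW xq)) _; apply: connect1.
  by rewrite /circulant_adj gapE /= leqnSn subSnn /near /= t0.
by move=> a b; apply: (connect_trans _ (H b)); rewrite symc; exact: H.
Qed.

Lemma degree_circulant (x : circulant) : degree x = (t.*2 + ((x : 'I_q) < h.*2))%N.
Proof.
have thq : (t.*2 < q)%N by rewrite /q; move: th; lia.
rewrite degreeE /=.
have xq := ltn_ord (x : 'I_q).
transitivity (\sum_(y < q) near (gap x y) + \sum_(y < q)
   (if (x < h)%N then (x + h == y)%N : nat else if (x < h.*2)%N then (x - h == y)%N : nat else 0))%N.
  rewrite -big_split /=; apply: eq_bigr => y _; rewrite /circulant_adj gapE /near.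
  have := ltn_ord y; move: th xq; rewrite /q; move: (nat_of_ord x) (nat_of_ord y) => a b.
  clear => th aq bq; case: (leqP a b) => ab; case: (ltnP a h) => ah; case: (ltnP a h.*2) => ah2; lia.
congr (_ + _)%N.
  rewrite (reindex (fun d : 'I_q => (d + (x : 'I_q))%R)); last first.
    by exists (fun d : 'I_q => (d - (x : 'I_q))%R) => d _; rewrite ?addrK ?subrK.
  rewrite (eq_bigr (fun d : 'I_q => near d : nat)) => [|d _]; last by rewrite /gap addrK.
  rewrite (eq_bigr (fun d : 'I_q => ((0 < d <= t)%N + (q - t <= d < q)%N)%N)) => [|d _]; last first.
    by rewrite /near; have := ltn_ord d; lia.
  rewrite big_split /= -addnn; congr (_ + _)%N.
    rewrite -(big_mkord xpredT (fun d => (0 < d <= t)%N : nat)) (big_cat_nat _ (n := 1)) //=.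
    rewrite big_nat1 add0n (big_cat_nat _ (n := t.+1)) //=; last by lia.
    rewrite [X in (_ + X)%N]big_nat_cond [X in (_ + X)%N]big1 ?addn0; last by move=> d; lia.
    rewrite big_nat_cond (eq_bigr (fun=> 1%N)) => [|d]; last by lia.
    by rewrite -big_nat_cond sum_nat_const_nat muln1 subn1.
  rewrite -(big_mkord xpredT (fun d => (q - t <= d < q)%N : nat)) (big_cat_nat _ (n := (q - t)%N)) //=; last by lia.
  rewrite [X in (X + _)%N]big_nat_cond [X in (X + _)%N]big1 ?add0n; last by move=> d; lia.
  rewrite big_nat_cond (eq_bigr (fun=> 1%N)) => [|d]; last by lia.
  by rewrite -big_nat_cond sum_nat_const_nat muln1; lia.
case: (ltnP x h) => xh; first by rewrite sum_nat_pick; lia.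
case: (ltnP x h.*2) => x2; last by rewrite big1.
by rewrite sum_nat_pick; lia.
Qed.

End EndGraphs.

Local Open Scope classical_set_scope.

(** * Asymptotics *)

Section Limits.
Variable R : realType.

Lemma cvg_invn : (n%:R^-1 : R) @[n --> \oo] --> (0 : R).
Proof.
apply/gtr0_cvgV0; last exact: cvgr_idn.
by near=> n; rewrite ltr0n; near: n; exact: nbhs_infty_gt.
Unshelve. all: by end_near. Qed.

(** This is the derivative of [sin] at [0]; nonvanishing of [x n] lets the sequence converge along
    the punctured filter. *)
Lemma cvg_sinc (x : nat -> R) : (forall n, (0 < n)%N -> x n != 0) -> x @ \oo --> (0 : R) ->
  ((x n)^-1 * sin (x n)) @[n --> \oo] --> (1 : R).
Proof.
move=> x0 xcv.
have D : h^-1 *: (sin (h + 0) - sin (0 : R)) @[h --> (0:R)^'] --> (1 : R).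
  have d : h^-1 *: ((sin \o shift (0 : R)) (h *: (1 : R)) - sin (0 : R)) @[h --> (0:R)^'] -->
    'D_1 sin (0 : R) by exact: derivable_sin.
  rewrite (@derive_val _ _ _ _ _ _ _ (is_derive_sin (0 : R))) cos0 in d.
  apply: cvg_trans d; apply: near_eq_cvg; near=> h.
  by rewrite /= [h *: _]mulr1.
have xn0 : x @ \oo --> (0 : R)^'.
  move=> A; rewrite /= /dnbhs /within /= => HA.
  have H : \forall n \near \oo, x n != 0 -> A (x n) by exact: (xcv _ HA).
  change (\forall n \near \oo, A (x n)); near=> n.
  have xn : x n != 0 by apply: x0; near: n; exact: nbhs_infty_gt.
  by move: xn; near: n.
have := cvg_comp _ _ xn0 D.
apply: cvg_trans; apply: near_eq_cvg; near=> n.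
by rewrite /= addr0 sin0 subr0.
Unshelve. all: by end_near. Qed.

(** As [1 - cos (pi / k) = 2 * sin (pi / (2 * k)) ^+ 2], the sequence is [pi ^+ 2] times the square
    of [sin x / x] at [x = pi / (2 * k)]. *)
Lemma cvg_path_connectivity :
  (k%:R ^+ 2 * algebraic_connectivity R (path_graph k)) @[k --> \oo] --> (pi ^+ 2 : R).
Proof.
have xcv : (pi / 2 * k%:R^-1 : R) @[k --> \oo] --> (0 : R).
  rewrite -[X in _ --> X](mulr0 (pi / 2)); apply: cvgMr; exact: cvg_invn.
have S := @cvg_sinc (fun k => pi / 2 * k%:R^-1) _ xcv.
have {S} S : ((pi / 2 * k%:R^-1)^-1 * sin (pi / 2 * k%:R^-1) : R) @[k --> \oo] --> (1 : R).
  by apply: S => n n0; rewrite mulf_neq0 ?mulf_neq0 ?invr_eq0 ?pnatr_eq0 -?lt0n // gt_eqF // pi_gt0.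
have L : (pi ^+ 2 * (((pi / 2 * k%:R^-1)^-1 * sin (pi / 2 * k%:R^-1)) *
    ((pi / 2 * k%:R^-1)^-1 * sin (pi / 2 * k%:R^-1))) : R) @[k --> \oo] --> (pi ^+ 2 * (1 * 1) : R).
  by apply: cvgM; [exact: cvg_cst | exact: cvgM].
rewrite !mulr1 in L; apply: cvg_trans L; apply: near_eq_cvg; near=> k.
have k2 : (2 <= k)%N by near: k; exact: nbhs_infty_ge.
have k0 : k%:R != 0 :> R by rewrite pnatr_eq0 -lt0n ltnW.
rewrite /= path_connectivity //.
have -> : pi / k%:R = (pi / 2 * k%:R^-1) *+ 2 :> R by rewrite -mulr_natr; field.
rewrite cos_mulr2n cos2sin2; have p0 : pi != 0 :> R by rewrite gt_eqF ?pi_gt0.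
move: (sin (pi / 2 / k%:R)) => s; move: (@pi R) p0 => p p0; field.
by rewrite p0 k0.
Unshelve. all: by end_near. Qed.

Let mu k : R := algebraic_connectivity R (path_graph k).

Lemma cvg_path_connectivity0 : mu @ \oo --> (0 : R).
Proof.
have L : ((k%:R ^+ 2 * mu k) * (k%:R^-1 * k%:R^-1) : R) @[k --> \oo] --> (pi ^+ 2 * (0 * 0) : R).
  apply: cvgM; first exact: cvg_path_connectivity.
  by apply: cvgM; exact: cvg_invn.
rewrite !mulr0 in L; apply: cvg_trans L; apply: near_eq_cvg; near=> k.
have k0 : k%:R != 0 :> R by rewrite pnatr_eq0 -lt0n; near: k; exact: nbhs_infty_gt.
by rewrite /=; move: (mu k) (k%:R : R) k0 => m x x0; field.
Unshelve. all: by end_near. Qed.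

Lemma cvg_lower_bound (K : nat) (c : R) :
  (n%:R ^+ 2 * (K%:R * mu n / (1 + Num.sqrt (c * mu n)) ^+ 2) : R) @[n --> \oo]
    --> (K%:R * pi ^+ 2 : R).
Proof.
have S : (Num.sqrt (c * mu n) : R) @[n --> \oo] --> (Num.sqrt (c * 0) : R).
  apply: (@cvg_comp _ _ _ (fun n => c * mu n) Num.sqrt _ (nbhs (c * 0))); last exact: sqrt_continuous.
  by apply: cvgM; [exact: cvg_cst | exact: cvg_path_connectivity0].
rewrite mulr0 sqrtr0 in S.
have L : ((K%:R * (n%:R ^+ 2 * mu n)) * ((1 + Num.sqrt (c * mu n)) * (1 + Num.sqrt (c * mu n)))^-1 : R) @[n --> \oo]
    --> (K%:R * pi ^+ 2 * ((1 + 0) * (1 + 0))^-1 : R).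
  apply: cvgM; first by apply: cvgM; [exact: cvg_cst | exact: cvg_path_connectivity].
  apply: cvgV; first by rewrite addr0 mulr1 oner_neq0.
  by apply: cvgM; apply: cvgD => //; exact: cvg_cst.
rewrite addr0 !mulr1 invr1 mulr1 in L; apply: cvg_trans L; apply: near_eq_cvg; near=> n.
by rewrite /= -expr2; move: (mu n) (Num.sqrt _) => m q; ring.
Unshelve. all: by end_near. Qed.

(** The factor of [necklace_upper_bound] at [eps = 1/k]; this choice makes both error terms vanish,
    because [mu k] is of order [1/k^2]. *)
Let den (K k : nat) : R := K.+2%:R - k%:R^-1 *+ 2 - (k%:R^-1)^-1 *+ 2 * mu k / K.+2%:R ^+ 2.

Lemma cvg_den K : den K @ \oo --> (K.+2%:R : R).
Proof.
have L : (K.+2%:R - k%:R^-1 * 2 - ((k%:R ^+ 2 * mu k) * k%:R^-1) * (2 / K.+2%:R ^+ 2) : R) @[k --> \oo]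
   --> (K.+2%:R - 0 * 2 - (pi ^+ 2 * 0) * (2 / K.+2%:R ^+ 2) : R).
  apply: cvgB; first apply: cvgB; first exact: cvg_cst.
    by apply: cvgM; [exact: cvg_invn | exact: cvg_cst].
  apply: cvgM; last exact: cvg_cst.
  by apply: cvgM; [exact: cvg_path_connectivity | exact: cvg_invn].
rewrite mulr0 !mul0r !subr0 in L; apply: cvg_trans L; apply: near_eq_cvg; near=> k.
have k0 : k%:R != 0 :> R by rewrite pnatr_eq0 -lt0n; near: k; exact: nbhs_infty_gt.
have D0 : K.+2%:R != 0 :> R by rewrite pnatr_eq0.
have A (x m D : R) : x != 0 -> D != 0 -> D - x^-1 * 2 - x ^+ 2 * m * x^-1 * (2 / D ^+ 2) =
    D - x^-1 *+ 2 - (x^-1)^-1 *+ 2 * m / D ^+ 2.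
  by move=> x0 d0; rewrite invrK !mulr2n; field; rewrite x0 d0.
exact: A.
Unshelve. all: by end_near. Qed.

Lemma cvg_upper_bound K :
  (k%:R ^+ 2 * (K%:R / K.+2%:R * mu k / den K k) : R) @[k --> \oo]
    --> (K%:R * pi ^+ 2 / K.+2%:R ^+ 2 : R).
Proof.
have D0 : K.+2%:R != 0 :> R by rewrite pnatr_eq0.
have L : ((K%:R / K.+2%:R) * (k%:R ^+ 2 * mu k) * (den K k)^-1 : R) @[k --> \oo]
   --> ((K%:R / K.+2%:R) * pi ^+ 2 * (K.+2%:R)^-1 : R).
  apply: cvgM; last by apply: cvgV => //; exact: cvg_den.
  by apply: cvgM; [exact: cvg_cst | exact: cvg_path_connectivity].
have A (k D p : R) : D != 0 -> k * p / D ^+ 2 = (k / D) * p * D^-1 by move=> d0; field.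
rewrite (A _ _ _ D0); apply: cvg_trans L; apply: near_eq_cvg; near=> k.
have B (a D x m q : R) : a / D * (x * m) * q = x * (a / D * m * q) by ring.
exact: B.
Unshelve. all: by end_near. Qed.

Lemma minimum_exists (S : set R) (s : seq R) : (forall x, S x -> x \in s) ->
  (exists x, S x) -> exists m, is_minimum S m.
Proof.
move=> Ss [x0 Sx0].
pose t := sort <=%R [seq x <- s | `[< S x >]].
have mt x : (x \in t) = `[< S x >].
  rewrite mem_sort mem_filter; case: asboolP => // Sx /=; exact: Ss.
have tsort : sorted <=%R t by apply: sort_sorted; exact: le_total.
have t0 : (0 < size t)%N.
  by case E : t mt => [|a u] // /(_ x0); rewrite in_nil; case: asboolP.
exists t`_0; split; first by apply/asboolP; rewrite -mt mem_nth.
move=> x Sx; have xt : x \in t by rewrite mt; exact/asboolP.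
rewrite -[leRHS](nth_index 0 xt).
by apply: (sorted_leq_nth le_trans lexx 0 tsort); rewrite ?inE ?index_mem.
Qed.

(** The filter is abstract so as to serve both all orders and even orders. The minimum times
    [n ^+ 2] is squeezed: [n / kf n] tends to [K + 2], which turns the limit [K * pi^2 / (K + 2)^2]
    of the upper bound into [K * pi^2]. *)
Lemma asymptotic_minimum (F : set_system nat) (FF : Filter F) (K Q : nat) (S : nat -> set R) (kf : nat -> nat) :
  F --> \oo -> (0 < K)%N ->
  (forall n, exists s : seq R, forall x, S n x -> x \in s) ->
  (\forall n \near F, forall x, S n x ->
     K%:R * mu n / (1 + Num.sqrt (K.+1%:R * (K.+1%:R + 1) * mu n)) ^+ 2 <= x) ->
  (\forall n \near F, (kf n * K.+2 <= n <= kf n * K.+2 + Q)%N) ->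
  (\forall n \near F, exists2 x, S n x & x * den K (kf n) <= K%:R / K.+2%:R * mu (kf n)) ->
  exists2 o : nat -> R, o n @[n --> F] --> (0 : R) &
    \forall n \near F, is_minimum (S n) ((1 + o n) * (K%:R * pi ^+ 2 / n%:R ^+ 2)).
Proof.
move=> Foo K0 fin low kn up.
have kfoo : kf @ F --> \oo.
  apply/cvgnyPge => A; near=> n.
  have : (A * K.+2 + Q <= n)%N by near: n; exact: (Foo _ (nbhs_infty_ge _)).
  have /andP [_] : (kf n * K.+2 <= n <= kf n * K.+2 + Q)%N by near: n.
  by move=> h1 h2; have := leq_trans h2 h1; rewrite leq_add2r leq_pmul2r.
pose m n : R := xget 0 [set m | is_minimum (S n) m].
have K0R : 0 < K%:R :> R by rewrite ltr0n.
have p0 : 0 < pi :> R := pi_gt0 R.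
have D0 : 0 < K.+2%:R :> R by rewrite ltr0n.
have Kp : K%:R * pi ^+ 2 != 0 :> R by rewrite gt_eqF // mulr_gt0 // exprn_gt0.
have mP : \forall n \near F, is_minimum (S n) (m n).
  near=> n; have [x Sx _] : exists2 x, S n x & x * den K (kf n) <= K%:R / K.+2%:R * mu (kf n) by near: n.
  have [s Ss] := fin n; have [y my] := minimum_exists Ss (ex_intro _ x Sx).
  exact: (@xgetPex _ 0 [set m | is_minimum (S n) m] (ex_intro _ y my)).
have npos : \forall n \near F, (0 < n)%N.
  exact: (Foo _ (nbhs_infty_gt 0)).
(* [o] is the relative error of the minimum itself, so the formula is an identity and only the limit
   has content. *)
exists (fun n => m n * n%:R ^+ 2 / (K%:R * pi ^+ 2) - 1); last first.
  near=> n; have n0 : (0 < n)%N by near: n.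
  have n0' : n%:R != 0 :> R by rewrite pnatr_eq0 -lt0n.
  have -> : (1 + (m n * n%:R ^+ 2 / (K%:R * pi ^+ 2) - 1)) * (K%:R * pi ^+ 2 / n%:R ^+ 2) = m n.
    by move: (K%:R * pi ^+ 2) Kp (m n) (n%:R : R) n0' => D D1 w x x0; field; rewrite x0 D1.
  by near: n.
have Lm : (m n * n%:R ^+ 2 : R) @[n --> F] --> (K%:R * pi ^+ 2 : R).
  have ratio : (n%:R / (kf n)%:R : R) @[n --> F] --> (K.+2%:R : R).
    have inv : ((kf n)%:R^-1 : R) @[n --> F] --> (0 : R).
      by apply: (@cvg_comp _ _ _ kf (fun k => k%:R^-1 : R) _ \oo _ kfoo); exact: cvg_invn.
    have L : (K.+2%:R + Q%:R * (kf n)%:R^-1 : R) @[n --> F] --> (K.+2%:R + Q%:R * 0 : R).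
      by apply: cvgD; [exact: cvg_cst | apply: cvgM; [exact: cvg_cst | exact: inv]].
    rewrite mulr0 addr0 in L; apply: (squeeze_cvgr _ (@cvg_cst _ _ _ _ _) L).
    near=> n; have /andP [h1 h2] : (kf n * K.+2 <= n <= kf n * K.+2 + Q)%N by near: n.
    have k0 : 0 < (kf n)%:R :> R.
      by rewrite ltr0n; near: n; exact: (kfoo _ (nbhs_infty_gt 0)).
    rewrite ler_pdivlMr // ler_pdivrMr // [X in _ && (_ <= X)]mulrDl mulfVK ?gt_eqF //.
    by rewrite -natrM mulnC ler_nat h1 /= -natrD ler_nat.
  have U : ((kf n)%:R ^+ 2 * (K%:R / K.+2%:R * mu (kf n) / den K (kf n)) * ((n%:R / (kf n)%:R) * (n%:R / (kf n)%:R)) : R)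
      @[n --> F] --> (K%:R * pi ^+ 2 / K.+2%:R ^+ 2 * (K.+2%:R * K.+2%:R) : R).
    apply: cvgM; last exact: cvgM.
    exact: (@cvg_comp _ _ _ kf (fun k => k%:R ^+ 2 * (K%:R / K.+2%:R * mu k / den K k) : R) _ \oo _ kfoo (@cvg_upper_bound K)).
  rewrite -expr2 mulfVK ?expf_neq0 ?gt_eqF // in U.
  have L : (n%:R ^+ 2 * (K%:R * mu n / (1 + Num.sqrt (K.+1%:R * (K.+1%:R + 1) * mu n)) ^+ 2) : R) @[n --> F]
      --> (K%:R * pi ^+ 2 : R).
    exact: (@cvg_comp _ _ _ id (fun n => n%:R ^+ 2 * (K%:R * mu n / (1 + Num.sqrt (K.+1%:R * (K.+1%:R + 1) * mu n)) ^+ 2) : R) _ \oo _ Foo (@cvg_lower_bound K _)).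
  apply: (squeeze_cvgr _ L U); near=> n.
  have [mS ml] : is_minimum (S n) (m n) by near: n.
  have k0 : (0 < kf n)%N by near: n; exact: (kfoo _ (nbhs_infty_gt 0)).
  have k0R : (kf n)%:R != 0 :> R by rewrite pnatr_eq0 -lt0n.
  rewrite mulrC ler_wpM2r ?sqr_ge0 //=; last first.
    have lo : forall x, S n x -> K%:R * mu n / (1 + Num.sqrt (K.+1%:R * (K.+1%:R + 1) * mu n)) ^+ 2 <= x by near: n.
    exact: lo.
  have [x Sx hx] : exists2 x, S n x & x * den K (kf n) <= K%:R / K.+2%:R * mu (kf n) by near: n.
  have d0 : 0 < den K (kf n).
    by near: n; apply: (kfoo [set k | 0 < den K k]); exact: (@cvgr_gt _ _ _ _ _ _ (@cvg_den K) 0 D0).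
  have E : (kf n)%:R ^+ 2 * (K%:R / K.+2%:R * mu (kf n) / den K (kf n)) * (n%:R / (kf n)%:R * (n%:R / (kf n)%:R)) =
     (K%:R / K.+2%:R * mu (kf n) / den K (kf n)) * n%:R ^+ 2.
    by move: (_ / den K (kf n)) (n%:R : R) ((kf n)%:R : R) k0R => Z z k k1; field.
  rewrite E ler_wpM2r ?sqr_ge0 //; apply: (le_trans (ml _ Sx)).
  by rewrite ler_pdivlMr.
have L : (m n * n%:R ^+ 2 / (K%:R * pi ^+ 2) - 1 : R) @[n --> F] --> ((K%:R * pi ^+ 2) / (K%:R * pi ^+ 2) - 1 : R).
  by apply: cvgB; [apply: cvgM => //; exact: cvg_cst | exact: cvg_cst].
by rewrite divff // subrr in L.
Unshelve. all: by end_near. Qed.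

End Limits.

(** * The minima over the two graph classes *)

Lemma connectivity_finite (R : realType) (n : nat) :
  exists s : seq R, forall G : sgraph, #|G| = n -> algebraic_connectivity R G \in s.
Proof.
pose mu (b : {ffun 'I_n * 'I_n -> bool}) : R := (spectrum (\matrix_(i, j)
  ((\sum_k b (i, k))%N%:R *+ (i == j) - (b (i, j))%:R) : 'M[R]_n))`_1.
exists [seq mu b | b : {ffun 'I_n * 'I_n -> bool}] => G Gn; subst n.
apply/fintype.imageP; exists [ffun p => adj (enum_val p.1) (enum_val p.2)]; first by [].
rewrite /mu /algebraic_connectivity; congr ((spectrum _)`_1).
apply/matrixP => i j; rewrite !mxE ffunE /=; congr (_%:R *+ _ - _).
rewrite degreeE (reindex _ (onW_bij _ (@enum_val_bij G))).
by apply: eq_bigr => k _; rewrite ffunE.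
Qed.

Lemma min_degree_ge (G : sgraph) d : (0 < #|G|)%N -> (forall x : G, (d <= degree x)%N) ->
  (d <= min_degree G)%N.
Proof.
move=> /card_gt0P [x _] Gd; rewrite /min_degree.
elim/big_ind: _ => // [|a b da db]; first exact: leq_trans (Gd x) (max_card _).
by rewrite leq_min da.
Qed.

(** [P] is the degree condition on the graphs, and [Q] bounds the total order of the two end
    graphs. *)
Lemma necklace_asymptotics (R : realType) (F : set_system nat) (FF : Filter F) (K Q : nat)
    (P : sgraph -> Prop) (kf : nat -> nat) :
  F --> \oo -> (2 <= K)%N ->
  (forall G, connected_graph G -> P G -> (K < min_degree G)%N) ->
  (\forall n \near F, exists (H1 H2 : sgraph) (r1 : H1) (r2 : H2),
    [/\ connected_graph H1, connected_graph H2, (#|H1| + #|H2| <= Q)%N,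
        #|necklace r1 r2 (kf n) K| = n & (0 < kf n)%N -> P (necklace r1 r2 (kf n) K)]) ->
  exists2 o : nat -> R, o n @[n --> F] --> (0 : R) &
    \forall n \near F, is_minimum
      [set mu : R | exists G : sgraph,
        [/\ #|G| = n, connected_graph G, P G & algebraic_connectivity R G = mu]]
      ((1 + o n) * ((K.+1%:R - 1) * pi ^+ 2 / n%:R ^+ 2)).
Proof.
move=> Foo K2 Pd neck.
have nkQ : \forall n \near F, (kf n * K.+2 <= n <= kf n * K.+2 + Q)%N.
  near=> n; have [H1 [H2 [r1 [r2 [_ _ HQ Hn _]]]]] : exists (H1 H2 : sgraph) (r1 : H1) (r2 : H2),
    [/\ connected_graph H1, connected_graph H2, (#|H1| + #|H2| <= Q)%N,
        #|necklace r1 r2 (kf n) K| = n & (0 < kf n)%N -> P (necklace r1 r2 (kf n) K)] by near: n.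
  move: Hn; rewrite card_necklace; move: (kf n * K.+2)%N => m; lia.
have KE : K.+1%:R - 1 = K%:R :> R by rewrite -natr1 addrK.
rewrite KE.
apply: (asymptotic_minimum FF Foo (ltnW K2) _ _ nkQ).
- move=> n; have [s sP] := connectivity_finite R n.
  by exists s => x [G [Gn _ _ <-]]; exact: sP.
- near=> n => x [G [Gn Gc PG <-]].
  have := connectivity_lower_bound R (K2 : (3 <= K.+1)%N) Gc (Pd _ Gc PG).
  by rewrite Gn /= KE.
near=> n; have [H1 [H2 [r1 [r2 [H1c H2c _ Hn HP]]]]] : exists (H1 H2 : sgraph) (r1 : H1) (r2 : H2),
    [/\ connected_graph H1, connected_graph H2, (#|H1| + #|H2| <= Q)%N,
        #|necklace r1 r2 (kf n) K| = n & (0 < kf n)%N -> P (necklace r1 r2 (kf n) K)] by near: n.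
have k2 : (2 <= kf n)%N.
  have h1 : (2 * K.+2 + Q <= n)%N by near: n; exact: (Foo _ (nbhs_infty_ge _)).
  have /andP [_ h2] : (kf n * K.+2 <= n <= kf n * K.+2 + Q)%N by near: n.
  by have := leq_trans h1 h2; rewrite leq_add2r leq_pmul2r.
exists (algebraic_connectivity R (necklace r1 r2 (kf n) K)).
  exists (necklace r1 r2 (kf n) K); split => //; last by apply: HP; exact: ltnW.
  by apply: necklace_connected => //; [exact: ltnW | exact: ltnW].
apply: necklace_upper_bound => //; first exact: ltnW.
  by rewrite invr_gt0 ltr0n ltnW.
by rewrite invf_le1 ?ltr0n ?ler1n ltnW.
Unshelve. all: by end_near. Qed.

Lemma min_degree_asymptotics (R : realType) (d : nat) : (3 <= d)%N ->
  exists2 o : nat -> R, o n @[n --> \oo] --> (0 : R) &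
    \forall n \near \oo, is_minimum
      [set mu : R | exists G : sgraph,
        [/\ #|G| = n, connected_graph G, (d <= min_degree G)%N & algebraic_connectivity R G = mu]]
      ((1 + o n) * ((d%:R - 1) * pi ^+ 2 / n%:R ^+ 2)).
Proof.
case: d => [//|K] K2.
(* The vertices of two beads and the remainder of [n] modulo [K.+2] are set aside for the two
   complete end graphs. *)
apply: (@necklace_asymptotics R \oo _ K (3 * K.+2) (fun G => (K < min_degree G)%N)
  (fun n => (n %/ K.+2 - 2)%N)) => //.
near=> n; have hn : (2 * K.+2 <= n)%N by near: n; exact: nbhs_infty_ge.
have q2 : (2 <= n %/ K.+2)%N by rewrite leq_divRL.
have hr : (n %% K.+2 < K.+2)%N by rewrite ltn_mod.
exists (complete_graph K.+2), (complete_graph (n %% K.+2 + K.+1).+1), ord0, ord0; split.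
- exact: complete_connected.
- exact: complete_connected.
- by rewrite !card_ord; lia.
- by rewrite card_necklace !card_ord [RHS](divn_eq n K.+2); nia.
move=> k0; apply: min_degree_ge => [|[[x|[i p]]|x]].
- by rewrite card_necklace card_ord.
- by rewrite degree_top // degree_complete /= leq_addr.
- by rewrite degree_bead.
- rewrite degree_bot // degree_complete /=; lia.
Unshelve. all: by end_near. Qed.

Lemma regular_asymptotics (R : realType) (d : nat) : (3 <= d)%N -> odd d ->
  let even_infty := within [set n : nat | ~~ odd n] \oo in
  exists2 o : nat -> R, o n @[n --> even_infty] --> (0 : R) &
    \forall n \near even_infty, is_minimum
      [set mu : R | exists G : sgraph,
        [/\ #|G| = n, connected_graph G, regular d G & algebraic_connectivity R G = mu]]
      ((1 + o n) * ((d%:R - 1) * pi ^+ 2 / n%:R ^+ 2)).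
Proof.
move=> d3 dodd even_infty; set t := d./2.
have dt : d = t.*2.+1 by rewrite -[LHS](odd_double_half d) dodd.
have t0 : (0 < t)%N by move: d3; rewrite dt; lia.
(* Here [K = 2 t]. An even [n] is [4 t + 6 + 2 m] with [m = a (t + 1) + r]: [a] beads of [2 (t + 1)]
   vertices and circulants on [2 t + 3] and [2 (t + 1 + r) + 1] vertices. *)
rewrite dt; pose m n := (n./2 - (t.*2 + 3))%N.
have FF : Filter even_infty by exact: within_filter.
apply: (@necklace_asymptotics R even_infty FF t.*2 (6 * t + 8) (regular t.*2.+1)
  (fun n => m n %/ t.+1)%N).
- exact: cvg_within.
- by move: t0; lia.
- move=> G [G0 _] Gr; apply: min_degree_ge => // x; by rewrite Gr.
(* Beyond this threshold the truncated subtraction in [m] is exact. *)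
exists (t.*2.*2 + 6)%N => // n; rewrite [_ n]/= => hn nev.
have hr : (m n %% t.+1 < t.+1)%N by rewrite ltn_mod.
have th1 : (t < t.+1)%N by [].
have th2 : (t < t.+1 + m n %% t.+1)%N by rewrite addSn ltnS leq_addr.
(* The matching misses exactly the vertex [ord_max], where the link to the necklace makes up for
   it. *)
have rP h (q : 'I_h.*2.+1) : ((q < h.*2) + (q == ord_max) = 1)%N.
  by rewrite -val_eqE /=; have := ltn_ord q; rewrite ltnS leq_eqVlt; case: ltngtP.
exists (circulant th1 t0), (circulant th2 t0), ord_max, ord_max; split.
- exact: circulant_connected.
- exact: circulant_connected.
- by rewrite !card_ord; lia.
- rewrite card_necklace !card_ord; have := divn_eq (m n) t.+1.
  have : n = (n./2).*2 by rewrite -[LHS](odd_double_half n) (negbTE nev).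
  have -> : (t.*2.+2 = t.+1 * 2)%N by lia.
  move: (m n %/ t.+1)%N (m n %% t.+1)%N => a b nE; rewrite mulnA.
  by move: (a * t.+1)%N hn nE; rewrite /m => c; lia.
move=> k0 [[x|[i p]]|x].
- by rewrite degree_top // degree_circulant -addnA rP addn1.
- by rewrite degree_bead.
- by rewrite degree_bot // degree_circulant -addnA rP addn1.
Qed.

Theorem theorem3p4 (R : realType) :
  (forall (d n : nat) (G : sgraph),
     (3 <= d)%N -> #|G| = n -> connected_graph G -> (d <= min_degree G)%N ->
     let mu_path : R := algebraic_connectivity R (path_graph n) in
     algebraic_connectivity R G >=
       (d%:R - 1) * mu_path
         / (1 + Num.sqrt (d%:R * (d%:R + 1) * mu_path)) ^+ 2)
  /\
  (forall d : nat, (3 <= d)%N ->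
     exists2 o : nat -> R, o n @[n --> \oo] --> (0 : R) &
       \forall n \near \oo,
         is_minimum
           [set mu : R | exists G : sgraph,
              [/\ #|G| = n, connected_graph G, (d <= min_degree G)%N
                & algebraic_connectivity R G = mu]]
           ((1 + o n) * ((d%:R - 1) * pi ^+ 2 / n%:R ^+ 2)))
  /\
  (forall d : nat, (3 <= d)%N -> odd d ->
     let even_infty := within [set n : nat | ~~ odd n] \oo in
     exists2 o : nat -> R, o n @[n --> even_infty] --> (0 : R) &
       \forall n \near even_infty,
         is_minimum
           [set mu : R | exists G : sgraph,
              [/\ #|G| = n, connected_graph G, regular d G
                & algebraic_connectivity R G = mu]]
           ((1 + o n) * ((d%:R - 1) * pi ^+ 2 / n%:R ^+ 2))).
Proof.
split; last by split; [exact: min_degree_asymptotics | exact: regular_asymptotics].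
by move=> d n G d3 <- Gc Gd; exact: connectivity_lower_bound.
Qed.
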